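(* Let $\mathcal{D}=[0,D]^d$ with $D>0$, $d\in\mathbb{N}$, and assume the following. (i) $W$ is a zero-mean Gaussian random field on $\mathcal{D}$ with covariance function $q_W$, and $((\lambda_i,e_i),\,i\in\mathbb{N})$ are the eigenpairs of its covariance operator, $(e_i)_{i\in\mathbb{N}}$ being an orthonormal basis of $L^2(\mathcal{D})$. The $e_i$ are continuously differentiable and there are constants $\alpha,\beta,C_e,C_\lambda>0$ such that for all $i\in\mathbb{N}$ $$\|e_i\|_{L^\infty(\mathcal{D})}\le C_e,\qquad \|\nabla e_i\|_{L^\infty(\mathcal{D})}\le C_e i^\alpha,\qquad \sum_{i=1}^\infty\lambda_i i^\beta\le C_\lambda<\infty.$$ (ii) $F:\mathbb{R}\to\mathbb{R}_+$ is Lipschitz continuous and globally bounded by a constant $C_F>0$, i.e. $F(x)<C_F$ for all $x\in\mathbb{R}$. (iii) $l$ is a Lévy process on $[0,C_F]$ with Lévy triplet $(\gamma_l,b,\nu)$, independent of $W$. There are a constant $\eta>1$ and càdlàg approximations $l^{(\varepsilon_l)}$ of $l$ such that for every $s\in[1,\eta)$ $$\mathbb{E}(|l(t)-l^{(\varepsilon_l)}(t)|^s)\le C_l\,\varepsilon_l,\quad t\in[0,C_F),$$ for $\varepsilon_l>0$, and $$\mathbb{E}(|l(t)|^s)\le C_l\,t^\delta,\quad t\in[0,C_F),$$ with $\delta\in(0,1]$ and a constant $C_l>0$ which may depend on $s$ but is independent of $t$ and $\varepsilon_l$. Let $W^N\approx W$, $N\in\mathbb{N}$, be approximations of $W$ with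 associated rate $R(N)$, given by either the truncated Karhunen-Loève expansion or the grid-interpolation approximation defined in the context. Let $1\le p<\eta$ be a real number and let $g:\mathbb{R}\to\mathbb{R}$ be globally Lipschitz continuous. Then there is a constant $C>0$, independent of $N$ and $\varepsilon_l$, such that $$\|g(l^{(\varepsilon_l)}(F(W^N)))-g(l(F(W)))\|_{L^p(\Omega;L^p(\mathcal{D}))}\le C\big(\varepsilon_l^{1/p}+R(N)^{\delta/p}\big)$$ for all $N\in\mathbb{N}$ and $\varepsilon_l>0$, where $\delta$ is the constant from (iii).
   Context: All random objects live on a complete probability space $(\Omega,\mathcal{F},\mathbb{P})$; $\mathbb{R}_+=[0,\infty)$. A Lévy process is a real-valued stochastic process with $l(0)=0$ a.s., independent and stationary increments, stochastically continuous, and taken to have càdlàg paths; its Lévy triplet is the one in the Lévy-Khinchin formula. A Gaussian random field (GRF) on $\mathcal{D}$ is a family of real random variables indexed by $\mathcal{D}$ with multivariate Gaussian finite-dimensional distributions; GRFs are assumed mean-square continuous and jointly measurable on $\Omega\times\mathcal{D}$. The covariance operator of $W$ is $Q:L^2(\mathcal{D})\to L^2(\mathcal{D})$, $Q(\varphi)(\underline{x})=\int_{\mathcal{D}}q_W(\underline{x},\underline{y})\varphi(\underline{y})\,d\underline{y}$, with $q_W$ the covariance function of $W$; its eigenvalues $(\lambda_i)$ are listed in decreasing order. Approximations $W^N$ of $W$, two options: (a) Truncated Karhunen-Loève expansion: writing $W(\underline{x})=\sum_{i=1}^\infty\sqrt{\lambda_i}Z_ie_i(\underline{x})$ with i.i.d.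 $\mathcal{N}(0,1)$ random variables $Z_i$ (convergence in mean square, uniformly in $\underline{x}\in\mathcal{D}$), set $W^N(\underline{x})=\sum_{i=1}^N\sqrt{\lambda_i}Z_ie_i(\underline{x})$. In this case $R(N)=N^{-\beta/2}$. (b) Grid interpolation: $W^N$ is obtained by evaluating $W$ at the points of the grid $\{(x_{i^{(1)}},\dots,x_{i^{(d)}})\}$, where $(x_i)$ is an equidistant grid on $[0,D]$ with maximum step size $1/N$, and by multilinear interpolation between the grid points. In this case $R(N)=N^{-\gamma}$ with $\gamma<\min(1,\beta/(2\alpha))$. Here $l(F(W))$ denotes the random field $\underline{x}\mapsto l(F(W(\underline{x})))$, and similarly for $l^{(\varepsilon_l)}(F(W^N))$. For a random field $X$, $\|X\|_{L^p(\Omega;L^p(\mathcal{D}))}=\big(\mathbb{E}\int_{\mathcal{D}}|X(\underline{x})|^p\,d\underline{x}\big)^{1/p}$.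
   Formalization: The formal theorem assumes that for every ε_l>0 the pair (l, l^(ε_l)) is jointly independent of W, not only l; without this the claim fails (l^(ε_l) may jump exactly at the random time F(W)). *)

(* Defs.v *)
From HB Require Import structures.
From mathcomp Require Import all_boot all_order all_algebra.
From mathcomp Require Import all_classical all_reals all_analysis.

Set Implicit Arguments.
Unset Strict Implicit.
Unset Printing Implicit Defensive.

Import Order.TTheory GRing.Theory Num.Theory.
Import numFieldNormedType.Exports.

Local Open Scope classical_set_scope.
Local Open Scope ring_scope.

Section rV_measurable.
Context {R : realType} (n : nat).

(* The Borel sigma-algebra of R^n as the product sigma-algebra, generated by
   the coordinate maps, as the library does for tuples. *)
Let coord (i : 'I_n) (x : 'rV[R]_n) : R := x ord0 i.

Let rV_set0 : g_sigma_preimage coord set0.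
Proof. exact: sigma_algebra0. Qed.

Let rV_setC A : g_sigma_preimage coord A -> g_sigma_preimage coord (~` A).
Proof. exact: sigma_algebraC. Qed.

Let rV_bigcup (F : _^nat) : (forall i, g_sigma_preimage coord (F i)) ->
  g_sigma_preimage coord (\bigcup_i (F i)).
Proof. exact: sigma_algebra_bigcup. Qed.

HB.instance Definition _ := @isMeasurable.Build default_measure_display
  'rV[R]_n (g_sigma_preimage coord) rV_set0 rV_setC rV_bigcup.

Lemma measurable_coord (i : 'I_n) :
  measurable_fun [set: 'rV[R]_n] (fun x : 'rV[R]_n => x ord0 i).
Proof.
move=> _ Y mY; rewrite setTI; apply: sub_sigma_algebra => /=.
rewrite -bigcup_seq/=; exists i => /=; first by rewrite mem_index_enum.
by exists Y => //; rewrite setTI.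
Qed.

Definition row_of_tuple (t : n.-tuple (measurableTypeR R)) : 'rV[R]_n := \row_i tnth t i.

Lemma measurable_row_of_tuple : measurable_fun [set: n.-tuple (measurableTypeR R)]
  row_of_tuple.
Proof.
have H : g_sigma_preimage coord `<=`
    [set A | measurable (row_of_tuple @^-1` A)].
  apply: smallest_sub.
    split => [|A|F]/=.
    - by rewrite preimage_set0.
    - by move=> mA; rewrite setTD preimage_setC; exact: measurableC.
    - by move=> mF; rewrite preimage_bigcup; exact: bigcup_measurable.
  rewrite -bigcup_seq; apply: bigcup_sub => i _ _ [B mB <-] /=.
  rewrite setTI.
  rewrite (_ : _ @^-1` _ = (fun t : n.-tuple (measurableTypeR R) => tnth t i) @^-1` B).
    by rewrite -[X in measurable X]setTI; exact: measurable_tnth.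
  by apply/seteqP; split => t /=; rewrite /coord mxE.
by move=> _ A mA; rewrite setTI; exact: H.
Qed.

End rV_measurable.

Lemma sigma_finite_pushforward d1 d2 (T1 : measurableType d1)
    (T2 : measurableType d2) (R : realType) (m : set T1 -> \bar R)
    (f : T1 -> T2) (g : T2 -> T1) :
  sigma_finite [set: T1] m -> measurable_fun [set: T2] g -> cancel f g ->
  sigma_finite [set: T2] (pushforward m f).
Proof.
move=> [F TF Foo] mg fK; exists (fun k => g @^-1` F k).
  by rewrite -preimage_bigcup -TF preimage_setT.
move=> k; have [mFk Fkoo] := Foo k; split.
  by rewrite -[X in measurable X]setTI; exact: mg.
rewrite /pushforward (_ : f @^-1` _ = F k)//.
by apply/seteqP; split => x /=; rewrite fK.
Qed.

Lemma sigma_finite_product d1 d2 (T1 : measurableType d1)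
    (T2 : measurableType d2) (R : realType)
    (m1 : {sigma_finite_measure set T1 -> \bar R})
    (m2 : {sigma_finite_measure set T2 -> \bar R}) :
  sigma_finite [set: T1 * T2] (m1 \x m2)%E.
Proof.
have /sigma_finiteP[F [TF ndF Foo]] := sigma_finiteT m1.
have /sigma_finiteP[G [TG ndG Goo]] := sigma_finiteT m2.
exists (fun n => F n `*` G n).
  rewrite -setXTT TF TG predeqE => -[x y]; split.
    move=> [/= [n _ Fnx] [k _ Gky]]; exists (maxn n k) => //; split.
    - by move: x Fnx; exact/subsetPset/ndF/leq_maxl.
    - by move: y Gky; exact/subsetPset/ndG/leq_maxr.
  by move=> [n _ []/= ? ?]; split; exists n.
move=> k; have [? ?] := Foo k; have [? ?] := Goo k.
split; first exact: measurableX.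
by rewrite product_measure1E// lte_mul_pinfty// ge0_fin_numE.
Qed.

Section lebesgue_rV.
Context {R : realType}.

Definition tuple_cons n (z : measurableTypeR R * n.-tuple (measurableTypeR R)) : n.+1.-tuple (measurableTypeR R) :=
  [tuple of z.1 :: z.2].

Definition tuple_uncons n (t : n.+1.-tuple (measurableTypeR R)) : measurableTypeR R * n.-tuple (measurableTypeR R) :=
  (thead t, [tuple of behead t]).

Lemma tuple_consK n : cancel (@tuple_cons n) (@tuple_uncons n).
Proof. by move=> [x t]; congr pair; apply/val_inj. Qed.

Lemma measurable_tuple_cons n : measurable_fun setT (@tuple_cons n).
Proof. exact: measurable_cons. Qed.

Lemma measurable_tuple_uncons n : measurable_fun setT (@tuple_uncons n).
Proof.
apply: measurable_fun_pair; first exact: measurable_tnth.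
exact: measurable_behead.
Qed.

Section tuple_step.
Variables (n : nat) (m : {sigma_finite_measure set (n.-tuple (measurableTypeR R)) -> \bar R}).

Definition lebesgue_tupleS : set (n.+1.-tuple (measurableTypeR R)) -> \bar R :=
  pushforward (lebesgue_measure \x m)%E (@tuple_cons n).

Let mc := @measurable_tuple_cons n.

Let lebesgue_tupleS0 : lebesgue_tupleS set0 = 0%E.
Proof. by rewrite /lebesgue_tupleS /pushforward preimage_set0 measure0. Qed.

Let lebesgue_tupleS_ge0 A : (0 <= lebesgue_tupleS A)%E.
Proof. exact: measure_ge0. Qed.

Let lebesgue_tupleS_sigma_additive : semi_sigma_additive lebesgue_tupleS.
Proof.
exact: (measure_semi_sigma_additive
  (s := measure_function_pushforward__canonical__measure_function_Measure
          (lebesgue_measure \x m)%E mc)).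
Qed.

HB.instance Definition _ := isMeasure.Build _ _ _ lebesgue_tupleS
  lebesgue_tupleS0 lebesgue_tupleS_ge0 lebesgue_tupleS_sigma_additive.

Let lebesgue_tupleS_sigma_finite : sigma_finite setT lebesgue_tupleS.
Proof.
apply: sigma_finite_pushforward (@measurable_tuple_uncons n) (@tuple_consK n).
exact: sigma_finite_product.
Qed.

HB.instance Definition _ := Measure_isSigmaFinite.Build _ _ _ lebesgue_tupleS
  lebesgue_tupleS_sigma_finite.

End tuple_step.
End lebesgue_rV.

Fixpoint lebesgue_tuple (R : realType) (n : nat) :
    {sigma_finite_measure set (n.-tuple (measurableTypeR R)) -> \bar R} :=
  match n with
  | 0 => dirac [tuple] : {sigma_finite_measure set (0.-tuple (measurableTypeR R)) -> \bar R}
  | n'.+1 => lebesgue_tupleS (lebesgue_tuple R n')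
  end.

Section lebesgue_rV.
Context {R : realType} {n : nat}.

Definition lebesgue_rV : set 'rV[R]_n -> \bar R :=
  pushforward (lebesgue_tuple R n) (@row_of_tuple R n).

Let lebesgue_rV0 : lebesgue_rV set0 = 0%E.
Proof. by rewrite /lebesgue_rV /pushforward preimage_set0 measure0. Qed.

Let lebesgue_rV_ge0 A : (0 <= lebesgue_rV A)%E.
Proof. rewrite /lebesgue_rV /pushforward; exact: measure_ge0. Qed.

Let lebesgue_rV_sigma_additive : semi_sigma_additive lebesgue_rV.
Proof.
exact: (measure_semi_sigma_additive
  (s := measure_function_pushforward__canonical__measure_function_Measure
          (lebesgue_tuple R n) (@measurable_row_of_tuple R n))).
Qed.

HB.instance Definition _ := isMeasure.Build _ _ _ lebesgue_rV
  lebesgue_rV0 lebesgue_rV_ge0 lebesgue_rV_sigma_additive.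

Let tuple_of_row (x : 'rV[R]_n) : n.-tuple (measurableTypeR R) :=
  [tuple x ord0 i | i < n].

Let lebesgue_rV_sigma_finite : sigma_finite setT lebesgue_rV.
Proof.
have mt : measurable_fun setT tuple_of_row.
  apply/measurable_fun_tnthP => i.
  rewrite (_ : _ \o _ = fun x : 'rV[R]_n => x ord0 i).
    exact: measurable_coord.
  by apply/funext => x /=; rewrite tnth_mktuple.
apply: (sigma_finite_pushforward (sigma_finiteT _) mt) => t.
by apply: eq_from_tnth => i; rewrite tnth_mktuple mxE.
Qed.

HB.instance Definition _ := Measure_isSigmaFinite.Build _ _ _ lebesgue_rV
  lebesgue_rV_sigma_finite.

End lebesgue_rV.

Lemma lebesgue_tuple_box (R : realType) n (A : 'I_n -> set (measurableTypeR R)) :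
  (forall i, measurable (A i)) ->
  lebesgue_tuple R n [set t | forall i, A i (tnth t i)] =
  (\prod_(i < n) lebesgue_measure (A i))%E.
Proof.
elim: n A => [|n IH] A mA.
  rewrite big_ord0 /= diracE mem_set//= => -[]//.
rewrite big_ord_recl /= -IH//.
rewrite /lebesgue_tupleS /pushforward.
rewrite (_ : _ @^-1` _ = A ord0 `*`
    [set t : n.-tuple (measurableTypeR R) | forall i, A (lift ord0 i) (tnth t i)]).
  rewrite product_measure1E//.
  rewrite (_ : [set _ | _] = \big[setI/setT]_(i < n)
      ((fun t : n.-tuple (measurableTypeR R) => tnth t i) @^-1` A (lift ord0 i))).
    apply: bigsetI_measurable => i _.
    by rewrite -[X in measurable X]setTI; exact: measurable_tnth.
  rewrite -bigcap_seq; apply/seteqP; split => t /= H i.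
    by move=> _ /=; exact: H.
  by apply: (H i); rewrite /= mem_index_enum.
apply/seteqP; split => -[x t] /=.
  move=> H; split; first exact: (H ord0).
  by move=> i; have := H (lift ord0 i); rewrite tnthS.
move=> [Ax At] i; case: (unliftP ord0 i) => [j ->|->]//.
by rewrite tnthS.
Qed.

Lemma lebesgue_rV_box (R : realType) n (A : 'I_n -> set R) :
  (forall i, measurable (A i)) ->
  lebesgue_rV [set x : 'rV[R]_n | forall i, A i (x ord0 i)] =
  (\prod_(i < n) lebesgue_measure (A i))%E.
Proof.
move=> mA; rewrite -lebesgue_tuple_box//; congr (lebesgue_tuple R n _).
by apply/seteqP; split => t /= H i; have := H i; rewrite mxE.
Qed.

Section cube.
Context {R : realType} (n : nat).
Implicit Types (D : set 'rV[R]_n) (f g : 'rV[R]_n -> R) (L : R).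

Definition cube L : set 'rV[R]_n :=
  [set x | forall j, 0 <= x ord0 j <= L].

Lemma measurable_cube L : measurable (cube L).
Proof.
rewrite (_ : cube L = \big[setI/setT]_(j < n)
    ((fun x : 'rV[R]_n => x ord0 j) @^-1` `[0, L])).
  apply: bigsetI_measurable => j _.
  by rewrite -[X in measurable X]setTI; exact: measurable_coord.
rewrite -bigcap_seq; apply/seteqP; split => x /= H j.
  by move=> _ /=; rewrite in_itv /=; exact: H.
by have := H j (mem_index_enum _); rewrite /= in_itv.
Qed.

Definition lebesgue_cube L := mrestr (@lebesgue_rV R n) (measurable_cube L).

HB.instance Definition _ L := Measure.on (lebesgue_cube L).

Definition inner_L2 D f g : R := \int[lebesgue_rV]_(x in D) (f x * g x).

Definition mem_L2 D f : Prop :=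
  measurable_fun D f /\ (\int[lebesgue_rV]_(x in D) (f x ^+ 2)%:E < +oo)%E.

Definition orthonormal_basis_L2 D (e : nat -> 'rV[R]_n -> R) : Prop :=
  [/\ forall i, mem_L2 D (e i),
      forall i j, inner_L2 D (e i) (e j) = (i == j)%:R
    & forall f, mem_L2 D f ->
        (\int[lebesgue_rV]_(x in D)
           ((f x - \sum_(i < k) inner_L2 D f (e i) * e i x) ^+ 2)%:E)%E
          @[k --> \oo] --> 0%E].

Definition euclidean_norm (v : 'rV[R]_n) : R :=
  Num.sqrt (\sum_(j < n) v ord0 j ^+ 2).

Definition gradient f (x : 'rV[R]_n) : 'rV[R]_n :=
  \row_j 'D_(delta_mx ord0 j) f x.

(* C^1 on a closed domain: the gradient exists in the interior of D and extends
   continuously to D. *)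
Definition continuously_differentiable_on D f : Prop :=
  [/\ {within D, continuous f},
      forall x, D° x -> differentiable f x
    & exists2 G : 'rV[R]_n -> 'rV[R]_n, {within D, continuous G} &
        forall x, D° x -> G x = gradient f x].

End cube.
Arguments cube {R} n L _.
Arguments lebesgue_cube {R} n L _.

Section probability.
Context {R : realType} (d : measure_display) (T : measurableType d).
Variable P : probability T R.

Definition equal_in_law (X Y : T -> R) : Prop :=
  forall B : set R, measurable B -> P (X @^-1` B) = P (Y @^-1` B).

(* Taking some of the B i to be the whole line gives the product rule for every
   subfamily. *)
Definition mutually_independent n (X : 'I_n -> T -> R) : Prop :=
  forall B : 'I_n -> set R, (forall i, measurable (B i)) ->
    P (\bigcap_(i in [set: 'I_n]) (X i @^-1` B i)) =
    (\prod_(i < n) P (X i @^-1` B i))%E.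

Definition events_of (I : Type) (S : set I) (X : I -> T -> R) : set (set T) :=
  \bigcup_(i in S) preimage_set_system [set: T] (X i) measurable.

Definition independent_sigma (G H : set (set T)) : Prop :=
  forall A B, <<s G >> A -> <<s H >> B -> P (A `&` B) = (P A * P B)%E.

(* The library's [normal_prob m 0] is not the Dirac mass at [m], whence the
   separate degenerate case. *)
Definition gaussian_variable (X : T -> R) : Prop :=
  measurable_fun [set: T] X /\
  exists m s : R,
    if s == 0 then {ae P, forall w, X w = m}
    else forall B : set R, measurable B -> P (X @^-1` B) = normal_prob m s B.

Definition gaussian_vector n (X : 'I_n -> T -> R) : Prop :=
  forall a : 'I_n -> R, gaussian_variable (fun w => \sum_(i < n) a i * X i w).

Section random_fields.
Variables (n : nat) (D : set 'rV[R]_n).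

Definition mean_square_continuous (W : 'rV[R]_n -> T -> R) : Prop :=
  forall x, D x ->
    'E_P[(fun w => (W y w - W x w) ^+ 2)%R]%E @[y --> within D (nbhs x)] --> 0%E.

Definition gaussian_random_field (W : 'rV[R]_n -> T -> R) : Prop :=
  [/\ forall k (x : 'I_k -> 'rV[R]_n), (forall i, D (x i)) ->
        gaussian_vector (fun i => W (x i)),
      mean_square_continuous W
    & measurable_fun ([set: T] `*` D)
        (fun z : T * 'rV[R]_n => W z.2 z.1)].

Definition covariance_function (W : 'rV[R]_n -> T -> R) (x y : 'rV[R]_n) : R :=
  fine (covariance P (W x) (W y)).

Definition covariance_operator (W : 'rV[R]_n -> T -> R) (f : 'rV[R]_n -> R)
    (x : 'rV[R]_n) : R :=
  \int[lebesgue_rV]_(y in D) (covariance_function W x y * f y).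

(* Q e_i = lambda_i e_i is an identity in L^2(D), hence almost everywhere. The
   indices start at 0: [lambda i] is the (i + 1)-st eigenvalue. *)
Definition covariance_eigenpairs (W : 'rV[R]_n -> T -> R)
    (lambda : nat -> R) (e : nat -> 'rV[R]_n -> R) : Prop :=
  [/\ orthonormal_basis_L2 D e,
      forall i, {ae lebesgue_rV, forall x, D x ->
        covariance_operator W (e i) x = lambda i * e i x}
    & nonincreasing_seq lambda].

Definition LpLp_norm (p : R) (X : 'rV[R]_n -> T -> R) : \bar R :=
  ((\int[P]_w \int[lebesgue_rV]_(x in D) (`|X x w| `^ p)%:E) `^ p^-1)%E.

End random_fields.

Section levy.
Variable b : R.

Definition cadlag_paths (X : R -> T -> R) : Prop :=
  forall w,
    (forall t, 0 <= t < b -> X s w @[s --> t^'+] --> X t w) /\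
    (forall t, 0 < t <= b -> cvg (X s w @[s --> t^'-])).

Definition independent_increments (X : R -> T -> R) : Prop :=
  forall k (t : nat -> R), (forall i, 0 <= t i <= b) ->
    {homo t : i j / (i <= j)%N >-> i <= j} ->
    mutually_independent (fun (i : 'I_k) w => X (t i.+1) w - X (t i) w).

Definition stationary_increments (X : R -> T -> R) : Prop :=
  forall s h, 0 <= s -> 0 <= h -> s + h <= b ->
    equal_in_law (fun w => X (s + h) w - X s w) (X h).

Definition stochastically_continuous (X : R -> T -> R) : Prop :=
  forall t eps, 0 <= t <= b -> 0 < eps ->
    P [set w | `|X s w - X t w| > eps]
      @[s --> within `[0, b] (nbhs t)] --> 0%E.

Definition cadlag_process (X : R -> T -> R) : Prop :=
  (forall t, 0 <= t <= b -> measurable_fun [set: T] (X t)) /\ cadlag_paths X.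

Definition levy_process (X : R -> T -> R) : Prop :=
  [/\ cadlag_process X, {ae P, forall w, X 0 w = 0},
      independent_increments X, stationary_increments X
    & stochastically_continuous X].

(* The real and imaginary parts of the Lévy-Khinchin exponent
   i gamma u - sigma2 / 2 u^2
     + int (e^(i u y) - 1 - i u y 1_{|y| <= 1}) nu(dy). *)
Definition levy_exponent_re (sigma2 : R) (nu : {measure set R -> \bar R})
    (u : R) : R :=
  - (sigma2 / 2) * u ^+ 2 + \int[nu]_y (cos (u * y) - 1).

Definition levy_exponent_im (gamma : R) (nu : {measure set R -> \bar R})
    (u : R) : R :=
  gamma * u + \int[nu]_y (sin (u * y) - u * y * \1_`[-1, 1] y).

Definition levy_measure (nu : {measure set R -> \bar R}) : Prop :=
  nu [set 0] = 0%E /\ (\int[nu]_y (Num.min 1 (y ^+ 2))%:E < +oo)%E.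

(* The Lévy-Khinchin formula E(e^(i u X_t)) = e^(t psi(u)) is split into real and
   imaginary parts. *)
Definition levy_triplet (X : R -> T -> R) (gamma sigma2 : R)
    (nu : {measure set R -> \bar R}) : Prop :=
  [/\ 0 <= sigma2, levy_measure nu
    & forall t u, 0 <= t <= b ->
        'E_P[(fun w => cos (u * X t w))%R]%E =
          (expR (t * levy_exponent_re sigma2 nu u) *
           cos (t * levy_exponent_im gamma nu u))%:E /\
        'E_P[(fun w => sin (u * X t w))%R]%E =
          (expR (t * levy_exponent_re sigma2 nu u) *
           sin (t * levy_exponent_im gamma nu u))%:E].

End levy.

Section approximations.
Variables (n : nat) (L : R).
Local Notation D := (cube n L).

Definition iid_standard_normal (Z : nat -> T -> R) : Prop :=
  [/\ forall i, measurable_fun [set: T] (Z i),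
      forall k, mutually_independent (fun i : 'I_k => Z i)
    & forall i (B : set R), measurable B ->
        P (Z i @^-1` B) = normal_prob 0 1 B].

Definition KL_sum (lambda : nat -> R) (e : nat -> 'rV[R]_n -> R)
    (Z : nat -> T -> R) (N : nat) (x : 'rV[R]_n) (w : T) : R :=
  \sum_(i < N) Num.sqrt (lambda i) * Z i w * e i x.

Definition KL_approximation (lambda : nat -> R) (e : nat -> 'rV[R]_n -> R)
    (W : 'rV[R]_n -> T -> R) (WN : nat -> 'rV[R]_n -> T -> R) : Prop :=
  exists Z : nat -> T -> R,
    [/\ iid_standard_normal Z,
        forall eps : R, 0 < eps -> \forall N \near \oo, forall x, D x ->
          ('E_P[(fun w => (W x w - KL_sum lambda e Z N x w) ^+ 2)%R] <= eps%:E)%E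
      & forall N x w, (0 < N)%N -> D x -> WN N x w = KL_sum lambda e Z N x w].

(* The nodes of the equidistant grid with m steps of length L / m in each
   coordinate. *)
Definition grid_point m (k : {ffun 'I_n -> 'I_m.+1}) : 'rV[R]_n :=
  \row_j ((k j)%:R * (L / m%:R)).

(* The piecewise linear nodal basis function of the node k * (L / m). *)
Definition hat m (k : nat) (t : R) : R :=
  Num.max 0 (1 - `|t / (L / m%:R) - k%:R|).

(* On each cell this is affine in each coordinate separately, and it agrees with
   f at the nodes. *)
Definition multilinear_interpolation m (f : 'rV[R]_n -> R) (x : 'rV[R]_n) : R :=
  \sum_(k : {ffun 'I_n -> 'I_m.+1})
    f (grid_point k) * \prod_(j < n) hat m (k j) (x ord0 j).

Definition grid_approximation (W : 'rV[R]_n -> T -> R)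
    (WN : nat -> 'rV[R]_n -> T -> R) : Prop :=
  exists m : nat -> nat, forall N, (0 < N)%N ->
    [/\ (0 < m N)%N, L / (m N)%:R <= N%:R^-1
      & forall x w, D x ->
          WN N x w = multilinear_interpolation (m N) (W^~ w) x].

Definition field_approximation (alpha beta : R) (lambda : nat -> R)
    (e : nat -> 'rV[R]_n -> R) (W : 'rV[R]_n -> T -> R)
    (WN : nat -> 'rV[R]_n -> T -> R) (rate : nat -> R) : Prop :=
  (KL_approximation lambda e W WN /\
     forall N, (0 < N)%N -> rate N = N%:R `^ (- (beta / 2)))
  \/
  (grid_approximation W WN /\
     exists2 gamma : R, gamma < Num.min 1 (beta / (2 * alpha)) &
       forall N, (0 < N)%N -> rate N = N%:R `^ (- gamma)).

End approximations.

End probability.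

(* Main.v *)
Require Import Defs.
From HB Require Import structures.
From mathcomp Require Import all_boot all_order all_algebra.
From mathcomp Require Import all_classical all_reals all_analysis.
From mathcomp Require Import ring lra.
From mathcomp Require Import measurable_realfun ess_sup_inf.
Set Implicit Arguments.
Unset Strict Implicit.
Unset Printing Implicit Defensive.
Import Order.TTheory GRing.Theory Num.Theory.
Import numFieldNormedType.Exports.
Local Open Scope classical_set_scope.
Local Open Scope ring_scope.

(** The fields [W] and [W^N] are independent of [(l, l^eps)], so that conditionally on them the
    processes are evaluated at the deterministic times [t = F(W^N(x))] and [s = F(W(x))]. The
    stationarity of the increments and the moment bounds give
    [E|l^eps(t) - l(s)|^p <= C (eps + |t - s|^delta)], and
    [E|Y|^delta <= r^delta (1 + E Y^2 / r^2)] reduces the theorem to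
    [sup_x E(W^N(x) - W(x))^2 <= C R(N)^2].

    For the Karhunen-Loève expansion this is the tail of the eigenvalue series. The variables
    [Z_i] need not be functions of [W], but [sqrt(lambda_i) Z_i] is the L^2 limit of quadratures
    of [int W e_i], hence almost surely equal to one. For the grid, the interpolation
    weights form a partition of unity, and one needs [E(W(x) - W(y))^2 <= C |x - y|^(2 theta)]
    with [theta = min(1, beta / (2 alpha))]: interpolate between the sup and the Lipschitz bounds
    of [e_i] in [sum_i lambda_i (e_i(x) - e_i(y))^2], which is the left-hand side for almost all
    [x] and [y], and use mean-square continuity for the others. *)

(** Conditioning is done without conditional expectations. By independence, the identity of [Omega],
    taken once into the sigma-algebra of the processes and once into that of [W], has the product
    law, and Tonelli integrates the first copy while the second is frozen. This asks for joint
    measurability of the composed processes, which is where right-continuity enters, and for random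
    times that are measurable for [W] itself, which is why versions of [W^N] are constructed.

    The free parameter [r] in the bound of [|Y|^delta] is set to [R(N)]: a second moment of order
    [R(N)^2] then yields [R(N)^delta], and the p-th root produces both exponents of the theorem.

    Two obstacles shape the analysis of the covariance. The eigenvalue equations hold only almost
    everywhere, so the Mercer expansion is proved at the points where all of them hold, which are
    dense in the cube. And the eigenvalues are not nonnegative by assumption: for the Mercer series
    the sign is derived from the convergence of the expansion, while in the Karhunen-Loève sum a
    negative eigenvalue has square root 0. *)

Section square_moment.
Context d (T : measurableType d) (R : realType).
Variables (mu : {measure set T -> \bar R}) (D : set T) (mD : measurable D).
Implicit Types f g : T -> R.

Lemma sqrD_le (a b : R) : (a + b) ^+ 2 <= 2 * a ^+ 2 + 2 * b ^+ 2.
Proof. by have := sqr_ge0 (a - b); lra. Qed.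

Lemma measurable_EFin_sqr f : measurable_fun D f ->
  measurable_fun D (fun x => (f x ^+ 2)%:E).
Proof. by move=> mf; apply/measurable_EFinP; exact: measurable_funX. Qed.

Lemma integral_sqrD_le f g : measurable_fun D f -> measurable_fun D g ->
  (\int[mu]_(x in D) ((f x + g x) ^+ 2)%:E <=
   2%:E * \int[mu]_(x in D) (f x ^+ 2)%:E +
   2%:E * \int[mu]_(x in D) (g x ^+ 2)%:E)%E.
Proof.
move=> mf mg.
have mf2 := measurable_EFin_sqr mf; have mg2 := measurable_EFin_sqr mg.
rewrite -!ge0_integralZl//; try by move=> x _; rewrite lee_fin sqr_ge0.
rewrite -ge0_integralD//=.
- apply: ge0_le_integral => //=.
  + by move=> x _; rewrite lee_fin sqr_ge0.
  + exact/measurable_EFin_sqr/measurable_funD.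
  + by apply: emeasurable_funD; exact: measurable_funeM.
  + by move=> x _; rewrite -!EFinM -EFinD lee_fin sqrD_le.
- by move=> x _; rewrite -EFinM lee_fin mulr_ge0// sqr_ge0.
- exact: measurable_funeM.
- by move=> x _; rewrite -EFinM lee_fin mulr_ge0// sqr_ge0.
- exact: measurable_funeM.
Qed.

(** Cauchy-Schwarz for the weights |c_k|: after symmetrising the double sum on the right, it follows
    termwise from 2|ab| <= a^2 + b^2. *)
Lemma sqr_sum_le (I : finType) (c f : I -> R) :
  (\sum_k c k * f k) ^+ 2 <= (\sum_k `|c k|) * \sum_k `|c k| * f k ^+ 2.
Proof.
have -> : (\sum_k `|c k|) * \sum_k `|c k| * f k ^+ 2 =
    2^-1 * \sum_k \sum_l `|c k| * `|c l| * (f k ^+ 2 + f l ^+ 2).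
  rewrite [in RHS](eq_bigr (fun k => \sum_l `|c k| * `|c l| * f k ^+ 2 +
      \sum_l `|c k| * `|c l| * f l ^+ 2)); last first.
    by move=> k _; rewrite -big_split; apply: eq_bigr => l _; rewrite mulrDr.
  rewrite big_split /= [X in _ * (X + _)]exchange_big /=.
  rewrite (_ : \sum_j \sum_i _ = \sum_i \sum_j `|c i| * `|c j| * f j ^+ 2); last first.
    by apply: eq_bigr => i _; apply: eq_bigr => j _; rewrite (mulrC `|c j|).
  rewrite -mulr2n -(mulr_natl (\sum_i _)) mulrA mulVf ?pnatr_eq0// mul1r.
  rewrite mulr_suml; apply: eq_bigr => i _; rewrite mulr_sumr.
  by apply: eq_bigr => j _; rewrite mulrA.
rewrite mulr_sumr expr2 mulr_suml; apply: ler_sum => k _.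
rewrite mulr_sumr mulr_sumr; apply: ler_sum => l _.
apply: (@le_trans _ _ (`|c k| * `|c l| * (`|f k| * `|f l|))).
  by apply: (le_trans (ler_norm _)); rewrite !normrM mulrACA.
rewrite [leRHS]mulrCA ler_wpM2l ?mulr_ge0//.
rewrite -(real_normK (num_real (f k))) -(real_normK (num_real (f l))).
by have := sqr_ge0 (`|f k| - `|f l|); lra.
Qed.

(** The bound is asked only where [c k != 0], so that in an interpolation the distant nodes, whose
    weights vanish, require no estimate. *)
Lemma integral_sqr_sum_le (I : finType) (c : I -> R) (f : I -> T -> R) (B : R) :
  (forall k, measurable_fun D (f k)) ->
  (forall k, c k != 0 -> (\int[mu]_(x in D) (f k x ^+ 2)%:E <= B%:E)%E) ->
  (\int[mu]_(x in D) ((\sum_k c k * f k x) ^+ 2)%:E <=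
    ((\sum_k `|c k|) ^+ 2 * B)%:E)%E.
Proof.
move=> mf fB.
have mf2 k := measurable_EFin_sqr (mf k).
have f20 k x : D x -> (0 <= (f k x ^+ 2)%:E)%E by rewrite lee_fin sqr_ge0.
pose S : R := \sum_k `|c k|; rewrite -/S; have S0 : 0 <= S by exact: sumr_ge0.
apply: (@le_trans _ _ (S%:E * \sum_k (`|c k|%:E * \int[mu]_(x in D) (f k x ^+ 2)%:E)))%E.
  rewrite (eq_bigr (fun k => \int[mu]_(x in D) (`|c k|%:E * (f k x ^+ 2)%:E))%E); last first.
    by move=> k _; rewrite ge0_integralZl//; exact: f20.
  rewrite -ge0_integral_sum//; last 2 first.
  - by move=> k; exact: measurable_funeM.
  - by move=> k x Dx; rewrite -EFinM lee_fin mulr_ge0// sqr_ge0.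
  rewrite -ge0_integralZl//; last 2 first.
  - by apply: emeasurable_sum => k; exact: measurable_funeM.
  - by move=> x Dx; apply: sume_ge0 => k _; rewrite -EFinM lee_fin mulr_ge0// sqr_ge0.
  apply: ge0_le_integral => //.
  - by move=> x _; rewrite lee_fin sqr_ge0.
  - by apply/measurable_EFin_sqr/measurable_sum => k; exact: measurable_funM.
  - apply: measurable_funeM; apply: emeasurable_sum => k; exact: measurable_funeM.
  - move=> x _; rewrite (eq_bigr (fun k => (`|c k| * f k x ^+ 2)%:E))//.
    by rewrite sumEFin -EFinM lee_fin sqr_sum_le.
rewrite expr2 -mulrA EFinM lee_wpmul2l ?lee_fin// mulr_suml -sumEFin.
apply: lee_sum => k _; have [->|ck0] := eqVneq (c k) 0.
  by rewrite normr0 mul0e mul0r.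
by rewrite EFinM lee_wpmul2l ?lee_fin// fB.
Qed.

End square_moment.

(** * Independence *)

Section independence.
Context d d1 d2 (T : measurableType d) (T1 : measurableType d1)
  (T2 : measurableType d2) (R : realType) (P : probability T R).
Variables (X : T -> T1) (Y : T -> T2).
Hypotheses (mX : measurable_fun setT X) (mY : measurable_fun setT Y).
Hypothesis indep : forall A B, measurable A -> measurable B ->
  (P (X @^-1` A `&` Y @^-1` B) = P (X @^-1` A) * P (Y @^-1` B))%E.

Let X' : {mfun T >-> T1} := HB.pack X (isMeasurableFun.Build _ _ _ _ X mX).
Let Y' : {mfun T >-> T2} := HB.pack Y (isMeasurableFun.Build _ _ _ _ Y mY).
Let mXY : measurable_fun setT (fun w => (X w, Y w)).
Proof. exact: measurable_fun_pair. Qed.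
Let XY' : {mfun T >-> (T1 * T2)%type} :=
  HB.pack (fun w => (X w, Y w)) (isMeasurableFun.Build _ _ _ _ _ mXY).

Lemma distribution_pairE A : measurable A ->
  (distribution P X' \x distribution P Y')%E A = distribution P XY' A.
Proof.
apply: product_measure_unique => {}A B mA mB /=.
by rewrite /distribution /pushforward /= -indep.
Qed.

Lemma ge0_integral_indep (f : T1 * T2 -> \bar R) :
  measurable_fun setT f -> (forall z, 0 <= f z)%E ->
  (\int[P]_w f (X w, Y w) = \int[P]_w2 \int[P]_w1 f (X w1, Y w2))%E.
Proof.
move=> mf f0.
transitivity (\int[distribution P XY']_z f z)%E.
  by rewrite ge0_integral_distribution.
transitivity (\int[distribution P X' \x distribution P Y']_z f z)%E.
  by apply: eq_measure_integral => A mA _; exact/esym/distribution_pairE.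
rewrite fubini_tonelli2// ge0_integral_distribution//=.
- apply: eq_integral => w _ /=; rewrite /fubini_G ge0_integral_distribution//.
  exact: measurableT_comp.
- exact: measurable_fun_fubini_tonelli_G.
- by move=> y; apply: integral_ge0.
Qed.

(** This plays the role of conditioning on [Y]: the moment is bounded for each frozen value of [Y],
    and the bound is then averaged. *)
Lemma ge0_integral_indep_le (f : T1 * T2 -> \bar R) (c : T2 -> \bar R) :
  measurable_fun setT f -> (forall z, 0 <= f z)%E -> measurable_fun setT c ->
  (forall y, \int[P]_w f (X w, y) <= c y)%E ->
  (\int[P]_w f (X w, Y w) <= \int[P]_w c (Y w))%E.
Proof.
move=> mf f0 mc fc; rewrite ge0_integral_indep//; apply: ge0_le_integral => //.
- by move=> w _; exact: integral_ge0.
- rewrite (_ : (fun _ => _) = fubini_G (distribution P X') f \o Y).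
    by apply: measurableT_comp => //; exact: measurable_fun_fubini_tonelli_G.
  apply/funext => w /=; rewrite /fubini_G ge0_integral_distribution//.
  exact: measurableT_comp.
- exact: measurableT_comp.
Qed.

End independence.

(** Tonelli for |XY| gives integrability under the product law; Fubini then integrates over the
    centred factor first, and the inner integral is 0 for every value of the other. *)
Lemma independent_expectationM d (T : measurableType d) (R : realType)
    (P : probability T R) (X Y : T -> R) :
  measurable_fun setT X -> measurable_fun setT Y ->
  (forall A B, measurable A -> measurable B ->
    P (X @^-1` A `&` Y @^-1` B) = P (X @^-1` A) * P (Y @^-1` B))%E ->
  P.-integrable setT (EFin \o X) ->
  P.-integrable setT (EFin \o Y) ->
  (\int[P]_w (X w)%:E = 0 -> \int[P]_w (X w * Y w)%:E = 0)%E.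
Proof.
move=> mX mY indep iX iY EX0.
pose X' : {mfun T >-> R} := HB.pack X (isMeasurableFun.Build _ _ _ _ X mX).
pose Y' : {mfun T >-> R} := HB.pack Y (isMeasurableFun.Build _ _ _ _ Y mY).
have mXY : measurable_fun setT (fun w => (X w, Y w)) by exact: measurable_fun_pair.
pose XY' : {mfun T >-> (R * R)%type} :=
  HB.pack (fun w => (X w, Y w)) (isMeasurableFun.Build _ _ _ _ _ mXY).
pose f := fun z : R * R => (z.1 * z.2)%:E.
have mf : measurable_fun setT f by apply/measurable_EFinP; exact: measurable_funM.
have mY2 (c : R) : measurable_fun setT (fun y : R => (c * y)%:E).
  by apply/measurable_EFinP; exact: measurable_funM.
have finf : (\int[P]_w `|f (X w, Y w)| < +oo)%E.
  pose h z := `|f z|%E.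
  have mh : measurable_fun setT h by exact: measurableT_comp.
  have h0 z : (0 <= h z)%E by exact: abse_ge0.
  rewrite (ge0_integral_indep mX mY indep mh h0).
  rewrite (eq_integral (fun w2 => `|(Y w2)%:E| * \int[P]_w1 `|(X w1)%:E|)%E); last first.
    move=> w _; rewrite -ge0_integralZl//; last by do 2 apply: measurableT_comp => //.
    by apply: eq_integral => w1 _; rewrite /h /f /= normrM mulrC EFinM.
  move/integrableP : iX => [_ iX]; move/integrableP : iY => [_ iY].
  rewrite ge0_integralZr//; [|by do 2 apply: measurableT_comp => //|exact: integral_ge0].
  rewrite lte_mul_pinfty//; first exact: integral_ge0.
  by rewrite ge0_fin_numE//; exact: integral_ge0.
have iXY : P.-integrable setT (f \o XY').
  by apply/integrableP; split => //; exact: measurableT_comp.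
transitivity (\int[distribution P XY']_z f z)%E.
  by rewrite integral_distribution.
transitivity (\int[distribution P X' \x distribution P Y']_z f z)%E.
  by apply: eq_measure_integral => A mA _; exact/esym/distribution_pairE.
have intf : (distribution P X' \x distribution P Y')%E.-integrable setT f.
  apply/integrableP; split => //.
  rewrite (@eq_measure_integral _ _ _ _ (distribution P XY')).
    by rewrite ge0_integral_distribution//; exact: measurableT_comp.
  by move=> A mA _; exact: distribution_pairE.
rewrite -integral21_prod_meas1//; apply: integral0_eq => y _.
transitivity (\int[distribution P X']_x (y%:E * x%:E))%E.
  by apply: eq_integral => x _; rewrite /f /= mulrC EFinM.
have iid : (distribution P X').-integrable setT (EFin : R -> \bar R).
  apply/integrableP; split; first exact: EFin_measurable.
  rewrite ge0_integral_distribution//; last by apply: measurableT_comp.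
  by move/integrableP : iX => [].
by rewrite integralZl// integral_distribution// EX0 mule0.
Qed.

(** * Gaussian moments *)

Section gaussian_moments.
Context {R : realType}.
Local Notation mu := (@lebesgue_measure R).

Lemma emeasurable_normal_pdf (m s : R) :
  measurable_fun setT (fun x => (normal_pdf m s x)%:E).
Proof. by apply/measurable_EFinP; exact: measurable_normal_pdf. Qed.

(** The Radon-Nikodym derivative of the law and [normal_pdf] have the same integral over every
    measurable set, hence agree almost everywhere. *)
Lemma ge0_integral_normal_prob (m s : R) (f : R -> \bar R) :
  measurable_fun setT f -> (forall x, 0 <= f x)%E ->
  (\int[normal_prob m s]_x f x = \int[mu]_x (f x * (normal_pdf m s x)%:E))%E.
Proof.
move=> mf f0.
have dom := normal_prob_dominates m s.
rewrite -(Radon_Nikodym_SigmaFinite.change_of_variables dom f0 measurableT mf).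
have irn := Radon_Nikodym_SigmaFinite.f_integrable dom.
apply: ae_eq_integral => //.
- by apply: emeasurable_funM => //; exact: measurable_int irn.
- by apply: emeasurable_funM => //; exact: emeasurable_normal_pdf.
apply: ae_eqe_mul2l; apply: integral_ae_eq => //.
- by exact: emeasurable_normal_pdf.
- by move=> A _ mA; rewrite -Radon_Nikodym_SigmaFinite.f_integral.
Qed.

(* [x^2 exp(- x^2 / (2 s^2))] is bounded by a multiple of [exp(- x^2 / (4 s^2))]. *)
Lemma normal_prob_sqr_lty (m s : R) : s != 0 ->
  (\int[normal_prob m s]_x (x ^+ 2)%:E < +oo)%E.
Proof.
move=> s0; have mX : measurable_fun setT (fun x : R => (x ^+ 2)%:E).
  by apply/measurable_EFinP; exact: measurable_funX.
rewrite ge0_integral_normal_prob//; last by move=> x; rewrite lee_fin sqr_ge0.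
pose s' := Num.sqrt 2 * s; have s'0 : s' != 0 by rewrite mulf_neq0// sqrtr_eq0 -ltNge.
have p0 := normal_peak_gt0 s'0.
(* With u = (x - m)^2 / (4 s^2), the inequality u exp(-u) <= 1 gives 2 (x - m)^2 exp(-2u) <= 8 s^2
   exp(-u); the quotient of the peaks normalises exp(-u) to the density with parameter [s']. The
   constant [c] below comes from x^2 <= 2 m^2 + 2 (x - m)^2. *)
pose K := normal_peak s * (8 * s ^+ 2) / normal_peak s'.
have K0 : 0 <= K by rewrite divr_ge0 ?normal_peak_ge0// mulr_ge0 ?normal_peak_ge0// mulr_ge0// sqr_ge0.
pose c := 2 * m ^+ 2; have c0 : 0 <= c by rewrite mulr_ge0// sqr_ge0.
have mpdf (t : R) : measurable_fun setT (fun x => (normal_pdf m t x)%:E).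
  by exact: emeasurable_normal_pdf.
apply: (@le_lt_trans _ _ (\int[mu]_x (c%:E * (normal_pdf m s x)%:E +
    K%:E * (normal_pdf m s' x)%:E))%E); last first.
  rewrite ge0_integralD//; last 4 first.
  - by move=> x _; rewrite -EFinM lee_fin mulr_ge0 ?normal_pdf_ge0.
  - exact: (measurable_funeM c%:E (mpdf s)).
  - by move=> x _; rewrite -EFinM lee_fin mulr_ge0 ?normal_pdf_ge0.
  - exact: (measurable_funeM K%:E (mpdf s')).
  rewrite !ge0_integralZl//; try by move=> x _; rewrite lee_fin normal_pdf_ge0.
    by rewrite !integral_normal_pdf !mule1 -EFinD ltry.
  - exact: mpdf.
  - exact: mpdf.
apply: ge0_le_integral => //.
- by move=> x _; rewrite -EFinM lee_fin mulr_ge0 ?sqr_ge0 ?normal_pdf_ge0.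
- exact: (emeasurable_funM mX (mpdf s)).
- exact: (emeasurable_funD (measurable_funeM c%:E (mpdf s)) (measurable_funeM K%:E (mpdf s'))).
move=> x _; rewrite -!EFinM -EFinD lee_fin.
have -> : x ^+ 2 = (m + (x - m)) ^+ 2 by congr (_ ^+ 2); ring.
apply: (le_trans (ler_wpM2r (normal_pdf_ge0 _ _ _) (sqrD_le _ _))).
rewrite mulrDl lerD2l !normal_pdfE// /K.
rewrite [leRHS]mulrA divfK ?gt_eqF//.
rewrite [leLHS]mulrCA -[leRHS]mulrA ler_wpM2l ?normal_peak_ge0//.
rewrite /normal_fun; move: ((x - m) ^+ 2) => y.
have s20 : 0 < s ^+ 2 by rewrite exprn_even_gt0.
have s'2 : s' ^+ 2 = 2 * s ^+ 2 by rewrite exprMn sqr_sqrtr.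
pose u := y / (4 * s ^+ 2).
have yu : y = u * (4 * s ^+ 2) by rewrite /u divfK// mulf_neq0 ?pnatr_eq0// gt_eqF.
have -> : - y / (s ^+ 2 *+ 2) = - u - u by rewrite yu; field.
have -> : - y / (s' ^+ 2 *+ 2) = - u by rewrite s'2 yu; field.
rewrite expRD yu.
have ue : u * expR (- u) <= 1.
  rewrite expRN ler_pdivrMr ?expR_gt0// mul1r (le_trans _ (expR_ge1Dx u))//.
  by rewrite lerDr.
have := expR_ge0 (- u) => e0.
have -> : 2 * (u * (4 * s ^+ 2)) * (expR (- u) * expR (- u)) =
  (8 * s ^+ 2 * expR (- u)) * (u * expR (- u)) by ring.
by rewrite ler_piMr// mulr_ge0// mulr_ge0// ltW.
Qed.

Lemma ge0_integral_lebesgueN (f : R -> \bar R) :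
  measurable_fun setT f -> (forall x, 0 <= f x)%E ->
  (\int[mu]_x f x = \int[mu]_x f (- x)%R)%E.
Proof.
move=> mf f0.
have -> : (\int[mu]_x f (- x)%R =
    \int[pushforward mu (-%R : _ -> measurableTypeR R)]_x f x)%E.
  by rewrite ge0_integral_pushforward//= => y _.
by apply: eq_measure_integral => A mA _; exact/esym/lebesgue_measureN.
Qed.

(** The reflection x -> -x preserves the density and exchanges the positive and negative parts;
    their difference is 0 because the second moment makes both finite. *)
Lemma normal_prob_mean0 (s : R) : s != 0 ->
  (\int[normal_prob 0 s]_x (x%:E) = 0)%E.
Proof.
move=> s0; have mid : measurable_fun setT (EFin : R -> \bar R) by exact: EFin_measurable.
have mp : measurable_fun setT (EFin^\+ : R -> \bar R)%E by exact: measurable_funepos.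
have mn : measurable_fun setT (EFin^\- : R -> \bar R)%E by exact: measurable_funeneg.
rewrite integralE.
have -> : (\int[normal_prob 0 s]_x (EFin^\+ x) = \int[normal_prob 0 s]_x (EFin^\- x))%E.
  rewrite !ge0_integral_normal_prob// ge0_integral_lebesgueN//.
  - apply: eq_integral => x _; congr (_ * _)%E.
      by rewrite funeposE funenegE EFinN.
    by rewrite !normal_pdfE// /normal_fun !subr0 sqrrN.
  - by apply: emeasurable_funM => //; exact: emeasurable_normal_pdf.
  - by move=> x; rewrite mule_ge0// lee_fin normal_pdf_ge0.
rewrite subee//.
rewrite ge0_fin_numE; last exact: integral_ge0.
apply: le_lt_trans (_ : (\int[normal_prob 0%R s]_x (1%:E + (x ^+ 2)%:E) < +oo)%E).
  apply: ge0_le_integral => //.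
  - by apply/measurable_EFinP/measurable_funD => //; exact: measurable_funX.
  - move=> x _; rewrite funenegE -EFinN -EFin_max lee_fin ge_max; apply/andP; split.
      have := sqr_ge0 (x + 2^-1); lra.
    by have := sqr_ge0 x; lra.
rewrite ge0_integralD//.
- rewrite integral_cst// mul1e lte_add_pinfty//.
    exact: le_lt_trans (probability_le1 (normal_prob 0 s) measurableT) (ltry _).
  exact: normal_prob_sqr_lty.
- by move=> x _; rewrite lee_fin sqr_ge0.
- by apply/measurable_EFinP; exact: measurable_funX.
Qed.

End gaussian_moments.

(** * Second moments of Gaussian and of independent variables *)

Section iid.
Context d (T : measurableType d) (R : realType) (P : probability T R).

(** The product rule for the first max(i, j) + 1 variables, with the whole line as the event of all
    the others. *)
Lemma mutually_independent_pair (Z : nat -> T -> R) i j (A B : set R) :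
  (forall i, measurable_fun setT (Z i)) ->
  (forall k, mutually_independent P (fun i : 'I_k => Z i)) -> i != j ->
  measurable A -> measurable B ->
  (P (Z i @^-1` A `&` Z j @^-1` B) = P (Z i @^-1` A) * P (Z j @^-1` B))%E.
Proof.
move=> mZ indZ ij mA mB; set k := (maxn i j).+1.
have ik : (i < k)%N by rewrite ltnS leq_maxl.
have jk : (j < k)%N by rewrite ltnS leq_maxr.
pose C (t : 'I_k) : set R := if t == i :> nat then A else if t == j :> nat then B else setT.
have mC t : measurable (C t) by rewrite /C; case: ifP => _ //; case: ifP.
have := indZ k C mC.
rewrite (bigD1 (Ordinal ik))//= (bigD1 (Ordinal jk)) /=; last first.
  by apply/eqP => -[] /esym; apply/eqP.
rewrite big1 ?mule1; last first.
  move=> t /andP[ti tj]; rewrite /C.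
  have -> : (t == i :> nat) = false by apply: contraNF ti => /eqP ti; apply/eqP/val_inj.
  have -> : (t == j :> nat) = false by apply: contraNF tj => /eqP tj; apply/eqP/val_inj.
  by rewrite preimage_setT probability_setT.
rewrite /C /= !eqxx eq_sym (negbTE ij) => <-; congr (P _); apply/seteqP; split => w /=.
  move=> [Aw Bw] t _ /=; case: ifPn => [/eqP ->//|_]; case: ifPn => [/eqP ->//|//].
by move=> H; split; [have := H (Ordinal ik) I|have := H (Ordinal jk) I];
  rewrite /= eqxx// eq_sym (negbTE ij).
Qed.

Lemma equal_in_law_integral (X Y : T -> R) (f : R -> \bar R) :
  measurable_fun setT X -> measurable_fun setT Y -> equal_in_law P X Y ->
  measurable_fun setT f -> (forall x, 0 <= f x)%E ->
  (\int[P]_w f (X w) = \int[P]_w f (Y w))%E.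
Proof.
move=> mX mY XY mf f0.
pose X' : {mfun T >-> R} := HB.pack X (isMeasurableFun.Build _ _ _ _ X mX).
pose Y' : {mfun T >-> R} := HB.pack Y (isMeasurableFun.Build _ _ _ _ Y mY).
rewrite -[LHS](ge0_integral_distribution X')// -[RHS](ge0_integral_distribution Y')//.
by apply: eq_measure_integral => A mA _; exact: XY.
Qed.

Lemma gaussian_law_integral (X : T -> R) (m s : R) (f : R -> \bar R) :
  measurable_fun setT X ->
  (forall B : set R, measurable B -> P (X @^-1` B) = normal_prob m s B) ->
  measurable_fun setT f -> (forall x, 0 <= f x)%E ->
  (\int[P]_w f (X w) = \int[normal_prob m s]_x f x)%E.
Proof.
move=> mX XE mf f0.
pose X' : {mfun T >-> R} := HB.pack X (isMeasurableFun.Build _ _ _ _ X mX).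
rewrite -[LHS](ge0_integral_distribution X')//.
pose idR : measurableTypeR R -> R := id.
have mid : measurable_fun setT idR by move=> _ A mA; rewrite setTI.
rewrite [RHS](_ : _ = \int[pushforward (normal_prob m s) idR]_x f x)%E.
  by apply: eq_measure_integral => A mA _; exact: XE.
by rewrite ge0_integral_pushforward.
Qed.

Lemma gaussian_law_mean (X : T -> R) (m s : R) :
  measurable_fun setT X ->
  (forall B : set R, measurable B -> P (X @^-1` B) = normal_prob m s B) ->
  (\int[P]_w (X w)%:E = \int[normal_prob m s]_x x%:E)%E.
Proof.
move=> mX XE; rewrite integralE [RHS]integralE; congr (_ - _)%E.
- rewrite -(gaussian_law_integral (f := (EFin^\+)%E) mX XE); first by apply: eq_integral => w _; rewrite !funeposE.
    exact: measurable_funepos.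
  by move=> x; exact: funepos_ge0.
- rewrite -(gaussian_law_integral (f := (EFin^\-)%E) mX XE); first by apply: eq_integral => w _; rewrite !funenegE.
    exact: measurable_funeneg.
  by move=> x; exact: funeneg_ge0.
Qed.

Lemma gaussian_variable_sqr_lty (X : T -> R) : gaussian_variable P X ->
  (\int[P]_w (X w ^+ 2)%:E < +oo)%E.
Proof.
move=> [mX [m [s]]]; case: eqVneq => [_ Xm|s0 Xlaw].
  rewrite (@ae_eq_integral _ _ _ P setT (cst (m ^+ 2)%:E))//.
  - rewrite integral_cst//= lte_mul_pinfty ?lee_fin ?sqr_ge0//.
    exact: le_lt_trans (probability_le1 P measurableT) (ltry _).
  - exact: measurable_EFin_sqr.
  - by apply: filterS Xm => w + _ => ->.
rewrite (gaussian_law_integral (f := fun x => (x ^+ 2)%:E) mX Xlaw).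
- exact: normal_prob_sqr_lty.
- by apply/measurable_EFinP; exact: measurable_funX.
- by move=> x; rewrite lee_fin sqr_ge0.
Qed.

Lemma integrable_of_sqr (X : T -> R) : measurable_fun setT X ->
  (\int[P]_w (X w ^+ 2)%:E < +oo)%E -> P.-integrable setT (EFin \o X).
Proof.
move=> mX X2; apply: (@le_integrable _ _ _ P setT measurableT _ (fun w => (1 + X w ^+ 2)%:E)).
- exact/measurable_EFinP.
- move=> w _ /=; rewrite lee_fin [leRHS]ger0_norm ?addr_ge0 ?sqr_ge0//.
  by rewrite -real_normK ?num_real//; have := sqr_ge0 (`|X w| - 2^-1); lra.
- apply/integrableP; split.
    by apply/measurable_EFinP/measurable_funD => //; exact: measurable_funX.
  under eq_integral do rewrite gee0_abs ?lee_fin ?addr_ge0 ?sqr_ge0//.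
  under eq_integral do rewrite EFinD.
  rewrite ge0_integralD//; last by apply/measurable_EFinP/measurable_funX.
    rewrite integral_cst// mul1e lte_add_pinfty//.
    exact: le_lt_trans (probability_le1 P measurableT) (ltry _).
  by move=> w _; rewrite lee_fin sqr_ge0.
Qed.

Lemma integrableM_of_sqr (X Y : T -> R) : measurable_fun setT X -> measurable_fun setT Y ->
  (\int[P]_w (X w ^+ 2)%:E < +oo)%E -> (\int[P]_w (Y w ^+ 2)%:E < +oo)%E ->
  P.-integrable setT (fun w => (X w * Y w)%:E).
Proof.
move=> mX mY X2 Y2.
have mX2 : measurable_fun setT (fun w => (X w ^+ 2)%:E) by exact: measurable_EFin_sqr.
have mY2 : measurable_fun setT (fun w => (Y w ^+ 2)%:E) by exact: measurable_EFin_sqr.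
apply: (@le_integrable _ _ _ P setT measurableT _ (fun w => (X w ^+ 2 + Y w ^+ 2)%:E)).
- by apply/measurable_EFinP; exact: measurable_funM.
- move=> w _ /=; rewrite lee_fin normrM [leRHS]ger0_norm ?addr_ge0 ?sqr_ge0//.
  rewrite -(real_normK (num_real (X w))) -(real_normK (num_real (Y w))).
  have := sqr_ge0 (`|X w| - `|Y w|); have := sqr_ge0 (`|X w|); have := sqr_ge0 (`|Y w|); lra.
- apply/integrableP; split; first by apply/measurable_EFinP/measurable_funD; exact: measurable_funX.
  under eq_integral do rewrite gee0_abs ?lee_fin ?addr_ge0 ?sqr_ge0//.
  under eq_integral do rewrite EFinD.
  rewrite ge0_integralD//; try by move=> w _; rewrite lee_fin sqr_ge0.
  by rewrite lte_add_pinfty.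
Qed.

Lemma orthogonal_sum_sqr (Z : nat -> T -> R) (s2 : R) :
  (forall i, measurable_fun setT (Z i)) ->
  (forall i, \int[P]_w (Z i w ^+ 2)%:E = s2%:E)%E ->
  (forall i j, i != j -> \int[P]_w (Z i w * Z j w)%:E = 0)%E ->
  forall k (a : 'I_k -> R),
    (\int[P]_w ((\sum_(i < k) a i * Z i w) ^+ 2)%:E = (s2 * \sum_(i < k) a i ^+ 2)%:E)%E.
Proof.
move=> mZ Z2 Zij k a.
have iZZ i j : P.-integrable setT (fun w => (Z i w * Z j w)%:E).
  by apply: integrableM_of_sqr => //; rewrite Z2 ltry.
transitivity (\int[P]_w (\sum_(p : 'I_k * 'I_k) (a p.1 * a p.2)%:E * (Z p.1 w * Z p.2 w)%:E))%E.
  apply: eq_integral => w _.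
  rewrite (eq_bigr (fun p : 'I_k * 'I_k => (a p.1 * Z p.1 w * (a p.2 * Z p.2 w))%:E)); last first.
    by move=> p _; rewrite -EFinM mulrACA.
  rewrite sumEFin -(pair_bigA _ (fun i j : 'I_k => a i * Z i w * (a j * Z j w)))/=.
  by rewrite expr2 mulr_suml; congr EFin; apply: eq_bigr => i _; rewrite mulr_sumr.
rewrite integral_sum//; last by move=> p; exact: integrableZl.
rewrite (eq_bigr (fun p : 'I_k * 'I_k => (a p.1 * a p.2 * (s2 * (p.1 == p.2)%:R))%:E)); last first.
  move=> [i j] _ /=; rewrite integralZl// [in RHS]EFinM; congr (_ * _)%E.
  have [->|ij] := eqVneq i j; first by rewrite mulr1 -(Z2 j).
  by rewrite mulr0 Zij.
rewrite sumEFin -(pair_bigA _ (fun i j : 'I_k => a i * a j * (s2 * (i == j)%:R)))/=.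
rewrite mulr_sumr; congr EFin; apply: eq_bigr => i _.
rewrite (bigD1 i)//= eqxx mulr1 big1 => [|j ij]; first by rewrite addr0 mulrC expr2.
by rewrite eq_sym (negbTE ij) !mulr0.
Qed.

(* [s2] is the variance of the standard normal law, whose value plays no role. *)
Lemma iid_standard_normal_sum_sqr (Z : nat -> T -> R) : iid_standard_normal P Z ->
  exists2 s2 : R, 0 <= s2 & forall k (a : 'I_k -> R),
    (\int[P]_w ((\sum_(i < k) a i * Z i w) ^+ 2)%:E = (s2 * \sum_(i < k) a i ^+ 2)%:E)%E.
Proof.
move=> [mZ indZ lawZ].
have lawE i f : measurable_fun setT f -> (forall x, 0 <= f x)%E ->
    (\int[P]_w f (Z i w) = \int[normal_prob 0 1]_x f x)%E.
  by move=> mf f0; exact: (gaussian_law_integral (mZ i) (lawZ i)).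
have msqr : measurable_fun setT (fun x : R => (x ^+ 2)%:E).
  by apply/measurable_EFinP; exact: measurable_funX.
have sqr_ge x : (0 <= (x ^+ 2 : R)%:E)%E by rewrite lee_fin sqr_ge0.
have lty := @normal_prob_sqr_lty R 0 1 (oner_neq0 _).
pose s2 := fine (\int[normal_prob 0 1]_x (x ^+ 2 : R)%:E)%E.
have Z2 i : (\int[P]_w (Z i w ^+ 2)%:E = s2%:E)%E.
  rewrite (lawE i (fun x => (x ^+ 2)%:E))// fineK// ge0_fin_numE//.
  exact: integral_ge0.
have iZ i : P.-integrable setT (EFin \o Z i).
  by apply: integrable_of_sqr => //; rewrite Z2 ltry.
have EZ i : (\int[P]_w (Z i w)%:E = 0)%E.
  by rewrite (gaussian_law_mean (mZ i) (lawZ i)) normal_prob_mean0.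
exists s2; first by apply: fine_ge0; exact: integral_ge0.
move=> k a; apply: orthogonal_sum_sqr => // i j ij.
apply: independent_expectationM => // A B mA mB.
exact: mutually_independent_pair.
Qed.

End iid.

(** * Almost sure versions measurable for a smaller sigma-algebra *)

Section sub_sigma_algebra.
Context d (T : measurableType d) (R : realType) (P : probability T R).

Lemma g_sigma_measurable_fun d' (T' : measurableType d') (H : set (set T))
    (h : T -> T') : H `<=` measurable ->
  measurable_fun [set: g_sigma_algebraType H] (h : g_sigma_algebraType H -> T') ->
  measurable_fun [set: T] h.
Proof.
move=> HF mh _ A mA; have := mh measurableT A mA; apply: smallest_sub => //.
exact: sigma_algebra_measurable.
Qed.

(** Approximations with squared errors at most 2^-(n+1) have a squared-error series with finite
    integral, so they converge to [f] almost everywhere without extracting a subsequence. The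
    version is their upper limit because it is measurable for [H] even where they diverge; [fine]
    sets it to 0 where it is infinite. *)
Lemma L2_limit_version (H : set (set T)) (f : T -> R) : H `<=` measurable ->
  measurable_fun setT f ->
  (forall eps : R, 0 < eps -> exists2 h : T -> R,
     measurable_fun [set: g_sigma_algebraType H] (h : g_sigma_algebraType H -> R) &
     (\int[P]_w ((f w - h w) ^+ 2)%:E <= eps%:E)%E) ->
  exists2 h : T -> R,
    measurable_fun [set: g_sigma_algebraType H] (h : g_sigma_algebraType H -> R) &
    {ae P, forall w, f w = h w}.
Proof.
move=> HF mf approx.
have /choice[hn hnP] : forall n : nat, exists h : T -> R,
    measurable_fun [set: g_sigma_algebraType H] (h : g_sigma_algebraType H -> R) /\
    (\int[P]_w ((f w - h w) ^+ 2)%:E <= (1 / (2 ^ n.+1)%:R)%:E)%E.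
  move=> n; have [|h mh h2] := approx (1 / (2 ^ n.+1)%:R); last by exists h.
  by rewrite divr_gt0// ltr0n expn_gt0.
have mhn n := (hnP n).1.
have mhnT n : measurable_fun setT (hn n) := g_sigma_measurable_fun HF (mhn n).
pose U n w := ((f w - hn n w) ^+ 2)%:E.
have mU n : measurable_fun setT (U n).
  by apply: measurable_EFin_sqr; exact: measurable_funB.
have U0 n w : (0 <= U n w)%E by rewrite lee_fin sqr_ge0.
have iU : P.-integrable setT (fun w => \sum_(n <oo) U n w)%E.
  apply/integrableP; split.
    by apply: ge0_emeasurable_sum => //.
  under eq_integral => w _ do rewrite gee0_abs ?nneseries_ge0//.
  rewrite integral_nneseries//.
  apply: le_lt_trans (ltry 1).
  apply: le_trans (epsilon_trick0 xpredT (@ler01 R)).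
  apply: lee_nneseries => [n _ _|n _]; first exact: integral_ge0.
  exact: (hnP n).2.
exists (fun w => fine (limn_esup (fun n => (hn n w)%:E))).
  apply: measurableT_comp; first exact: fine_measurable.
  by apply: measurable_fun_limn_esup => n; exact/measurable_EFinP.
have := integrable_ae measurableT iU; apply: filterS => w /(_ I) Ufin.
suff hf : hn n w @[n --> \oo] --> f w.
  have /cvg_limn_einf_sup[_ ->//] : (hn n w)%:E @[n --> \oo] --> (f w)%:E.
  by apply: cvg_EFin; [exact: nearW|exact: hf].
pose a n := (f w - hn n w) ^+ 2.
have a0 : a @ \oo --> 0.
  apply: cvg_series_cvg_0; apply: nondecreasing_is_cvgn.
    by apply/nondecreasing_seqP => n; rewrite /series /= big_nat_recr//= lerDl sqr_ge0.
  exists (fine (\sum_(n <oo) U n w)) => _ [n _ <-].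
  rewrite -lee_fin fineK// /series /= -sumEFin.
  by apply: (@nneseries_lim_ge R (U ^~ w) xpredT 0 n).
have : Num.sqrt (a n) @[n --> \oo] --> Num.sqrt (0 : R).
  by apply: continuous_cvg => //; exact: sqrt_continuous.
rewrite sqrtr0 => /cvgr0_norm_lt a0'.
apply/cvgrPdist_lt => e e0; have := a0' e e0; apply: filterS => n.
by rewrite ger0_norm ?sqrtr_ge0// sqrtr_sqr.
Qed.

End sub_sigma_algebra.

(** * Multilinear interpolation on the cube *)

Lemma norm_rV_le (R : realType) d (x : 'rV[R]_d) (r : R) : 0 <= r ->
  (forall j, `|x ord0 j| <= r) -> `|x| <= r.
Proof.
move=> r0 xr; rewrite [leLHS]/Num.norm /= mx_normrE.
by apply/bigmax_leP; split => // -[i j] _ /=; rewrite ord1.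
Qed.

Lemma norm_coord_le (R : realType) d (x : 'rV[R]_d) j : `|x ord0 j| <= `|x|.
Proof.
rewrite [leRHS]/Num.norm /= mx_normrE.
by apply/bigmax_geP; right; exists (ord0, j).
Qed.

Section hats.
Context {R : realType}.

Lemma hat_ge0 (L : R) (m k : nat) (t : R) : 0 <= hat L m k t.
Proof. by rewrite /hat le_max lexx. Qed.

Lemma hat_eq0 (L : R) (m k : nat) (t : R) : 0 < L -> (0 < m)%N -> L / m%:R <= `|t - k%:R * (L / m%:R)| ->
  hat L m k t = 0.
Proof.
move=> L0 m0; rewrite /hat; have h0 : 0 < L / m%:R by rewrite divr_gt0 ?ltr0n.
move: (L / m%:R) h0 => h h0 ht; apply/max_idPl; rewrite subr_le0.
by rewrite -(ler_pM2r h0) mul1r -{3}(gtr0_norm h0) -normrM mulrBl divfK ?gt_eqF.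
Qed.

Lemma sum_hat (L : R) (m : nat) (t : R) : 0 < L -> (0 < m)%N -> 0 <= t <= L ->
  \sum_(k < m.+1) hat L m k t = 1.
Proof.
move=> L0 m0 /andP[t0 tL]; have h0 : 0 < L / m%:R by rewrite divr_gt0 ?ltr0n.
rewrite /hat; set u := t / (L / m%:R).
have u0 : 0 <= u by rewrite divr_ge0// ltW.
have um : u <= m%:R by rewrite ler_pdivrMr// mulrCA divff ?mulr1// pnatr_eq0 -lt0n.
have zero k : 1 <= `|u - k%:R| -> Num.max 0 (1 - `|u - k%:R|) = 0.
  by move=> ?; apply/max_idPl; rewrite subr_le0.
(* At the right end point only the last hat contributes. Elsewhere the two hats at [truncn u] and
   its successor do, with values adding up to 1; at the end point that successor would not be an
   index. *)
have [um'|um'] := leP m%:R u.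
  have -> : u = m%:R by apply/eqP; rewrite eq_le um.
  rewrite big_ord_recr /= subrr normr0 subr0 (max_idPr _)// big1 ?add0r// => i _.
  apply/max_idPl; rewrite subr_le0 ger0_norm ?subr_ge0 ?ler_nat 1?ltnW//.
  by rewrite -natrB 1?ltnW// ler1n subn_gt0.
have := truncn_itv u0; set i := Num.truncn u => /andP[iu ui].
have im : (i < m)%N by rewrite -(ltr_nat R) (le_lt_trans iu).
rewrite (bigD1 (inord i)) //= (bigD1 (inord i.+1)) /=; last first.
  by apply/eqP => /(congr1 val); rewrite /= !inordK ?ltnS ?(ltnW im)//; exact: nesym (@n_Sn _).
rewrite big1 ?addr0 => [|j].
  rewrite !inordK ?ltnS ?(ltnW im)//.
  rewrite -natr1 in ui *.
  rewrite ger0_norm ?subr_ge0// ler0_norm; last lra.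
  rewrite !(max_idPr _); lra.
move=> /andP[ji jSi]; apply: zero.
have [{}ji|ij|/esym ij] := ltngtP j i.
- have : (j.+1%:R : R) <= i%:R by rewrite ler_nat.
  rewrite -natr1 => ?; rewrite ger0_norm; lra.
- have : (i.+2%:R : R) <= j%:R.
    rewrite ler_nat ltn_neqAle ij andbT; apply: contra jSi => /eqP ij'.
    by apply/eqP/val_inj; rewrite /= inordK ?ij'.
  by rewrite -!natr1 in ui * => ?; rewrite ler0_norm; lra.
- by move: ji; rewrite ij => /eqP[]; apply/val_inj; rewrite /= inordK// -?ij.
Qed.

Section grid.
Variables (d : nat) (L : R) (m : nat).
Hypotheses (L0 : 0 < L) (m0 : (0 < m)%N).
Implicit Types (k : {ffun 'I_d -> 'I_m.+1}) (x : 'rV[R]_d).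

Definition grid_weight k x : R := \prod_(j < d) hat L m (k j) (x ord0 j).

Lemma grid_weight_ge0 k x : 0 <= grid_weight k x.
Proof. by apply: prodr_ge0 => j _; exact: hat_ge0. Qed.

(** Expanding the product over the coordinates of the one-dimensional sums gives one term for each
    node. *)
Lemma sum_grid_weight x : cube d L x -> \sum_k grid_weight k x = 1.
Proof.
move=> Dx; rewrite /grid_weight.
rewrite -(bigA_distr_bigA (fun j (i : 'I_m.+1) => hat L m i (x ord0 j))).
by rewrite big1// => j _; rewrite sum_hat.
Qed.

(** The norm of row vectors is the sup norm, so a distant node is at least one mesh away in some
    coordinate, and there its hat vanishes. *)
Lemma grid_weight_eq0 k x : L / m%:R < `|x - grid_point L k| -> grid_weight k x = 0.
Proof.
move=> h; suff [j hj] : exists j, L / m%:R <= `|x ord0 j - (k j)%:R * (L / m%:R)|.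
  by rewrite /grid_weight (bigD1 j)//= hat_eq0 ?mul0r.
apply/not_existsP => H; move: h; rewrite ltNge => /negP; apply.
apply: norm_rV_le => [|j]; first by rewrite divr_ge0// ltW.
by rewrite !mxE; have /negP := H j; rewrite -ltNge => /ltW.
Qed.

Lemma cube_grid_point k : cube d L (grid_point L k).
Proof.
move=> j; rewrite mxE mulr_ge0//= ?divr_ge0 ?(ltW L0)//.
rewrite mulrCA ler_piMr ?(ltW L0)// ler_pdivrMr ?ltr0n// mul1r ler_nat.
by rewrite -ltnS.
Qed.

End grid.

End hats.

Lemma convex_gt0 (R : realFieldType) (t a b : R) : 0 <= t -> t <= 1 -> 0 < a -> 0 < b ->
  0 < t * a + (1 - t) * b.
Proof.
move=> t0 t1 a0 b0; have [->|t0'] := eqVneq t 0; first by rewrite mul0r add0r subr0 mul1r.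
by rewrite ltr_wpDr// ?mulr_gt0 ?mulr_ge0 ?subr_ge0 ?(ltW b0)// lt0r t0'.
Qed.

(** * The cube: density of sets of full measure, and gradient bounds *)

Section cube_geometry.
Context {R : realType} (d : nat).
Implicit Types (x y z : 'rV[R]_d) (L : R).

Definition open_cube L : set 'rV[R]_d := [set x | forall j, 0 < x ord0 j < L].

Lemma open_cube_sub L : open_cube L `<=` cube d L.
Proof. by move=> x xL j; have /andP[/ltW-> /ltW->] := xL j. Qed.

Lemma measurable_rV_box (A : 'I_d -> set R) : (forall i, measurable (A i)) ->
  measurable [set x : 'rV[R]_d | forall i, A i (x ord0 i)].
Proof.
move=> mA; rewrite (_ : [set _ | _] = \big[setI/setT]_(j < d)
    ((fun x : 'rV[R]_d => x ord0 j) @^-1` A j)).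
  apply: bigsetI_measurable => j _.
  by rewrite -[X in measurable X]setTI; exact: measurable_coord.
rewrite -bigcap_seq; apply/seteqP; split => x /= H j; first by move=> _; exact: H.
by apply: (H j); rewrite /= mem_index_enum.
Qed.

Lemma lebesgue_cubeE L : 0 < L -> @lebesgue_rV R d (cube d L) = (L ^+ d)%:E.
Proof.
move=> L0; rewrite (_ : cube d L = [set x : 'rV[R]_d | forall i, `[0, L]%classic (x ord0 i)]).
  rewrite (@lebesgue_rV_box R d (fun=> `[0, L]%classic))// (eq_bigr (fun=> L%:E)).
    by rewrite prodEFin prodr_const card_ord.
  by move=> i _; rewrite lebesgue_measure_itv/= lte_fin L0 oppr0 adde0.
by apply/seteqP; split => x /= H j; have := H j; rewrite in_itv.
Qed.

(** Even when x lies on the boundary, the points of the open cube near x contain a box with nonempty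
    interior; its volume is positive, so it is not contained in a null set. *)
Lemma ae_dense_cube L (A : set 'rV[R]_d) : 0 < L ->
  {ae lebesgue_rV, forall x, cube d L x -> A x} ->
  forall x r, cube d L x -> 0 < r -> exists y, [/\ open_cube L y, A y & `|x - y| < r].
Proof.
move=> L0 [N [mN N0 AN]] x r Dx r0.
pose a j := Num.max 0 (x ord0 j - r / 2); pose b j := Num.min L (x ord0 j + r / 2).
have ab j : a j < b j.
  have /andP[? ?] := Dx j; rewrite /a /b lt_min !gt_max L0 /=; apply/andP; split.
    lra.
  by apply/andP; split; lra.
pose B := [set y : 'rV[R]_d | forall j, `]a j, b j[%classic (y ord0 j)].
have mB : measurable B by exact: (measurable_rV_box (A := fun j => `]a j, b j[%classic)).
have B0 : (0 < @lebesgue_rV R d B)%E.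
  rewrite (@lebesgue_rV_box R d (fun j => `]a j, b j[%classic))// (eq_bigr (fun j => (b j - a j)%:E)).
    by rewrite prodEFin lte_fin; apply: prodr_gt0 => j _; rewrite subr_gt0.
  by move=> i _; rewrite lebesgue_measure_itv/= lte_fin ab.
apply/not_existsP => H; move: B0; rewrite ltNge => /negP; apply.
rewrite -N0; apply: le_measure; rewrite ?inE// => y By.
apply: AN => /= Hy; apply: (H y).
have oy : open_cube L y.
  move=> j; have := By j; rewrite /= in_itv/= /a /b gt_max lt_min.
  by move=> /andP[/andP[-> _] /andP[-> _]].
split => //; first by apply: Hy; exact: open_cube_sub.
apply: (@le_lt_trans _ _ (r / 2)); last lra.
apply: norm_rV_le => [|j]; first lra.
have := By j; rewrite /= in_itv/= /a /b gt_max lt_min => /andP[/andP[_ ?] /andP[_ ?]].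
by rewrite !mxE ler_norml; apply/andP; split; lra.
Qed.

(** The infinity norm is an essential supremum when the total mass is positive, hence the volume of
    the cube. A null set of the restricted measure, cut down to the cube, is Lebesgue null. *)
Lemma lebesgue_cube_Lnorm_ae L (f : 'rV[R]_d -> \bar R) (c : R) : 0 < L ->
  ('N[lebesgue_cube d L]_+oo[f] <= c%:E)%E ->
  {ae lebesgue_rV, forall x, cube d L x -> (`|f x| <= c%:E)%E}.
Proof.
move=> L0; rewrite unlock /=.
rewrite /lebesgue_cube /mrestr setTI lebesgue_cubeE// lte_fin exprn_gt0//.
move=> /ess_supP [N [mN N0 AN]].
exists (N `&` cube d L); split => //.
  by apply: measurableI => //; exact: measurable_cube.
move=> x /= /not_implyP[Dx Hx]; split => //; exact: AN.
Qed.

Lemma cube_continuousP (V : normedModType R) L (f : 'rV[R]_d -> V) :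
  {within cube d L, continuous f} <->
  (forall x, cube d L x -> forall e : R, 0 < e ->
    exists2 r : R, 0 < r & forall y, cube d L y -> `|x - y| < r -> `|f x - f y| < e).
Proof.
split.
  move=> /subspace_continuousP fc x Dx e e0.
  have /cvgrPdist_lt/(_ e e0) := fc x Dx.
  rewrite near_withinE near_nbhs => /nbhs_ballP[r r0 Hr]; exists r => // y Dy xy.
  by apply: Hr => //; rewrite -ball_normE.
move=> H; apply/subspace_continuousP => x Dx; apply/cvgrPdist_lt => e e0.
have [r r0 Hr] := H x Dx e e0.
rewrite near_withinE near_nbhs; apply/nbhs_ballP; exists r => // y xy Dy.
by apply: Hr => //; move: xy; rewrite -ball_normE.
Qed.

Lemma ae_cube_norm_le L (f : 'rV[R]_d -> R) (C : R) : 0 < L ->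
  {within cube d L, continuous f} ->
  {ae lebesgue_rV, forall x, cube d L x -> `|f x| <= C} ->
  forall x, cube d L x -> `|f x| <= C.
Proof.
move=> L0 /cube_continuousP fc aef x Dx; apply/ler_addgt0Pr => e e0.
have [r r0 Hr] := fc x Dx e e0.
have [y [oy fy xy]] := ae_dense_cube L0 aef Dx r0.
have := Hr y (open_cube_sub oy) xy => /ltW fxy.
rewrite -(subrK (f y) (f x)) addrC (le_trans (ler_normD _ _))//.
by rewrite lerD.
Qed.

Lemma open_cube_interior L : open_cube L `<=` (cube d L)°.
Proof.
move=> x ox; rewrite /interior /=; apply/nbhs_ballP.
pose m := \big[Num.min/1]_(j < d) Num.min (x ord0 j) (L - x ord0 j).
have m0 : 0 < m.
  by apply: lt_bigmin => // j _; have /andP[? ?] := ox j; rewrite lt_min; apply/andP; split; lra.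
exists m => // y; rewrite -ball_normE /= => xy j.
have : `|(x - y) ord0 j| < m by apply: le_lt_trans xy; exact: norm_coord_le.
have mj : m <= Num.min (x ord0 j) (L - x ord0 j) by exact: bigmin_le_cond.
rewrite !mxE ltr_norml => /andP[xy1 xy2].
by move: mj; rewrite le_min => /andP[? ?]; apply/andP; split; lra.
Qed.

Lemma euclidean_norm_coord (v : 'rV[R]_d) j : `|v ord0 j| <= euclidean_norm v.
Proof.
rewrite /euclidean_norm -sqrtr_sqr ler_wsqrtr// (bigD1 j)//= lerDl.
by apply: sumr_ge0 => i _; rewrite sqr_ge0.
Qed.

Lemma is_derive_line (f : 'rV[R]_d -> R) (x v : 'rV[R]_d) (t : R) :
  differentiable f (x + t *: v) ->
  is_derive t 1 (fun s : R => f (x + s *: v)) ('D_v f (x + t *: v)).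
Proof.
move=> df; have dv : derivable f (x + t *: v) v by exact: diff_derivable.
have E : (fun h : R => h^-1 *: (((fun s : R => f (x + s *: v)) \o shift t) (h *: 1) -
    f (x + t *: v))) = (fun h : R => h^-1 *: ((f \o shift (x + t *: v)) (h *: v) -
    f (x + t *: v))).
  apply/funext => h /=; congr (_ *: (f _ - _)).
  by rewrite -[h%:A]/(h * 1) mulr1 scalerDl addrCA.
by split; rewrite /derivable /derive /= E.
Qed.

(** The continuous extension [G] turns the almost everywhere bound into a bound at every point of
    the open cube. There the mean value theorem applies along segments; each of the d partial
    derivatives contributes K times the sup distance, whence the factor d. Continuity of [f] carries
    the estimate to the closed cube. *)
Lemma gradient_lipschitz L (f : 'rV[R]_d -> R) (K : R) : 0 < L ->
  continuously_differentiable_on (cube d L) f ->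
  {ae lebesgue_rV, forall x, cube d L x -> euclidean_norm (gradient f x) <= K} ->
  forall x y, cube d L x -> cube d L y -> `|f x - f y| <= d%:R * K * `|x - y|.
Proof.
move=> L0 [/cube_continuousP fc fd [G /cube_continuousP Gc GE]] aeK.
have partial_le z j : open_cube L z -> `|'D_(delta_mx ord0 j) f z| <= K.
  move=> oz; have -> : 'D_(delta_mx ord0 j) f z = G z ord0 j.
    by rewrite GE ?mxE//; exact: open_cube_interior.
  apply/ler_addgt0Pr => e e0.
  have [r r0 Hr] := Gc z (open_cube_sub oz) e e0.
  have [y [oy gy zy]] := ae_dense_cube L0 aeK (open_cube_sub oz) r0.
  have Gzy := Hr y (open_cube_sub oy) zy.
  have Gy : `|G y ord0 j| <= K.
    by rewrite GE; [exact: le_trans (euclidean_norm_coord _ _) gy|exact: open_cube_interior].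
  have : `|(G z - G y) ord0 j| <= e by apply: le_trans (norm_coord_le _ _) (ltW Gzy).
  rewrite !mxE => Gj.
  rewrite -(subrK (G y ord0 j) (G z ord0 j)) addrC (le_trans (ler_normD _ _))//.
  by rewrite lerD.
have open_lip x y : open_cube L x -> open_cube L y -> `|f x - f y| <= d%:R * K * `|x - y|.
  move=> ox oy; pose v := x - y.
  have oline (t : R) : 0 <= t <= 1 -> open_cube L (y + t *: v).
    move=> /andP[t0 t1] j; rewrite !mxE.
    have /andP[x0 xL] := ox j; have /andP[y0 yL] := oy j.
    have -> : y ord0 j + t * (x ord0 j - y ord0 j) = t * x ord0 j + (1 - t) * y ord0 j by ring.
    rewrite convex_gt0//= -subr_gt0.
    have -> : L - (t * x ord0 j + (1 - t) * y ord0 j) =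
      t * (L - x ord0 j) + (1 - t) * (L - y ord0 j) by ring.
    by rewrite convex_gt0// subr_gt0.
  have dline (t : R) : 0 <= t <= 1 -> differentiable f (y + t *: v).
    by move=> t01; apply: fd; apply: open_cube_interior; exact: oline.
  have [||c] := @MVT R (fun s : R => f (y + s *: v)) (fun s => 'D_v f (y + s *: v)) 0 1 ltr01.
  - by move=> t; rewrite in_itv/= => /andP[/ltW t0 /ltW t1]; apply: is_derive_line; apply: dline; rewrite t0.
  - apply: derivable_within_continuous => t; rewrite in_itv/= => t01.
    by have [] := is_derive_line (dline t t01).
  rewrite in_itv/= => /andP[/ltW c0 /ltW c1].
  have c01 : 0 <= c <= 1 by rewrite c0.
  have -> : y + 1 *: v = x by rewrite scale1r /v addrC subrK.
  have -> : y + 0 *: v = y by rewrite scale0r addr0.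
  rewrite subr0 mulr1 => ->.
  rewrite -/v deriveE; last exact: dline.
  rewrite [X in 'd _ _ X]row_sum_delta linear_sum/= (le_trans (ler_norm_sum _ _ _))//.
  rewrite -mulrA mulr_natl -[X in _ *+ X]card_ord -sumr_const; apply: ler_sum => j _.
  rewrite linearZ/= normrM mulrC ler_pM//; last exact: norm_coord_le.
  rewrite -deriveE; last exact: dline.
  by apply: partial_le; exact: oline.
move=> x y Dx Dy; apply/ler_addgt0Pr => e e0.
(* Moving both end points by at most [e'] changes the Lipschitz bound by at most 2 K' e' = e / 2,
   and the values of [f] by e / 4 each. Adding 1 keeps [K'] positive. *)
pose K' := d%:R * `|K| + 1; have K'0 : 0 < K' by rewrite ltr_wpDl// mulr_ge0.
pose e' := e / (4 * K').
have e'0 : 0 < e' by rewrite divr_gt0// mulr_gt0.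
have e40 : 0 < e / 4 by rewrite divr_gt0.
have near_open z : cube d L z -> exists z', [/\ open_cube L z', `|f z - f z'| <= e / 4 & `|z - z'| <= e'].
  move=> Dz; have [r r0 Hr] := fc z Dz _ e40.
  have m0 : 0 < Num.min r e' by rewrite lt_min r0.
  have [z' [oz' _ zz']] := ae_dense_cube L0 aeK Dz m0.
  move: zz'; rewrite lt_min => /andP[zr ze]; exists z'; split => //; last exact: ltW.
  by apply: ltW; apply: Hr => //; exact: open_cube_sub.
have [x' [ox' fx xx']] := near_open x Dx.
have [y' [oy' fy yy']] := near_open y Dy.
have f1 : `|f x - f y| <= `|f x - f x'| + `|f x' - f y'| + `|f y - f y'|.
  rewrite (distrC (f y)) -(addrA `|_|).
  rewrite (le_trans (ler_distD (f x') _ _))// lerD2l; exact: ler_distD.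
have xy' : `|x' - y'| <= `|x - y| + 2 * e'.
  have : `|x' - y'| <= `|x' - x| + (`|x - y| + `|y - y'|).
    by rewrite (le_trans (ler_distD x _ _))// lerD2l; exact: ler_distD.
  rewrite (distrC x' x); lra.
have f2 := open_lip _ _ ox' oy'.
have K0 : 0 <= K.
  have [z [oz Hz _]] := ae_dense_cube L0 aeK Dx ltr01.
  exact: le_trans (sqrtr_ge0 _) Hz.
have f3 : d%:R * K * `|x' - y'| <= d%:R * K * `|x - y| + e / 2.
  apply: (le_trans (ler_wpM2l _ xy')); first by rewrite mulr_ge0.
  rewrite mulrDr lerD2l.
  have : K' * e' = e / 4 by rewrite /e'; field; rewrite gt_eqF.
  rewrite /K' (ger0_norm K0) => ?; nra.
lra.
Qed.

End cube_geometry.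

Section interpolation.
Context {R : realType} (d : nat) (L : R) (m : nat).
Hypotheses (L0 : 0 < L) (m0 : (0 < m)%N).
Implicit Types (x : 'rV[R]_d) (f : 'rV[R]_d -> R).

Lemma multilinear_interpolationE f x : multilinear_interpolation L m f x =
  \sum_(k : {ffun 'I_d -> 'I_m.+1}) grid_weight L k x * f (grid_point L k).
Proof. by apply: eq_bigr => k _; rewrite mulrC. Qed.

(** The interpolant is a convex average of the nodal values, and only nodes within one mesh of x
    have positive weight. *)
Lemma multilinear_interpolation_dist f x (c e : R) : cube d L x ->
  (forall k : {ffun 'I_d -> 'I_m.+1}, `|x - grid_point L k| <= L / m%:R ->
     `|f (grid_point L k) - c| <= e) ->
  `|multilinear_interpolation L m f x - c| <= e.
Proof.
move=> Dx fe; have sw := sum_grid_weight L0 m0 Dx.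
rewrite multilinear_interpolationE -[c]mul1r -{1}sw mulr_suml -sumrB.
rewrite (le_trans (ler_norm_sum _ _ _))// -[leRHS]mul1r -sw mulr_suml.
apply: ler_sum => k _; rewrite -mulrBr normrM ger0_norm ?grid_weight_ge0//.
have [h|h] := leP `|x - grid_point L k| (L / m%:R).
  by rewrite ler_wpM2l ?grid_weight_ge0 ?fe.
by rewrite grid_weight_eq0// !mul0r.
Qed.

Lemma measurable_grid_weight (k : {ffun 'I_d -> 'I_m.+1}) :
  measurable_fun setT (grid_weight L k : 'rV[R]_d -> R).
Proof.
apply: measurable_prod => j _; rewrite /hat.
apply: measurable_maxr => //; apply: measurable_funB => //.
apply: measurableT_comp => //; apply: measurable_funB => //.
by apply: measurable_funM => //; exact: measurable_coord.
Qed.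

Lemma integral_sqr_interpolation d' (T : measurableType d') (P : probability T R)
    (W : 'rV[R]_d -> T -> R) x (B : R) : cube d L x ->
  (forall y, cube d L y -> measurable_fun setT (W y)) ->
  (forall k : {ffun 'I_d -> 'I_m.+1}, `|x - grid_point L k| <= L / m%:R ->
     (\int[P]_w ((W (grid_point L k) w - W x w) ^+ 2)%:E <= B%:E)%E) ->
  (\int[P]_w ((multilinear_interpolation L m (W ^~ w) x - W x w) ^+ 2)%:E <= B%:E)%E.
Proof.
move=> Dx mW WB; have sw := sum_grid_weight L0 m0 Dx.
have E w : multilinear_interpolation L m (W ^~ w) x - W x w =
    \sum_(k : {ffun 'I_d -> 'I_m.+1}) grid_weight L k x * (W (grid_point L k) w - W x w).
  rewrite multilinear_interpolationE -{1}[W x w]mul1r -{1}sw mulr_suml -sumrB.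
  by apply: eq_bigr => k _; rewrite -mulrBr.
under eq_integral do rewrite E.
apply: le_trans (integral_sqr_sum_le (mu := P) measurableT
  (c := fun k : {ffun 'I_d -> 'I_m.+1} => grid_weight L k x)
  (f := fun k w => W (grid_point L k) w - W x w) (B := B) _ _) _.
- by move=> k; apply: measurable_funB; apply: mW => //; exact: cube_grid_point.
- move=> k; have [h _|h] := leP `|x - grid_point L k| (L / m%:R); first exact: WB.
  by rewrite grid_weight_eq0// eqxx.
- under eq_bigr do rewrite ger0_norm ?grid_weight_ge0//.
  by rewrite sw expr1n mul1r.
Qed.

End interpolation.

Section cube_continuity.
Context {R : realType} (d : nat) (L : R).
Hypothesis L0 : 0 < L.

(** The sigma-algebra of row vectors is generated by the coordinates. Measurability comes from
    approximation: [f] is the pointwise limit of its interpolants, which are finite combinations of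
    measurable weights. *)
Lemma cube_continuous_measurable (f : 'rV[R]_d -> R) :
  {within cube d L, continuous f} -> measurable_fun (cube d L) f.
Proof.
move=> /cube_continuousP fc.
apply: (measurable_fun_cvg (h := fun n => multilinear_interpolation L n.+1 f)).
  move=> n; apply: measurable_sum => k.
  apply: measurable_funM => //; apply: measurable_funTS; exact: measurable_grid_weight.
move=> x Dx; apply/cvgrPdist_le => e e0.
have [r r0 Hr] := fc x Dx e e0.
near=> n; rewrite distrC; apply: multilinear_interpolation_dist => // k xk.
rewrite distrC; apply/ltW/Hr; first exact: cube_grid_point.
apply: le_lt_trans xk _.
rewrite ltr_pdivrMr// mulrC -ltr_pdivrMr//.
near: n; exists (Num.truncn (L / r)) => // n /= ln.
apply: lt_le_trans (truncnS_gt _) _; by rewrite ler_nat ltnS.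
Unshelve. all: by end_near. Qed.

Lemma compact_cube : compact (cube d L).
Proof.
have := @rV_compact R d (fun=> `[0, L]%classic) (fun=> @segment_compact R 0 L).
by congr compact; apply/seteqP; split => x /= H j; have := H j; rewrite in_itv.
Qed.

Lemma cube_continuous_bounded (f : 'rV[R]_d -> R) : {within cube d L, continuous f} ->
  exists M : R, forall x, cube d L x -> `|f x| <= M.
Proof.
move=> fc; have := compact_bounded (continuous_compact fc compact_cube).
move=> [M [_ HM]]; exists (M + 1) => x Dx.
by apply: (HM (M + 1)); [rewrite ltrDl|exists x].
Qed.

Lemma cube_bounded_mem_L2 (f : 'rV[R]_d -> R) : {within cube d L, continuous f} ->
  mem_L2 (cube d L) f.
Proof.
move=> fc; have mf := cube_continuous_measurable fc.
have mD := @measurable_cube R d L.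
split => //; have [M fM] := cube_continuous_bounded fc.
apply: (@le_lt_trans _ _ (\int[lebesgue_rV]_(x in cube d L) (M ^+ 2)%:E)%E).
  apply: ge0_le_integral => //.
  - by move=> x _; rewrite lee_fin sqr_ge0.
  - exact: measurable_EFin_sqr.
  - move=> x Dx; rewrite lee_fin -real_normK ?num_real// lerXn2r ?nnegrE ?fM//.
    exact: le_trans (fM x Dx).
by rewrite integral_cst// [X in (_ * X)%E](lebesgue_cubeE d L0) -EFinM ltry.
Qed.

End cube_continuity.

(** * Sup, Lipschitz and Hölder bounds for the eigenfunctions *)

Section basis_bounds.
Context {R : realType} (d : nat) (L : R) (e : nat -> 'rV[R]_d -> R).
Variables (alpha beta Ce : R).
Hypotheses (L0 : 0 < L) (eC1 : forall i, continuously_differentiable_on (cube d L) (e i))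
  (alpha_gt0 : 0 < alpha) (beta_gt0 : 0 < beta) (Ce_gt0 : 0 < Ce)
  (e_bounded : forall i, ('N[lebesgue_cube d L]_+oo[EFin \o e i] <= Ce%:E)%E)
  (grad_e_bounded : forall i,
     ('N[lebesgue_cube d L]_+oo[
         (fun x => (euclidean_norm (gradient (e i) x))%:E)]
       <= (Ce * i.+1%:R `^ alpha)%:E)%E).

Lemma basis_norm_le i x : cube d L x -> `|e i x| <= Ce.
Proof.
apply: (ae_cube_norm_le L0); first by have [] := eC1 i.
have := lebesgue_cube_Lnorm_ae L0 (e_bounded i); apply: filterS => y H Dy.
by have := H Dy; rewrite /= lee_fin.
Qed.

Lemma basis_lipschitz i x y : cube d L x -> cube d L y ->
  `|e i x - e i y| <= d%:R * (Ce * i.+1%:R `^ alpha) * `|x - y|.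
Proof.
apply: (gradient_lipschitz L0) => //.
have := lebesgue_cube_Lnorm_ae L0 (grad_e_bounded i); apply: filterS => z H Dz.
have := H Dz; rewrite /= lee_fin; apply: le_trans; exact: ler_norm.
Qed.

(** Let z = (i + 1)^alpha |x - y|. The difference is at most d Ce z and at most 2 Ce, and the
    constant 2 d Ce covers both. For z <= 1, theta <= 1 gives z^2 <= z^(2 theta); for z > 1, 1 <=
    z^(2 theta). Finally 2 alpha theta <= beta leaves a power of i that the eigenvalue sum
    absorbs. *)
Lemma basis_hoelder i x y : (0 < d)%N -> cube d L x -> cube d L y ->
  (e i x - e i y) ^+ 2 <= (2 * d%:R * Ce) ^+ 2 *
    (i.+1%:R `^ beta * `|x - y| `^ (2 * Num.min 1 (beta / (2 * alpha)))).
Proof.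
move=> d0 Dx Dy; set theta := Num.min _ _.
have theta0 : 0 < theta by rewrite lt_min ltr01 divr_gt0// mulr_gt0.
have d1 : (1 : R) <= d%:R by rewrite ler1n.
pose z := i.+1%:R `^ alpha * `|x - y|.
have z0 : 0 <= z by rewrite mulr_ge0 ?powR_ge0.
have zE : z `^ (2 * theta) <= i.+1%:R `^ beta * `|x - y| `^ (2 * theta).
  rewrite powRM ?powR_ge0// ler_wpM2r ?powR_ge0// -powRrM.
  apply: ler_powR; first by rewrite ler1n.
  have : theta <= beta / (2 * alpha) by rewrite ge_min lexx orbT.
  by rewrite ler_pdivlMr ?mulr_gt0//; lra.
apply: le_trans (_ : (2 * d%:R * Ce) ^+ 2 * z `^ (2 * theta) <= _); last first.
  by rewrite ler_wpM2l// sqr_ge0.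
have De : `|e i x - e i y| <= 2 * Ce.
  rewrite (le_trans (ler_normB _ _))// (_ : 2 * Ce = Ce + Ce); last by ring.
  by rewrite lerD// basis_norm_le.
have De2 : `|e i x - e i y| <= d%:R * Ce * z.
  by have := basis_lipschitz i Dx Dy; rewrite /z; congr (_ <= _); ring.
rewrite -(real_normK (num_real (e i x - e i y))).
have [z1|z1] := leP z 1.
  apply: (@le_trans _ _ ((2 * d%:R * Ce) ^+ 2 * z ^+ 2)).
    rewrite -exprMn lerXn2r ?nnegrE//; first by rewrite !mulr_ge0// ltW.
    apply: (le_trans De2); rewrite -!mulrA ler_peMl ?ler1n//.
    by rewrite !mulr_ge0// ltW.
  rewrite ler_wpM2l ?sqr_ge0//.
  have [->|zn0] := eqVneq z 0; first by rewrite expr0n powR_ge0.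
  rewrite -powR_mulrn//; apply: ger_powR; first by rewrite z1 andbT lt0r zn0.
  by rewrite ler_piMr// ge_min lexx.
apply: (@le_trans _ _ ((2 * d%:R * Ce) ^+ 2 * 1)).
  rewrite mulr1 lerXn2r ?nnegrE//; first by rewrite !mulr_ge0// ltW.
  by rewrite (le_trans De)// ler_wpM2r ?ler_peMr// ltW.
rewrite ler_wpM2l ?sqr_ge0// -[leLHS](powRr0 z).
by apply: ler_powR; [exact: ltW|rewrite mulr_ge0// ltW].
Qed.

End basis_bounds.

Lemma cvge0_near_le (R : realType) (I : Type) (F : set_system I) {FF : Filter F} (f : I -> \bar R) :
  f @ F --> 0%E -> forall e : R, 0 < e -> \forall x \near F, (f x <= e%:E)%E.
Proof.
move=> /fine_cvgP[ffin /cvgrPdist_le fe] e e0.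
apply: filterS2 ffin (fe e e0) => y fy /=; rewrite sub0r normrN => ye.
by rewrite -(fineK fy) lee_fin (le_trans (ler_norm _)).
Qed.

(** * The covariance function of a centred, mean-square continuous field *)

Section second_order_field.
Context d (T : measurableType d) (R : realType) (P : probability T R).
Variables (n : nat) (L : R) (W : 'rV[R]_n -> T -> R).
Local Notation D := (cube n L).
Hypothesis (WG : gaussian_random_field P D W).
Local Notation msqd x y := (\int[P]_w ((W x w - W y w) ^+ 2)%:E)%E.
Local Notation q := (covariance_function P W).

Lemma field_gaussian x : D x -> gaussian_variable P (W x).
Proof.
move=> Dx; have [+ _ _] := WG => /(_ 1%N (fun=> x) (fun=> Dx) (fun=> 1)).
by congr gaussian_variable; apply/funext => w; rewrite big_ord1 mul1r.
Qed.

Lemma field_measurable x : D x -> measurable_fun setT (W x).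
Proof. by move=> /field_gaussian[]. Qed.

Lemma field_sqr_lty x : D x -> (\int[P]_w (W x w ^+ 2)%:E < +oo)%E.
Proof. by move=> /field_gaussian/gaussian_variable_sqr_lty. Qed.

Lemma field_integrableM x y : D x -> D y -> P.-integrable setT (fun w => (W x w * W y w)%:E).
Proof.
by move=> Dx Dy; apply: integrableM_of_sqr; rewrite ?field_sqr_lty//; exact: field_measurable.
Qed.

Lemma msqd_cont x (e : R) : D x -> 0 < e -> exists2 r : R, 0 < r &
  forall y, D y -> `|x - y| < r -> (msqd y x <= e%:E)%E.
Proof.
move=> Dx e0; have [_ + _] := WG => /(_ x Dx).
rewrite unlock => /cvge0_near_le/(_ e e0).
rewrite near_withinE near_nbhs => /nbhs_ballP[r r0 Hr]; exists r => // y Dy xy.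
by apply: Hr => //; rewrite -ball_normE.
Qed.

Lemma msqd_triangle x y z : D x -> D y -> D z ->
  (msqd x z <= 2%:E * msqd x y + 2%:E * msqd y z)%E.
Proof.
move=> /field_measurable mx /field_measurable my /field_measurable mz.
apply: le_trans (integral_sqrD_le P measurableT (measurable_funB mx my) (measurable_funB my mz)).
rewrite le_eqVlt; apply/orP; left; apply/eqP; apply: eq_integral => w _.
by rewrite addrA subrK.
Qed.

Hypothesis (Wmean : forall x, D x -> 'E_P[W x]%E = 0%E).

Lemma covariance_functionE x y : D x -> D y -> (q x y)%:E = (\int[P]_w (W x w * W y w)%:E)%E.
Proof.
move=> Dx Dy.
have covE : covariance P (W x) (W y) = (\int[P]_w (W x w * W y w)%:E)%E.
  rewrite [in LHS]unlock !Wmean//= unlock; apply: eq_integral => w _ /=.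
  by rewrite !fctE /= !subr0.
rewrite /covariance_function covE fineK//.
exact: integrable_fin_num (field_integrableM Dx Dy).
Qed.

Lemma covariance_functionC x y : q x y = q y x.
Proof. by rewrite /covariance_function covarianceC. Qed.

Lemma covariance_quadratic (I : finType) (c : I -> R) (x : I -> 'rV[R]_n) :
  (forall i, D (x i)) ->
  (\int[P]_w ((\sum_i c i * W (x i) w) ^+ 2)%:E)%E =
    (\sum_i \sum_j c i * c j * q (x i) (x j))%:E.
Proof.
move=> Dx.
transitivity (\int[P]_w (\sum_(p : I * I) (c p.1 * c p.2)%:E * (W (x p.1) w * W (x p.2) w)%:E))%E.
  apply: eq_integral => w _.
  rewrite (eq_bigr (fun p : I * I => (c p.1 * W (x p.1) w * (c p.2 * W (x p.2) w))%:E)); last first.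
    by move=> p _; rewrite -EFinM mulrACA.
  rewrite sumEFin -(pair_bigA _ (fun i j : I => c i * W (x i) w * (c j * W (x j) w)))/=.
  by rewrite expr2 mulr_suml; congr EFin; apply: eq_bigr => i _; rewrite mulr_sumr.
have iWW (p : I * I) : P.-integrable setT (fun w => (W (x p.1) w * W (x p.2) w)%:E).
  exact: field_integrableM.
rewrite integral_sum//; last by move=> p; exact: integrableZl.
rewrite (eq_bigr (fun p : I * I => (c p.1 * c p.2 * q (x p.1) (x p.2))%:E)); last first.
  by move=> p _; rewrite integralZl// [in RHS]EFinM covariance_functionE.
by rewrite sumEFin -(pair_bigA _ (fun i j : I => c i * c j * q (x i) (x j))).
Qed.

Lemma msqdE x y : D x -> D y -> msqd x y = (q x x - 2 * q x y + q y y)%:E.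
Proof.
move=> Dx Dy.
pose z (i : 'I_2) := if i == ord0 then x else y.
pose c (i : 'I_2) : R := if i == ord0 then 1 else -1.
have -> : msqd x y = (\int[P]_w ((\sum_i c i * W (z i) w) ^+ 2)%:E)%E.
  apply: eq_integral => w _; rewrite !big_ord_recl big_ord0 /= /c /z /=.
  by rewrite addr0 mul1r mulN1r.
rewrite covariance_quadratic; last by move=> i; rewrite /z; case: ifP.
rewrite !big_ord_recl !big_ord0 /= /c /z /= (covariance_functionC y x).
by congr EFin; ring.
Qed.

(** Cauchy-Schwarz, read off from E(r W(x) - W(y) + W(y'))^2 >= 0 at r = B / A. The added 1 allows
    the division when W(x) has variance 0. *)
Lemma covariance_function_dist x y y' : D x -> D y -> D y' ->
  (((q x y - q x y') ^+ 2)%:E <= (q x x + 1)%:E * msqd y y')%E.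
Proof.
move=> Dx Dy Dy'; set A := q x x + 1; set B := q x y - q x y'.
have qxx : 0 <= q x x.
  rewrite -lee_fin covariance_functionE//; apply: integral_ge0 => w _.
  by rewrite lee_fin -expr2 sqr_ge0.
have A0 : 0 < A by rewrite ltr_wpDl.
pose r := B / A.
pose z (i : 'I_3) := if i == ord0 then x else if i == 1 then y else y'.
pose c (i : 'I_3) : R := if i == ord0 then r else if i == 1 then - 1 else 1.
have Dz i : D (z i) by rewrite /z; case: ifP => // _; case: ifP.
have : (0 <= \int[P]_w ((\sum_i c i * W (z i) w) ^+ 2)%:E)%E.
  by apply: integral_ge0 => w _; rewrite lee_fin sqr_ge0.
rewrite covariance_quadratic// !big_ord_recl !big_ord0 /= /c /z /= lee_fin.
rewrite (covariance_functionC y x) (covariance_functionC y' x) (covariance_functionC y' y).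
move=> H.
rewrite msqdE// -EFinM lee_fin mulrC -ler_pdivrMr//.
have rA : r * A = B by rewrite /r divfK// gt_eqF.
have -> : B ^+ 2 / A = r * B by rewrite /r; field; rewrite gt_eqF.
have r2 : r * r * q x x <= r * B.
  by rewrite -rA mulrA ler_wpM2l -?expr2 ?sqr_ge0// lerDl.
have r3 : r * q x y - r * q x y' = r * B by rewrite /B; ring.
nra.
Qed.

Lemma covariance_function_continuous x : D x -> {within D, continuous (q x)}.
Proof.
move=> Dx; apply/cube_continuousP => y Dy e e0.
have A0 : 0 < q x x + 1.
  rewrite ltr_wpDl// -lee_fin covariance_functionE//; apply: integral_ge0 => w _.
  by rewrite lee_fin -expr2 sqr_ge0.
pose e' := (e / 2) ^+ 2 / (q x x + 1).
have e'0 : 0 < e' by rewrite divr_gt0// exprn_gt0// divr_gt0.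
have [r r0 Hr] := msqd_cont Dy e'0; exists r => // z Dz yz.
have := covariance_function_dist Dx Dz Dy.
have := Hr z Dz yz; rewrite msqdE// lee_fin -EFinM lee_fin => h1 h2.
have {h1 h2} : (q x z - q x y) ^+ 2 <= (e / 2) ^+ 2.
  rewrite (le_trans h2)// mulrC -ler_pdivlMr//.
have e20 : 0 < e / 2 by rewrite divr_gt0.
rewrite -real_normK ?num_real// ler_pXn2r ?nnegrE ?(ltW e20)// distrC => h.
by apply: le_lt_trans h _; lra.
Qed.

End second_order_field.

(** The arithmetic of [msqd_hoelder]: two quadratic triangle inequalities multiply the middle term
    by 4, which with the 4 in front of t makes 16, while the errors add up to 2 eps / 6 + 4 eps / 6
    = eps. *)
Lemma chained_bound (R : realFieldType) (M a b c f g s t eps : R) :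
  a <= 2 * b + 2 * c -> c <= 2 * f + 2 * g -> f <= s -> b <= eps / 6 -> g <= eps / 6 ->
  s <= M * (4 * t) -> a <= 16 * M * t + eps.
Proof. by lra. Qed.

(** * Mean-square Hölder continuity *)

Section mercer.
Context d (T : measurableType d) (R : realType) (P : probability T R).
Variables (n : nat) (L : R) (W : 'rV[R]_n -> T -> R).
Local Notation D := (cube n L).
Local Notation msqd x y := (\int[P]_w ((W x w - W y w) ^+ 2)%:E)%E.
Local Notation q := (covariance_function P W).
Variables (lambda : nat -> R) (e : nat -> 'rV[R]_n -> R) (alpha beta Ce Clambda : R).
Hypotheses (n_gt0 : (0 < n)%N) (L0 : 0 < L) (WG : gaussian_random_field P D W)
  (Wmean : forall x, D x -> 'E_P[W x]%E = 0%E)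
  (eigenpairs : covariance_eigenpairs P D W lambda e)
  (eC1 : forall i, continuously_differentiable_on D (e i))
  (alpha_gt0 : 0 < alpha) (beta_gt0 : 0 < beta) (Ce_gt0 : 0 < Ce)
  (e_bounded : forall i, ('N[lebesgue_cube n L]_+oo[EFin \o e i] <= Ce%:E)%E)
  (grad_e_bounded : forall i,
     ('N[lebesgue_cube n L]_+oo[
         (fun x => (euclidean_norm (gradient (e i) x))%:E)]
       <= (Ce * i.+1%:R `^ alpha)%:E)%E)
  (lambda_summable :
     (\sum_(0 <= i <oo) (lambda i * i.+1%:R `^ beta)%:E <= Clambda%:E)%E).

Let mD : measurable D := @measurable_cube R n L.
Let me i : measurable_fun D (e i).
Proof. by have [/(_ i)[]] := let: And3 h _ _ := eigenpairs in h. Qed.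

(** The exceptional null set of the eigenvalue equation depends on i; these points avoid all of the
    countably many null sets at once. *)
Definition eigen_point (x : 'rV[R]_n) := forall i, covariance_operator P D W (e i) x = lambda i * e i x.

Lemma ae_eigen_point : {ae lebesgue_rV, forall x, D x -> eigen_point x}.
Proof.
have [_ aeQ _] := eigenpairs; have := ae_foralln aeQ.
by apply: filterS => x H Dx i; exact: H.
Qed.

Definition mercer_sum (x : 'rV[R]_n) k (y : 'rV[R]_n) := \sum_(i < k) lambda i * e i x * e i y.

Lemma measurable_mercer_sum x k : measurable_fun D (mercer_sum x k).
Proof. by apply: measurable_sum => i; exact: measurable_funM. Qed.

Let mq x (Dx : D x) : measurable_fun D (q x).
Proof. by apply: (cube_continuous_measurable L0); exact: covariance_function_continuous. Qed.

(** At such a point lambda_i e_i(x) is the i-th Fourier coefficient of q(x, .), so the Mercer sum is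
    its partial Fourier sum and completeness of the basis applies. *)
Lemma mercer_L2 x : D x -> eigen_point x ->
  (\int[lebesgue_rV]_(y in D) ((q x y - mercer_sum x k y) ^+ 2)%:E)%E @[k --> \oo] --> 0%E.
Proof.
move=> Dx ex; have [[_ _ basis] _ _] := eigenpairs.
have := basis (q x) (cube_bounded_mem_L2 L0 (covariance_function_continuous WG Wmean Dx)).
apply: cvg_trans; apply: near_eq_cvg; apply: nearW => k.
apply: eq_integral => y _; congr ((_ - _) ^+ 2)%:E.
by apply: eq_bigr => i _; rewrite -ex.
Qed.

Let int_e2 i : (\int[lebesgue_rV]_(y in D) (e i y ^+ 2)%:E = 1)%E.
Proof.
have [[_ /(_ i i) ortho _] _ _] := eigenpairs.
move: ortho; rewrite eqxx /inner_L2 /Rintegral => h.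
(* [Rintegral] turns an infinite integral into 0, so the value 1 forces the extended integral to be
   finite. *)
have fin : (\int[lebesgue_rV]_(x in D) (e i x * e i x)%:E)%E \is a fin_num.
  by apply: contra_eqT h; rewrite fin_numE negb_and !negbK => /orP[]/eqP->; rewrite eq_sym oner_eq0.
by under eq_integral do rewrite expr2; rewrite -(fineK fin) h.
Qed.

(** Consecutive Mercer sums differ by lambda_k e_k(x) e_k, and e_k has norm 1; the coefficient is
    therefore controlled by two consecutive remainders in L^2. *)
Lemma mercer_coef_cvg0 x : D x -> eigen_point x -> (lambda k * e k x) @[k --> \oo] --> 0.
Proof.
move=> Dx ex; apply/cvgrPdist_le => eps eps0.
pose I k := (\int[lebesgue_rV]_(y in D) ((q x y - mercer_sum x k y) ^+ 2)%:E)%E.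
have e'0 : 0 < eps ^+ 2 / 4 by rewrite divr_gt0// exprn_gt0.
have := cvge0_near_le (mercer_L2 Dx ex) e'0 => -[N _ HN].
exists N => // k /= Nk; rewrite sub0r normrN.
have mS j : measurable_fun D (fun y => q x y - mercer_sum x j y).
  by apply: measurable_funB; [exact: mq|exact: measurable_mercer_sum].
have : (((lambda k * e k x) ^+ 2)%:E <= 2%:E * I k.+1 + 2%:E * I k)%E.
  rewrite -[leLHS]mule1 -(int_e2 k) -ge0_integralZl//; last 3 first.
  - exact: measurable_EFin_sqr.
  - by move=> y _; rewrite lee_fin sqr_ge0.
  - by rewrite lee_fin sqr_ge0.
  have mN : measurable_fun D (fun y => - (q x y - mercer_sum x k.+1 y)) by exact: measurable_funN.
  apply: le_trans (_ : \int[lebesgue_rV]_(y in D)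
     ((- (q x y - mercer_sum x k.+1 y) + (q x y - mercer_sum x k y)) ^+ 2)%:E <= _)%E.
    rewrite le_eqVlt; apply/orP; left; apply/eqP/eq_integral => y _.
    rewrite -EFinM -exprMn; congr ((_ ^+ 2)%:E).
    by rewrite /mercer_sum big_ord_recr /=; ring.
  apply: le_trans (integral_sqrD_le _ mD mN (mS k)) _.
  by under [X in (2%:E * X + _ <= _)%E]eq_integral do rewrite sqrrN.
move=> h; rewrite -(ler_pXn2r (n := 2))// ?nnegrE// ?(ltW eps0)// real_normK ?num_real//.
rewrite -lee_fin (le_trans h)//.
apply: (@le_trans _ _ (2%:E * (eps ^+ 2 / 4)%:E + 2%:E * (eps ^+ 2 / 4)%:E)%E).
  by apply: leeD; rewrite lee_wpmul2l//; apply: HN => /=; rewrite // leqW.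
by rewrite -!EFinM -EFinD lee_fin; lra.
Qed.

(* As [lambda_k e_k] tends to 0 almost everywhere, a negative eigenvalue would, by monotonicity,
   force [e_k] to tend to 0 as well, against [int e_k^2 = 1]. *)
Lemma eigenvalue_ge0 i : 0 <= lambda i.
Proof.
have [_ _ ni] := eigenpairs; rewrite leNgt; apply/negP => li.
have e_cvg0 x : D x -> eigen_point x -> e k x @[k --> \oo] --> 0.
  move=> Dx ex; apply/cvgrPdist_le => eps eps0.
  have e'0 : 0 < - lambda i * eps by rewrite mulr_gt0// oppr_gt0.
  have /cvgrPdist_le/(_ _ e'0)[N _ HN] := mercer_coef_cvg0 Dx ex.
  exists (maxn N i) => // k /=; rewrite geq_max => /andP[Nk ik].
  have := HN k Nk; rewrite /= !sub0r !normrN normrM => h.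
  have lk : - lambda i <= `|lambda k|.
    by rewrite -normrN (le_trans _ (ler_norm _))// lerN2; exact: ni.
  have := le_trans (ler_wpM2r (normr_ge0 (e k x)) lk) h.
  by rewrite ler_pM2l// oppr_gt0.
have [] := @dominated_convergence _ _ R (@lebesgue_rV R n) D mD
  (fun k y => (e k y ^+ 2)%:E) (cst 0%E) (cst (Ce ^+ 2)%:E).
- by move=> k; exact: measurable_EFin_sqr.
- exact: measurable_cst.
- apply: filterS ae_eigen_point => x ex Dx.
  have /(cvgM (e_cvg0 x Dx (ex Dx))) := e_cvg0 x Dx (ex Dx).
  rewrite mulr0 => h; apply: cvg_EFin; first exact: nearW.
  by apply: cvg_trans h; apply: near_eq_cvg; apply: nearW => k /=; rewrite expr2.
- apply/integrableP; split; first exact: measurable_cst.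
  rewrite integral_cst// [X in (_ * X)%E](lebesgue_cubeE n L0).
  by rewrite -EFinM ltry.
- apply: nearW => x k Dx /=; rewrite lee_fin ger0_norm ?sqr_ge0//.
  rewrite -real_normK ?num_real// lerXn2r ?nnegrE ?(ltW Ce_gt0)//.
  exact: (basis_norm_le L0 eC1 e_bounded).
move=> _ _; rewrite integral0_eq// => h.
have : (fun=> 1%E : \bar R) @ \oo --> (0 : \bar R)%E.
  by apply: cvg_trans h; apply: near_eq_cvg; apply: nearW => k; rewrite /= int_e2.
move=> /(@cvg_unique _ (@ereal_hausdorff R) _ _ _ _ (cvg_cst _)) /eqP.
by rewrite eqe oner_eq0.
Qed.

Lemma eigenvalue_sum_le k : \sum_(i < k) lambda i * i.+1%:R `^ beta <= Clambda.
Proof.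
rewrite -lee_fin (le_trans _ lambda_summable)// -sumEFin.
rewrite -(big_mkord xpredT (fun i => (lambda i * i.+1%:R `^ beta)%:E)).
by apply: nneseries_lim_ge => i _ _; rewrite lee_fin mulr_ge0 ?powR_ge0 ?eigenvalue_ge0.
Qed.

Let theta := Num.min 1 (beta / (2 * alpha)).
Let theta_gt0 : 0 < theta.
Proof. by rewrite lt_min ltr01 divr_gt0// mulr_gt0. Qed.

Let pow_ge1 i : 1 <= i.+1%:R `^ beta.
Proof.
rewrite -[leLHS](powRr0 i.+1%:R).
by apply: ler_powR; [rewrite ler1n|exact: ltW].
Qed.

Let e_le i x : D x -> `|e i x| <= Ce.
Proof. exact: (basis_norm_le L0 eC1 e_bounded). Qed.
Let e_hoelder i x y := @basis_hoelder R n L e alpha beta Ce L0 eC1 alpha_gt0 beta_gt0 Ce_gt0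
  e_bounded grad_e_bounded i x y n_gt0.

(** The estimate is uniform in k, so the limit inherits this modulus of continuity. Taking the
    square root of [basis_hoelder] leaves (i + 1)^(beta / 2), which is enlarged to (i + 1)^beta to
    match the eigenvalue sum. *)
Lemma mercer_sum_hoelder x k y y' : D x -> D y -> D y' ->
  `|mercer_sum x k y - mercer_sum x k y'| <=
    Ce * (2 * n%:R * Ce) * Clambda * `|y - y'| `^ theta.
Proof.
move=> Dx Dy Dy'; rewrite /mercer_sum -sumrB (le_trans (ler_norm_sum _ _ _))//.
apply: (@le_trans _ _ (\sum_(i < k) (lambda i * i.+1%:R `^ beta) *
   (Ce * (2 * n%:R * Ce) * `|y - y'| `^ theta))); last first.
  rewrite -mulr_suml (le_trans (ler_wpM2r _ (eigenvalue_sum_le k)))//.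
    by rewrite !mulr_ge0 ?powR_ge0// ltW.
  by rewrite mulrC -!mulrA !ler_wpM2l ?(ltW Ce_gt0)// mulrC.
apply: ler_sum => i _; rewrite -mulrBr normrM normrM (ger0_norm (eigenvalue_ge0 i)).
have h : `|e i y - e i y'| <= 2 * n%:R * Ce * (i.+1%:R `^ beta * `|y - y'| `^ theta).
  have c0 : 0 <= 2 * n%:R * Ce by rewrite !mulr_ge0// ltW.
  rewrite -(ler_pXn2r (n := 2))// ?nnegrE//; last by rewrite mulr_ge0// mulr_ge0 ?powR_ge0.
  rewrite real_normK ?num_real// (le_trans (e_hoelder i Dy Dy'))//.
  rewrite [leRHS]exprMn ler_wpM2l ?sqr_ge0// [leRHS]exprMn -/theta (mulrC 2) powRrM.
  rewrite powR_mulrn ?powR_ge0// ler_wpM2r ?sqr_ge0//.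
  by rewrite expr2 ler_peMl ?powR_ge0.
rewrite -!mulrA ler_wpM2l ?eigenvalue_ge0//.
apply: (le_trans (ler_pM _ _ (e_le i Dx) h)) => //.
by rewrite le_eqVlt; apply/orP; left; apply/eqP; ring.
Qed.

Lemma mercer_sum_cvg x y : D x -> D y -> cvgn (mercer_sum x ^~ y).
Proof.
move=> Dx Dy.
have -> : mercer_sum x ^~ y = series (fun i => lambda i * e i x * e i y).
  by apply/funext => k; rewrite /series /= big_mkord.
apply: normed_cvg; apply: (@series_le_cvg _ _ (fun i => Ce ^+ 2 * (lambda i * i.+1%:R `^ beta))).
- by move=> i /=.
- by move=> i; rewrite mulr_ge0 ?sqr_ge0// mulr_ge0 ?powR_ge0 ?eigenvalue_ge0.
- move=> i /=; rewrite !normrM (ger0_norm (eigenvalue_ge0 i)) -mulrA [leRHS]mulrCA.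
  rewrite ler_wpM2l ?eigenvalue_ge0//; apply: (@le_trans _ _ (Ce * Ce)).
    by apply: ler_pM => //; exact: e_le.
  by rewrite -expr2 ler_peMr ?sqr_ge0.
- apply: nondecreasing_is_cvgn.
    apply/nondecreasing_seqP => k; rewrite /series /= big_nat_recr//= lerDl.
    by rewrite mulr_ge0 ?sqr_ge0// mulr_ge0 ?powR_ge0 ?eigenvalue_ge0.
  exists (Ce ^+ 2 * Clambda) => _ [k _ <-].
  by rewrite /series /= big_mkord -mulr_sumr ler_wpM2l ?sqr_ge0 ?eigenvalue_sum_le.
Qed.

(* The two sides agree almost everywhere in [y] and are continuous. *)
Lemma mercer x y : D x -> eigen_point x -> D y -> mercer_sum x k y @[k --> \oo] --> q x y.
Proof.
move=> Dx ex Dy; pose K z := limn (mercer_sum x ^~ z).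
have KE z : D z -> mercer_sum x k z @[k --> \oo] --> K z by exact: mercer_sum_cvg.
have mK : measurable_fun D K.
  by apply: (measurable_fun_cvg (h := mercer_sum x)) => // k; exact: measurable_mercer_sum.
have mqK : measurable_fun D (fun z => q x z - K z) by exact: measurable_funB (mq Dx) mK.
pose f k z := ((q x z - mercer_sum x k z) ^+ 2)%:E.
have mf k : measurable_fun D (f k).
  by apply/measurable_EFin_sqr/measurable_funB; [exact: mq|exact: measurable_mercer_sum].
have f0 k z : D z -> (0 <= f k z)%E by move=> _; rewrite lee_fin sqr_ge0.
have fK z : D z -> limn_einf (f ^~ z) = ((q x z - K z) ^+ 2)%:E.
  move=> Dz; suff /cvg_limn_einf_sup[-> _] :
    f k z @[k --> \oo] --> ((q x z - K z) ^+ 2)%:E by [].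
  apply: cvg_EFin; first exact: nearW.
  rewrite expr2; have h : (q x z - mercer_sum x k z) @[k --> \oo] --> q x z - K z.
    by apply: cvgB; [exact: cvg_cst|exact: KE].
  by apply: cvg_trans (cvgM h h); apply: near_eq_cvg; apply: nearW => k /=; rewrite expr2.
(* Fatou: the pointwise limit [K] of the partial sums must agree in L^2 with their L^2 limit q(x,
   .). *)
have int0 : (\int[lebesgue_rV]_(z in D) ((q x z - K z) ^+ 2)%:E = 0)%E.
  apply/eqP; rewrite eq_le; apply/andP; split; last first.
    by apply: integral_ge0 => z _; rewrite lee_fin sqr_ge0.
  have [li _] := cvg_limn_einf_sup (mercer_L2 Dx ex).
  rewrite -[leRHS]li; apply: le_trans (fatou (@lebesgue_rV R n) mD mf f0).
  rewrite le_eqVlt; apply/orP; left; apply/eqP/eq_integral => z; rewrite inE => Dz.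
  by rewrite fK.
have aeqK : {ae lebesgue_rV, forall z, D z -> q x z = K z}.
  have := (ae_eq_integral_abs (@lebesgue_rV R n) mD (measurable_EFin_sqr mqK)).1.
  have -> : (\int[lebesgue_rV]_(z in D) `|((q x z - K z) ^+ 2)%:E| = 0)%E.
    by rewrite -[RHS]int0; apply: eq_integral => z _; rewrite gee0_abs// lee_fin sqr_ge0.
  move=> /(_ erefl); apply: filterS => z H Dz; have := H Dz.
  by move=> [] /eqP; rewrite sqrf_eq0 subr_eq0 => /eqP.
suff : q x y = K y by move=> ->; exact: KE.
apply/eqP; rewrite -subr_eq0 -normr_le0; apply/ler_addgt0Pr => eps eps0.
pose M := Ce * (2 * n%:R * Ce) * Clambda.
have M0 : 0 <= M.
  rewrite mulr_ge0 ?mulr_ge0// ?(ltW Ce_gt0)//.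
  by apply: le_trans (eigenvalue_sum_le 0); rewrite big_ord0.
have eps20 : 0 < eps / 2 by rewrite divr_gt0.
have /cube_continuousP/(_ y Dy _ eps20)[r r0 Hr] := covariance_function_continuous WG Wmean Dx.
(* Chosen so that (M + 1) r'^theta = eps / 2, which makes the Hölder modulus of [K] at distance r'
   at most eps / 2. *)
pose r' := (eps / 2 / (M + 1)) `^ theta^-1.
have M1 : 0 < M + 1 by rewrite ltr_wpDl.
have r'0 : 0 < r' by rewrite powR_gt0// divr_gt0.
have m0 : 0 < Num.min r r' by rewrite lt_min r0.
have [z [oz qKz]] := ae_dense_cube L0 aeqK Dy m0.
rewrite lt_min => /andP[yzr yzr'].
have Dz := open_cube_sub oz.
have h1 := Hr z Dz yzr.
have h2 : `|K y - K z| <= eps / 2.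
  have cv : `|mercer_sum x k y - mercer_sum x k z| @[k --> \oo] --> `|K y - K z|.
    by apply: cvg_norm; apply: cvgB; exact: KE.
  rewrite -(cvg_lim _ cv)//; apply: limr_le; first by apply/cvg_ex; eexists; exact: cv.
  apply: nearW => k; apply: le_trans (mercer_sum_hoelder k Dx Dy Dz) _.
  rewrite -/M; apply: (@le_trans _ _ ((M + 1) * `|y - z| `^ theta)).
    by rewrite ler_wpM2r ?powR_ge0// lerDl.
  rewrite mulrC -ler_pdivlMr//.
  rewrite (_ : eps / 2 / (M + 1) = r' `^ theta).
    by apply: ge0_ler_powR; rewrite ?nnegrE// ltW.
  by rewrite /r' -powRrM mulVf ?gt_eqF// powRr1// ltW// divr_gt0.
rewrite add0r (_ : q x y - K y = (q x y - q x z) - (K y - K z)); last by rewrite qKz; ring.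
by apply: (le_trans (ler_normB _ _)); lra.
Qed.

Lemma msqd_hoelder_eigen x y : D x -> eigen_point x -> D y -> eigen_point y ->
  (msqd x y <= ((2 * n%:R * Ce) ^+ 2 * Clambda * `|x - y| `^ (2 * theta))%:E)%E.
Proof.
move=> Dx ex Dy ey; rewrite (msqdE WG Wmean)// lee_fin.
pose u k := mercer_sum x k x - 2 * mercer_sum x k y + mercer_sum y k y.
have uq : u k @[k --> \oo] --> q x x - 2 * q x y + q y y.
  apply: cvgD; last exact: mercer.
  apply: cvgB; first exact: mercer.
  by apply: cvgM; [exact: cvg_cst|exact: mercer].
rewrite -(cvg_lim _ uq)//; apply: limr_le; first by apply/cvg_ex; eexists; exact: uq.
apply: nearW => k.
have -> : u k = \sum_(i < k) lambda i * (e i x - e i y) ^+ 2.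
  rewrite /u /mercer_sum mulr_sumr -sumrB -big_split /=; apply: eq_bigr => i _; ring.
apply: (@le_trans _ _ (\sum_(i < k) (lambda i * i.+1%:R `^ beta) *
   ((2 * n%:R * Ce) ^+ 2 * `|x - y| `^ (2 * theta)))).
  apply: ler_sum => i _; rewrite -mulrA ler_wpM2l ?eigenvalue_ge0//.
  by rewrite mulrCA; exact: e_hoelder.
rewrite -mulr_suml -[leRHS]mulrA [leRHS]mulrCA ler_wpM2r ?eigenvalue_sum_le//.
by rewrite mulr_ge0 ?sqr_ge0 ?powR_ge0.
Qed.

Lemma msqd_hoelder : exists2 C : R, 0 <= C & forall x y, D x -> D y ->
  (msqd x y <= (C * `|x - y| `^ (2 * Num.min 1 (beta / (2 * alpha))))%:E)%E.
Proof.
pose M := (2 * n%:R * Ce) ^+ 2 * Clambda.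
have M0 : 0 <= M.
  rewrite mulr_ge0 ?sqr_ge0//.
  by apply: le_trans (eigenvalue_sum_le 0); rewrite big_ord0.
exists (16 * M); first by rewrite mulr_ge0.
move=> x y Dx Dy; rewrite -/theta.
have [->|xy] := eqVneq x y.
  rewrite (eq_integral (cst 0%E)) ?integral0; last first.
    by move=> w _; rewrite subrr expr0n.
  by rewrite lee_fin mulr_ge0 ?powR_ge0// mulr_ge0.
have xy0 : 0 < `|x - y| by rewrite normr_gt0 subr_eq0.
apply/lee_addgt0Pr => eps eps0.
have eps60 : 0 < eps / 6 by rewrite divr_gt0.
(* Moving each end point by less than |x - y| / 2 at most doubles their distance, which costs the
   factor 2^(2 theta) <= 4. This radius is positive because the case x = y has been removed. *)
have approx z : D z -> exists z', [/\ D z', eigen_point z', (msqd z' z <= (eps / 6)%:E)%E &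
    `|z - z'| < `|x - y| / 2].
  move=> Dz; have [r r0 Hr] := msqd_cont WG Dz eps60.
  have m0 : 0 < Num.min r (`|x - y| / 2) by rewrite lt_min r0 divr_gt0.
  have [z' [oz' ez']] := ae_dense_cube L0 ae_eigen_point Dz m0.
  rewrite lt_min => /andP[zr zxy]; exists z'.
  by split => //; [exact: open_cube_sub|apply: Hr => //; exact: open_cube_sub].
have [x' [Dx' ex' mx' xx']] := approx x Dx.
have [y' [Dy' ey' my' yy']] := approx y Dy.
have msqdC a b : msqd a b = msqd b a.
  by apply: eq_integral => w _; rewrite -sqrrN opprB.
have h1 := msqd_triangle WG Dx Dx' Dy.
have h2 := msqd_triangle WG Dx' Dy' Dy.
have h3 := msqd_hoelder_eigen Dx' ex' Dy' ey'.
rewrite msqdC in mx'; move: h1 h2 h3 mx' my'.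
rewrite !(msqdE WG Wmean)// -/M -!EFinM -!EFinD !lee_fin => h1 h2 h3 h4 h5.
have h6 : `|x' - y'| `^ (2 * theta) <= 4 * `|x - y| `^ (2 * theta).
  apply: (@le_trans _ _ ((2 * `|x - y|) `^ (2 * theta))).
    apply: ge0_ler_powR; rewrite ?nnegrE// ?mulr_ge0//; first exact: ltW.
    have : `|x' - y'| <= `|x' - x| + (`|x - y| + `|y - y'|).
      by rewrite (le_trans (ler_distD x _ _))// lerD2l; exact: ler_distD.
    rewrite (distrC x' x); lra.
  rewrite (powRM _ (ler0n _ 2) (normr_ge0 _)); apply: ler_wpM2r; first exact: powR_ge0.
  rewrite (_ : 4 = 2 `^ 2%:R :> R); last by rewrite powR_mulrn// -natrX.
  apply: ler_powR; first by rewrite ler1n.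
  by rewrite ler_piMr// ge_min lexx.
exact: chained_bound h1 h2 h3 h4 h5 (ler_wpM2l M0 h6).
Qed.

End mercer.

Lemma events_of_measurable_fun d (T : measurableType d) (R : realType) (I : Type)
    (S : set I) (X : I -> T -> R) i : S i ->
  measurable_fun [set: g_sigma_algebraType (events_of S X)]
    (X i : g_sigma_algebraType (events_of S X) -> R).
Proof.
move=> Si _ B mB; apply: sub_sigma_algebra; exists i => //.
by exists B => //; rewrite setTI.
Qed.

Lemma events_of_measurable d (T : measurableType d) (R : realType) (I : Type)
    (S : set I) (X : I -> T -> R) : (forall i, S i -> measurable_fun setT (X i)) ->
  events_of S X `<=` measurable.
Proof. by move=> mX _ [i Si [B mB <-]]; exact: mX. Qed.

(** * The grid-interpolation approximation *)

Section grid_approximation.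
Context d (T : measurableType d) (R : realType) (P : probability T R).
Variables (n : nat) (L : R) (W : 'rV[R]_n -> T -> R).
Local Notation D := (cube n L).
Variables (lambda : nat -> R) (e : nat -> 'rV[R]_n -> R) (alpha beta Ce Clambda : R).
Hypotheses (n_gt0 : (0 < n)%N) (L0 : 0 < L) (WG : gaussian_random_field P D W)
  (Wmean : forall x, D x -> 'E_P[W x]%E = 0%E)
  (eigenpairs : covariance_eigenpairs P D W lambda e)
  (eC1 : forall i, continuously_differentiable_on D (e i))
  (alpha_gt0 : 0 < alpha) (beta_gt0 : 0 < beta) (Ce_gt0 : 0 < Ce)
  (e_bounded : forall i, ('N[lebesgue_cube n L]_+oo[EFin \o e i] <= Ce%:E)%E)
  (grad_e_bounded : forall i,
     ('N[lebesgue_cube n L]_+oo[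
         (fun x => (euclidean_norm (gradient (e i) x))%:E)]
       <= (Ce * i.+1%:R `^ alpha)%:E)%E)
  (lambda_summable :
     (\sum_(0 <= i <oo) (lambda i * i.+1%:R `^ beta)%:E <= Clambda%:E)%E).
Variables (WN : nat -> 'rV[R]_n -> T -> R) (rate : nat -> R) (gamma : R).
Hypotheses (WN_grid : grid_approximation L W WN)
  (gamma_lt : gamma < Num.min 1 (beta / (2 * alpha)))
  (rateE : forall N, (0 < N)%N -> rate N = N%:R `^ (- gamma)).

Lemma grid_approximation_rate : exists2 C : R, 0 <= C & forall N x, (0 < N)%N -> D x ->
  (\int[P]_w ((WN N x w - W x w) ^+ 2)%:E <= (C * rate N ^+ 2)%:E)%E.
Proof.
have [C C0 HC] := msqd_hoelder n_gt0 L0 WG Wmean eigenpairs eC1 alpha_gt0 beta_gt0 Ce_gt0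
  e_bounded grad_e_bounded lambda_summable.
exists C => // N x N0 Dx; have [m Hm] := WN_grid; have [m0 mN WNE] := Hm N N0.
under eq_integral do rewrite WNE//.
apply: integral_sqr_interpolation => //.
  by move=> y; exact: (field_measurable WG).
move=> k xk; apply: (le_trans (HC _ _ (cube_grid_point L0 m0 k) Dx)).
rewrite lee_fin ler_wpM2l// rateE//.
have N1 : (1 : R) <= N%:R by rewrite ler1n.
have theta0 : 0 < Num.min 1 (beta / (2 * alpha)) by rewrite lt_min ltr01 divr_gt0// mulr_gt0.
(* The node lies within one mesh, hence within 1/N, of x; as N >= 1 and gamma < theta, N^(-2 theta)
   is at most N^(-2 gamma) = R(N)^2. *)
apply: (@le_trans _ _ ((N%:R `^ (-1)) `^ (2 * Num.min 1 (beta / (2 * alpha))))).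
  apply: ge0_ler_powR; rewrite ?nnegrE ?powR_ge0//; first by rewrite mulr_ge0// ltW.
  by rewrite powR_inv1// distrC (le_trans xk).
rewrite -powR_mulrn ?powR_ge0// -!powRrM; apply: ler_powR => //.
by move: gamma_lt; set t := Num.min _ _ => ?; lra.
Qed.

Lemma grid_approximation_version N x : (0 < N)%N -> D x ->
  exists2 h : T -> R,
    measurable_fun [set: g_sigma_algebraType (events_of D W)]
      (h : g_sigma_algebraType (events_of D W) -> R) &
    {ae P, forall w, WN N x w = h w}.
Proof.
move=> N0 Dx; have [m Hm] := WN_grid; have [m0 _ WNE] := Hm N N0.
exists (fun w => multilinear_interpolation L (m N) (W ^~ w) x); last first.
  by apply: nearW => w; exact: WNE.
apply: measurable_sum => k; apply: measurable_funM => //.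
apply: events_of_measurable_fun; exact: cube_grid_point.
Qed.

Lemma grid_approximation_measurable N : (0 < N)%N ->
  measurable_fun ([set: T] `*` D) (fun z : T * 'rV[R]_n => WN N z.2 z.1).
Proof.
move=> N0; have [m Hm] := WN_grid; have [m0 _ WNE] := Hm N N0.
apply: (eq_measurable_fun (fun z : T * 'rV[R]_n =>
    \sum_(k : {ffun 'I_n -> 'I_(m N).+1}) W (grid_point L k) z.1 * grid_weight L k z.2)).
  by move=> z; rewrite inE => -[_ Dz]; rewrite WNE.
apply: measurable_funTS; apply: measurable_sum => k; apply: measurable_funM.
  apply: (measurableT_comp (f := W (grid_point L k))) => //.
  by apply: (field_measurable WG); exact: cube_grid_point.
by apply: (measurableT_comp (f := grid_weight L k)) => //; exact: measurable_grid_weight.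
Qed.

End grid_approximation.

(** * Integrals of bounded functions over the cube *)

Section cube_integrals.
Context {R : realType} (n : nat) (L : R).
Hypothesis L0 : 0 < L.
Local Notation D := (cube n L).
Local Notation mu := (@lebesgue_rV R n).

Lemma cube_bounded_integrable (f : 'rV[R]_n -> R) (M : R) : measurable_fun D f ->
  (forall x, D x -> `|f x| <= M) -> mu.-integrable D (EFin \o f).
Proof.
move=> mf fM; apply: measurable_bounded_integrable => //.
- exact: measurable_cube.
- by rewrite [ltLHS](lebesgue_cubeE n L0) ltry.
- exists M; split; first exact: num_real.
  by move=> y My x Dx; exact: le_trans (fM x Dx) (ltW My).
Qed.

Lemma cube_Rintegral_le (f : 'rV[R]_n -> R) (M : R) : measurable_fun D f ->
  (forall x, D x -> `|f x| <= M) -> `|\int[mu]_(x in D) f x| <= M * L ^+ n.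
Proof.
move=> mf fM; have mD := @measurable_cube R n L.
have intf := cube_bounded_integrable mf fM.
apply: (le_trans (le_normr_Rintegral mD intf)).
have -> : M * L ^+ n = \int[mu]_(x in D) M.
  by rewrite Rintegral_cst// [X in fine X](lebesgue_cubeE n L0).
apply: le_Rintegral => //.
- apply: (@cube_bounded_integrable (fun x => `|f x|) M); first exact: measurableT_comp.
  by move=> x Dx; rewrite normr_id fM.
- by apply: (@cube_bounded_integrable (cst M) `|M|).
Qed.

Lemma Rintegral_sum_cube (I : finType) (f : I -> 'rV[R]_n -> R) :
  (forall i, mu.-integrable D (EFin \o f i)) ->
  \int[mu]_(x in D) (\sum_i f i x) = \sum_i \int[mu]_(x in D) f i x.
Proof.
move=> intf; have mD := @measurable_cube R n L.
rewrite /Rintegral; under eq_integral do rewrite -sumEFin.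
rewrite integral_sum//.
rewrite (eq_bigr (fun i => (fine (\int[mu]_(x in D) (f i x)%:E)%E)%:E)); last first.
  by move=> i _; rewrite fineK//; exact: integrable_fin_num (intf i).
by rewrite sumEFin.
Qed.

End cube_integrals.

(** * The Karhunen-Loève approximation *)

Section karhunen_loeve.
Context d (T : measurableType d) (R : realType) (P : probability T R).
Variables (n : nat) (L : R) (W : 'rV[R]_n -> T -> R).
Local Notation D := (cube n L).
Variables (lambda : nat -> R) (e : nat -> 'rV[R]_n -> R) (alpha beta Ce Clambda : R).
Hypotheses (n_gt0 : (0 < n)%N) (L0 : 0 < L) (WG : gaussian_random_field P D W)
  (ebasis : orthonormal_basis_L2 D e) (lambda_ni : nonincreasing_seq lambda)
  (eC1 : forall i, continuously_differentiable_on D (e i))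
  (beta_gt0 : 0 < beta) (Ce_gt0 : 0 < Ce)
  (e_bounded : forall i, ('N[lebesgue_cube n L]_+oo[EFin \o e i] <= Ce%:E)%E)
  (grad_e_bounded : forall i,
     ('N[lebesgue_cube n L]_+oo[
         (fun x => (euclidean_norm (gradient (e i) x))%:E)]
       <= (Ce * i.+1%:R `^ alpha)%:E)%E)
  (lambda_summable :
     (\sum_(0 <= i <oo) (lambda i * i.+1%:R `^ beta)%:E <= Clambda%:E)%E).
Variables (Z : nat -> T -> R) (s2 : R).
Hypotheses (mZ : forall i, measurable_fun setT (Z i)) (s2_ge0 : 0 <= s2)
  (Zsum : forall k (a : 'I_k -> R),
    (\int[P]_w ((\sum_(i < k) a i * Z i w) ^+ 2)%:E = (s2 * \sum_(i < k) a i ^+ 2)%:E)%E)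
  (Zcvg : forall eps : R, 0 < eps -> \forall N \near \oo, forall x, D x ->
    ('E_P[(fun w => (W x w - KL_sum lambda e Z N x w) ^+ 2)%R] <= eps%:E)%E).

Let mD : measurable D := @measurable_cube R n L.
Let me i : measurable_fun D (e i).
Proof. by have [/(_ i)[]] := ebasis. Qed.
Let e_le i x : D x -> `|e i x| <= Ce.
Proof. exact: (basis_norm_le L0 eC1 e_bounded). Qed.
Let mW x : D x -> measurable_fun setT (W x).
Proof. exact: (field_measurable WG). Qed.

Lemma measurable_KL_sum N x : measurable_fun setT (KL_sum lambda e Z N x).
Proof.
by apply: measurable_sum => i; apply: measurable_funM => //; exact: measurable_funM.
Qed.

(* If some eigenvalue is negative, then all later ones are, and their square roots vanish. *)
Lemma sqrt_eigenvalue_tail : exists2 C : R, 0 <= C & forall N M, (0 < N)%N ->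
  \sum_(i < M | (N <= i)%N) Num.sqrt (lambda i) ^+ 2 <= C * N%:R `^ (- beta).
Proof.
(* For i >= N the factor (i + 1)^beta N^(-beta) is at least 1; inserting it extracts the decay from
   the weighted sum. *)
have pos N M (F : nat -> R) : (0 < N)%N -> (forall i, 0 <= F i) ->
    \sum_(i < M | (N <= i)%N) F i <=
    (\sum_(i < M | (N <= i)%N) F i * i.+1%:R `^ beta) * N%:R `^ (- beta).
  move=> N0 F0; rewrite mulr_suml; apply: ler_sum => i Ni.
  rewrite -mulrA ler_peMr// powRN ler_pdivlMr ?powR_gt0 ?ltr0n// mul1r; apply: ge0_ler_powR; rewrite ?nnegrE ?ler0n//; first exact: ltW.
  by rewrite ler_nat leqW.
have [l0|] := pselect (forall i, 0 <= lambda i).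
  have C0 : 0 <= Clambda.
    rewrite -lee_fin (le_trans _ lambda_summable)//.
    by apply: nneseries_ge0 => i _ _; rewrite lee_fin mulr_ge0 ?powR_ge0// l0.
  exists Clambda => // N M N0; apply: le_trans (pos N M (fun i => Num.sqrt (lambda i) ^+ 2) N0 _) _.
    by move=> i; rewrite sqr_ge0.
  rewrite ler_wpM2r ?powR_ge0//.
  under eq_bigr do rewrite sqr_sqrtr//.
  rewrite -lee_fin (le_trans _ lambda_summable)//.
  apply: (@le_trans _ _ (\sum_(i < M) (lambda i * i.+1%:R `^ beta)%:E)%E).
    rewrite sumEFin lee_fin big_mkcond /=; apply: ler_sum => i _.
    by case: ifP => // _; rewrite mulr_ge0 ?powR_ge0.
  rewrite -(big_mkord xpredT (fun i => (lambda i * i.+1%:R `^ beta)%:E)).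
  by apply: nneseries_lim_ge => i _ _; rewrite lee_fin mulr_ge0 ?powR_ge0.
move=> /existsNP[i0 /negP]; rewrite -ltNge => li0.
have sq0 i : (i0 <= i)%N -> Num.sqrt (lambda i) = 0.
  move=> ii; apply/eqP; rewrite sqrtr_eq0; apply: le_trans (ltW li0).
  exact: lambda_ni.
pose G i := Num.sqrt (lambda i) ^+ 2 * i.+1%:R `^ beta.
have G0 i : 0 <= G i by rewrite mulr_ge0 ?sqr_ge0 ?powR_ge0.
exists (\sum_(i < i0) G i); first exact: sumr_ge0.
move=> N M N0; apply: le_trans (pos N M (fun i => Num.sqrt (lambda i) ^+ 2) N0 _) _.
  by move=> i; rewrite sqr_ge0.
rewrite ler_wpM2r ?powR_ge0//.
apply: (@le_trans _ _ (\sum_(i < M) G i)).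
  by rewrite big_mkcond /=; apply: ler_sum => i _; case: ifP => // _.
have [Mi|iM] := leqP M i0.
  rewrite (big_ord_widen _ G Mi) big_mkcond /=; apply: ler_sum => i _.
  by case: ifP.
rewrite [leRHS](big_ord_widen _ G (ltnW iM)) [leRHS]big_mkcond /=; apply: ler_sum => i _.
by case: ltnP => // ii; rewrite /G sq0// expr0n mul0r.
Qed.

(** [Zcvg] carries no rate, but the comparison index M may depend on N: it is taken so large that
    the M-th sum is within N^(-beta) of W in mean square. The finite block of terms from N to M is
    then computed by orthogonality. *)
Lemma KL_sum_rate : exists2 C : R, 0 <= C & forall N x, (0 < N)%N -> D x ->
  (\int[P]_w ((KL_sum lambda e Z N x w - W x w) ^+ 2)%:E <= (C * N%:R `^ (- beta))%:E)%E.
Proof.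
have [C C0 HC] := sqrt_eigenvalue_tail.
exists (2 * (s2 * (Ce ^+ 2 * C)) + 2).
  by rewrite addr_ge0// mulr_ge0// mulr_ge0// mulr_ge0 ?sqr_ge0.
move=> N x N0 Dx; set t := N%:R `^ (- beta).
have t0 : 0 < t by rewrite powR_gt0// ltr0n.
have [M0 _ HM] := Zcvg t0; pose M := maxn M0 N.
have := HM M (leq_maxl _ _) x Dx; rewrite unlock => WM.
have NM : (N <= M)%N by rewrite leq_maxr.
have E w : KL_sum lambda e Z N x w - W x w =
  (KL_sum lambda e Z N x w - KL_sum lambda e Z M x w) + - (W x w - KL_sum lambda e Z M x w).
  by ring.
under eq_integral do rewrite E.
apply: le_trans (integral_sqrD_le P measurableT _ _) _.
- by apply: measurable_funB; exact: measurable_KL_sum.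
- by apply: measurable_funN; apply: measurable_funB; [exact: mW|exact: measurable_KL_sum].
rewrite mulrDl [leRHS]EFinD; apply: leeD; last first.
  rewrite EFinM lee_wpmul2l//; apply: le_trans WM.
  by under eq_integral do rewrite sqrrN.
rewrite -mulrA EFinM lee_wpmul2l//.
pose a (i : 'I_M) := if (N <= i)%N then - (Num.sqrt (lambda i) * e i x) else 0.
have Ea w : KL_sum lambda e Z N x w - KL_sum lambda e Z M x w = \sum_(i < M) a i * Z i w.
  rewrite /KL_sum (big_ord_widen _ (fun i => Num.sqrt (lambda i) * Z i w * e i x) NM).
  rewrite big_mkcond -sumrB; apply: eq_bigr => i _ /=; rewrite /a ltnNge.
  by case: (N <= i)%N => /=; rewrite ?subrr ?mul0r// sub0r mulNr mulrAC.
under eq_integral do rewrite Ea.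
rewrite Zsum lee_fin -mulrA ler_wpM2l// -mulrA.
apply: le_trans (ler_wpM2l (sqr_ge0 Ce) (HC N M N0)).
rewrite mulr_sumr [leRHS]big_mkcond /=; apply: ler_sum => i _; rewrite /a.
case: ifP => _; last by rewrite expr0n.
rewrite sqrrN exprMn mulrC ler_wpM2r ?sqr_ge0//.
by rewrite -real_normK ?num_real// lerXn2r ?nnegrE ?(ltW Ce_gt0) ?e_le.
Qed.

Let Lip j := n%:R * (Ce * j.+1%:R `^ alpha).
Let Lip_ge0 j : 0 <= Lip j.
Proof. by rewrite mulr_ge0// mulr_ge0 ?powR_ge0// ltW. Qed.

(** Quadrature weights: paired with the nodal values of a function f, they give the integral of e_i
    times the multilinear interpolant of f. *)
Let c i m (k : {ffun 'I_n -> 'I_m.+1}) :=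
  \int[lebesgue_rV]_(x in D) (e i x * grid_weight L k x).

Let weight_le1 m (k : {ffun 'I_n -> 'I_m.+1}) x : (0 < m)%N -> D x -> grid_weight L k x <= 1.
Proof.
move=> m0 Dx; rewrite -(sum_grid_weight L0 m0 Dx) (bigD1 k)//= lerDl.
by apply: sumr_ge0 => k' _; exact: grid_weight_ge0.
Qed.

Let mweight m (k : {ffun 'I_n -> 'I_m.+1}) : measurable_fun D (grid_weight L k : 'rV[R]_n -> R).
Proof. by apply: measurable_funTS; exact: measurable_grid_weight. Qed.

Let e_weight_le i m (k : {ffun 'I_n -> 'I_m.+1}) x : (0 < m)%N -> D x ->
  `|e i x * grid_weight L k x| <= Ce.
Proof.
move=> m0 Dx; rewrite normrM -[leRHS]mulr1 ler_pM ?e_le//.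
by rewrite ger0_norm ?grid_weight_ge0// weight_le1.
Qed.

Let int_e_weight i m (k : {ffun 'I_n -> 'I_m.+1}) : (0 < m)%N ->
  (@lebesgue_rV R n).-integrable D (EFin \o (fun x => e i x * grid_weight L k x)).
Proof.
move=> m0; apply: (cube_bounded_integrable L0 (M := Ce)).
  exact: measurable_funM.
by move=> x Dx; exact: e_weight_le.
Qed.

(** The bound is independent of m, so the error of a truncated expansion is not amplified when the
    grid is refined. *)
Let sum_c_le i m : (0 < m)%N -> \sum_k `|@c i m k| <= Ce * L ^+ n.
Proof.
move=> m0.
have intw (k : {ffun 'I_n -> 'I_m.+1}) :
    (@lebesgue_rV R n).-integrable D (EFin \o (fun x => Ce * grid_weight L k x)).
  apply: (cube_bounded_integrable L0 (M := Ce)); first exact: measurable_funM.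
  move=> x Dx; rewrite normrM (gtr0_norm Ce_gt0) ger0_norm ?grid_weight_ge0//.
  by rewrite ler_piMr ?(ltW Ce_gt0)// weight_le1.
apply: (@le_trans _ _ (\sum_(k : {ffun 'I_n -> 'I_m.+1})
    \int[lebesgue_rV]_(x in D) (Ce * grid_weight L k x))).
  apply: ler_sum => k _; apply: (le_trans (le_normr_Rintegral mD (int_e_weight i k m0))).
  apply: le_Rintegral => //.
    apply: (cube_bounded_integrable L0 (M := Ce)).
      by apply: measurableT_comp => //; exact: measurable_funM.
    by move=> x Dx; rewrite normr_id e_weight_le.
  move=> x Dx; rewrite normrM (ger0_norm (grid_weight_ge0 _ _ _)).
  by rewrite ler_wpM2r ?grid_weight_ge0 ?e_le.
rewrite -Rintegral_sum_cube//.
rewrite (@eq_Rintegral _ _ _ _ _ (cst Ce)); last first.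
  by move=> x; rewrite inE => Dx; rewrite -mulr_sumr (sum_grid_weight L0 m0 Dx) mulr1.
by rewrite Rintegral_cst// [X in fine X](lebesgue_cubeE n L0).
Qed.

(** The quadrature replaces e_j by its interpolant, which is within Lip j times the mesh of it,
    whereas the exact integral of e_i e_j is given by orthonormality. *)
Let c_dual i j m : (0 < m)%N ->
  `|\sum_k @c i m k * e j (grid_point L k) - (i == j)%:R| <= Ce * (Lip j * (L / m%:R)) * L ^+ n.
Proof.
move=> m0.
have intI : (@lebesgue_rV R n).-integrable D
    (EFin \o (fun x => e i x * multilinear_interpolation L m (e j) x)).
  apply: (cube_bounded_integrable L0 (M := Ce * Ce)).
    apply: measurable_funM => //; apply: measurable_sum => k.
    by apply: measurable_funM => //; exact: mweight.
  move=> x Dx; rewrite normrM ler_pM ?e_le//.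
  rewrite -[X in `|X|]subr0; apply: multilinear_interpolation_dist => // k _.
  by rewrite subr0 e_le//; exact: cube_grid_point.
have inte : (@lebesgue_rV R n).-integrable D (EFin \o (fun x => e i x * e j x)).
  apply: (cube_bounded_integrable L0 (M := Ce * Ce)); first exact: measurable_funM.
  by move=> x Dx; rewrite normrM ler_pM ?e_le.
have -> : \sum_k @c i m k * e j (grid_point L k) =
    \int[lebesgue_rV]_(x in D) (e i x * multilinear_interpolation L m (e j) x).
  rewrite (eq_bigr (fun k : {ffun 'I_n -> 'I_m.+1} => \int[lebesgue_rV]_(x in D)
      (e i x * grid_weight L k x * e j (grid_point L k)))); last first.
    by move=> k _; rewrite RintegralZr//; exact: int_e_weight.
  rewrite -Rintegral_sum_cube//; last first.
    move=> k; apply: (cube_bounded_integrable L0 (M := Ce * Ce)).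
      by apply: measurable_funM => //; exact: measurable_funM.
    move=> x Dx; rewrite normrM ler_pM ?e_weight_le// e_le//.
    exact: cube_grid_point.
  apply: eq_Rintegral => x _; rewrite multilinear_interpolationE mulr_sumr.
  by apply: eq_bigr => k _; rewrite mulrA.
have [_ /(_ i j) <- _] := ebasis; rewrite /inner_L2 -RintegralB//.
apply: cube_Rintegral_le => //.
  apply: measurable_funB; last exact: measurable_funM.
  apply: measurable_funM => //; apply: measurable_sum => k.
  by apply: measurable_funM => //; exact: mweight.
move=> x Dx; rewrite -mulrBr normrM ler_pM ?e_le//.
apply: multilinear_interpolation_dist => // k xk.
apply: (le_trans (basis_lipschitz L0 eC1 grad_e_bounded j (cube_grid_point L0 m0 k) Dx)).
by rewrite distrC; apply: ler_wpM2l xk; exact: Lip_ge0.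
Qed.

(* The coefficient is the L^2 limit of the quadratures of [W] against [e i], which only involve
   the values of [W] at finitely many points. *)
Lemma KL_coef_version i : exists2 h : T -> R,
    measurable_fun [set: g_sigma_algebraType (events_of D W)]
      (h : g_sigma_algebraType (events_of D W) -> R) &
    {ae P, forall w, Num.sqrt (lambda i) * Z i w = h w}.
Proof.
apply: L2_limit_version.
- exact: events_of_measurable.
- exact: measurable_funM.
move=> eps eps0; pose K := Ce * L ^+ n.
have K0 : 0 < K by rewrite mulr_gt0// exprn_gt0.
(* The quadrature of the remainder has second moment at most K^2 eps1 = eps / 4, and squaring a sum
   of two terms doubles it. *)
pose eps1 := eps / (4 * K ^+ 2).
have eps10 : 0 < eps1 by rewrite divr_gt0// mulr_gt0// exprn_gt0.
have [M0 _ HM] := Zcvg eps10; pose M := maxn M0 i.+1.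
have WM x : D x -> (\int[P]_w ((KL_sum lambda e Z M x w - W x w) ^+ 2)%:E <= eps1%:E)%E.
  move=> Dx; have := HM M (leq_maxl _ _) x Dx; rewrite unlock; apply: le_trans.
  by under eq_integral do rewrite -sqrrN opprB.
have iM : (i < M)%N by rewrite leq_maxr.
pose b j := Num.sqrt (lambda j) * (Ce * (Lip j * L) * L ^+ n).
pose B := s2 * \sum_(j < M) b j ^+ 2.
have B0 : 0 <= B by rewrite mulr_ge0// sumr_ge0// => j _; rewrite sqr_ge0.
(* The mesh is chosen after the truncation M, since [B] depends on M. As m >= 1, B / m^2 <= B / m <=
   eps / 4. *)
pose m := (Num.truncn (4 * B / eps)).+1.
have m_gt0 : (0 : R) < m%:R by rewrite ltr0n.
have Bm : B / m%:R ^+ 2 <= eps / 4.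
  rewrite ler_pdivrMr ?exprn_gt0//.
  have := truncnS_gt (4 * B / eps); rewrite -/m ltr_pdivrMr// => Bm.
  apply: (@le_trans _ _ (eps / 4 * m%:R)); first by lra.
  by rewrite ler_wpM2l ?divr_ge0 ?(ltW eps0)// expr2 ler_peMr// ler1n.
exists (fun w => \sum_k @c i m k * W (grid_point L k) w).
  apply: measurable_sum => k; apply: measurable_funM => //.
  by apply: events_of_measurable_fun; exact: cube_grid_point.
pose a (j : 'I_M) := Num.sqrt (lambda j) * ((i == j)%:R - \sum_k @c i m k * e j (grid_point L k)).
(* The first sum is the quadrature error on the truncated expansion, which contains the i-th term
   because i < M; the second is the quadrature of the remainder of the expansion. *)
have E w : Num.sqrt (lambda i) * Z i w - \sum_k @c i m k * W (grid_point L k) w =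
    \sum_(j < M) a j * Z j w +
    \sum_k @c i m k * (KL_sum lambda e Z M (grid_point L k) w - W (grid_point L k) w).
  rewrite [X in _ = _ + X](eq_bigr (fun k => @c i m k * KL_sum lambda e Z M (grid_point L k) w -
      @c i m k * W (grid_point L k) w)); last by move=> k _; rewrite mulrBr.
  rewrite sumrB addrA; congr (_ - _).
  have -> : \sum_k @c i m k * KL_sum lambda e Z M (grid_point L k) w =
      \sum_(j < M) Num.sqrt (lambda j) * (\sum_k @c i m k * e j (grid_point L k)) * Z j w.
    rewrite /KL_sum; under eq_bigr do rewrite mulr_sumr.
    rewrite exchange_big /=; apply: eq_bigr => j _.
    rewrite mulr_sumr mulr_suml; apply: eq_bigr => k _; ring.
  rewrite -big_split /= (bigD1 (Ordinal iM))//= [X in _ = _ + X]big1.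
    by rewrite /a eqxx /=; ring.
  move=> j ji; rewrite /a (_ : (i == j) = false); first by rewrite mulr0n; ring.
  by apply/negbTE; apply: contra ji => /eqP ij; apply/eqP/val_inj.
under eq_integral do rewrite E.
have mKW (k : {ffun 'I_n -> 'I_m.+1}) : measurable_fun setT (fun w => KL_sum lambda e Z M (grid_point L k) w - W (grid_point L k) w).
  by apply: measurable_funB; [exact: measurable_KL_sum|apply: mW; exact: cube_grid_point].
apply: le_trans (integral_sqrD_le P measurableT _ _) _.
- by apply: measurable_sum => j; exact: measurable_funM.
- by apply: measurable_sum => k; exact: measurable_funM.
rewrite (_ : eps = 2 * (eps / 4) + 2 * (eps / 4)); last by lra.
rewrite [leRHS]EFinD; apply: leeD; rewrite [leRHS]EFinM; apply: lee_wpmul2l => //.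
  rewrite Zsum lee_fin; apply: le_trans Bm.
  rewrite /B -mulrA ler_wpM2l// mulr_suml; apply: ler_sum => j _.
  rewrite -expr_div_n -(real_normK (num_real (a j))) lerXn2r ?nnegrE//.
    by rewrite divr_ge0// mulr_ge0 ?sqrtr_ge0// mulr_ge0 ?exprn_ge0 ?(ltW L0)// mulr_ge0 ?(ltW Ce_gt0)// mulr_ge0// ltW.
  rewrite /a normrM (ger0_norm (sqrtr_ge0 _)) /b -[leRHS]mulrA ler_wpM2l ?sqrtr_ge0//.
  rewrite distrC; apply: (le_trans (@c_dual i j m isT)).
  by rewrite le_eqVlt; apply/orP; left; apply/eqP; ring.
apply: le_trans (integral_sqr_sum_le (mu := P) measurableT (c := @c i m)
  (f := fun k w => KL_sum lambda e Z M (grid_point L k) w - W (grid_point L k) w)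
  (B := eps1) mKW _) _.
  by move=> k _; apply: WM; exact: cube_grid_point.
rewrite lee_fin; apply: (@le_trans _ _ (K ^+ 2 * eps1)).
  rewrite ler_wpM2r ?(ltW eps10)// lerXn2r ?nnegrE ?(ltW K0)//; first exact: sumr_ge0.
  exact: sum_c_le.
rewrite /eps1 le_eqVlt; apply/orP; left; apply/eqP; field.
by rewrite gt_eqF.
Qed.

Lemma KL_sum_version N x : D x -> exists2 h : T -> R,
    measurable_fun [set: g_sigma_algebraType (events_of D W)]
      (h : g_sigma_algebraType (events_of D W) -> R) &
    {ae P, forall w, KL_sum lambda e Z N x w = h w}.
Proof.
move=> Dx.
have /choice[h hP] : forall i, exists h : T -> R,
    measurable_fun [set: g_sigma_algebraType (events_of D W)]
      (h : g_sigma_algebraType (events_of D W) -> R) /\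
    {ae P, forall w, Num.sqrt (lambda i) * Z i w = h w}.
  by move=> i; have [h ? ?] := KL_coef_version i; exists h.
exists (fun w => \sum_(i < N) h i w * e i x).
  by apply: measurable_sum => i; apply: measurable_funM => //; exact: (hP i).1.
have := ae_foralln (fun i => (hP i).2); apply: filterS => w Hw.
by apply: eq_bigr => i _; rewrite Hw.
Qed.

Lemma KL_sum_jointly_measurable N :
  measurable_fun ([set: T] `*` D) (fun z : T * 'rV[R]_n => KL_sum lambda e Z N z.2 z.1).
Proof.
apply: measurable_sum => i; apply: measurable_funM.
  apply: measurable_funM => //; apply: measurable_funTS.
  by apply: (measurableT_comp (f := Z i)) => //; exact: mZ.
apply: (measurable_comp (F := D)) => //; last exact: measurable_funTS measurable_snd.
by move=> _ [z [_ Dz] <-].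
Qed.

End karhunen_loeve.

(** * Composition of the Lévy process with the fields *)

Lemma measurable_fun_countable_cases d1 d2 d3 (T1 : measurableType d1)
    (T2 : measurableType d2) (T3 : measurableType d3)
    (Y : nat -> T1 -> T3) (kappa : T2 -> nat) :
  (forall k, measurable_fun setT (Y k)) ->
  (forall k, measurable (kappa @^-1` [set k])) ->
  measurable_fun setT (fun z : T1 * T2 => Y (kappa z.2) z.1).
Proof.
move=> mY mk _ A mA; rewrite setTI.
rewrite (_ : _ @^-1` A = \bigcup_k ((Y k @^-1` A) `*` (kappa @^-1` [set k]))).
  apply: bigcup_measurable => k _; apply: measurableX => //.
  by rewrite -[X in measurable X]setTI; exact: mY.
apply/seteqP; split => -[x y] /=; first by move=> Ax; exists (kappa y).
by move=> [k _ [/= Ax ->]].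
Qed.

Section cadlag_measurability.
Context {R : realType}.

(* Right-continuity: [X] at time [t] is the limit of [X] at the grid times just after [t]. *)
Lemma right_continuous_measurable d1 d2 (T1 : measurableType d1) (T2 : measurableType d2)
    (b : R) (X : R -> T1 -> R) (phi : T2 -> R) : 0 < b ->
  (forall t, 0 <= t <= b -> measurable_fun setT (X t)) ->
  (forall w t, 0 <= t < b -> X s w @[s --> t^'+] --> X t w) ->
  measurable_fun setT phi -> (forall y, 0 <= phi y < b) ->
  measurable_fun setT (fun z : T1 * T2 => X (phi z.2) z.1).
Proof.
move=> b0 mX Xr mphi phib.
pose kappa n y := Num.truncn (n.+1%:R * phi y).
(* The successor makes the grid time strictly later than [phi y], as a limit from the right
   requires. Capping at [b] keeps it in the time interval and preserves strictness because phi y <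
   b. *)
pose tm n k : R := Num.min (k.+1%:R / n.+1%:R) b.
have tm_ge0 n k : 0 <= tm n k <= b.
  by rewrite le_min divr_ge0//= ge_min lexx orbT (ltW b0).
apply: (measurable_fun_cvg (h := fun n z => X (tm n (kappa n z.2)) z.1)).
  move=> n; apply: (measurable_fun_countable_cases (Y := fun k => X (tm n k))).
    by move=> k; exact: mX.
  move=> k.
  have -> : kappa n @^-1` [set k] = (fun y => n.+1%:R * phi y) @^-1` `[k%:R, k.+1%:R[.
    apply/seteqP; split => y /=; rewrite in_itv/=.
      by move=> <-; apply: truncn_itv; rewrite mulr_ge0//; case/andP: (phib y).
    by move=> /truncn_def.
  by rewrite -[X in measurable X]setTI; apply: measurable_funM.
move=> [w y] _ /=.
have /cvg_at_rightP := Xr w (phi y) (phib y).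
apply; split.
  move=> n; have /andP[phi0 phi1] := phib y; rewrite lt_min phi1 andbT.
  by rewrite ltr_pdivlMr// mulrC truncnS_gt.
apply/cvgrPdist_lt => e e0.
near=> n.
have /andP[phi0 phi1] := phib y.
have h1 : phi y < tm n (kappa n y).
  by rewrite lt_min phi1 andbT ltr_pdivlMr// mulrC truncnS_gt.
rewrite ltr0_norm ?subr_lt0// opprB ltrBlDr.
apply: (@le_lt_trans _ _ ((kappa n y).+1%:R / n.+1%:R)); first by rewrite ge_min lexx.
rewrite ltr_pdivrMr// -natr1.
have h2 : (kappa n y)%:R <= n.+1%:R * phi y.
  by have /andP[] := @truncn_itv R (n.+1%:R * phi y) (mulr_ge0 (ler0n _ _) phi0).
apply: (@le_lt_trans _ _ (n.+1%:R * phi y + 1)); first by rewrite lerD2r.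
rewrite mulrDl addrC mulrC ltrD2r.
rewrite mulrC -ltr_pdivrMr//.
near: n; exists (Num.truncn (1 / e)) => // n /= ln.
apply: lt_le_trans (truncnS_gt _) _; by rewrite ler_nat ltnS.
Unshelve. all: by end_near. Qed.

End cadlag_measurability.

Section power_inequalities.
Context {R : realType}.

Lemma powR_normD_le (p a b : R) : 0 <= p ->
  `|a + b| `^ p <= 2 `^ p * (`|a| `^ p + `|b| `^ p).
Proof.
move=> p0.
have h (x y : R) : `|x| <= `|y| -> `|x + y| `^ p <= 2 `^ p * (`|x| `^ p + `|y| `^ p).
  move=> xy; apply: (@le_trans _ _ ((2 * `|y|) `^ p)).
    apply: ge0_ler_powR; rewrite ?nnegrE ?mulr_ge0//.
    by rewrite (le_trans (ler_normD _ _))// mulrDl mul1r lerD2r.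
  by rewrite (powRM _ (ler0n _ 2) (normr_ge0 _)) ler_wpM2l ?powR_ge0// lerDr powR_ge0.
have [ab|/ltW ba] := leP `|a| `|b|; first exact: h.
by rewrite addrC [X in _ * X]addrC; exact: h.
Qed.

(** Below the threshold r the first summand suffices; above it |y| / r >= 1, and raising its
    exponent from delta to 2 only increases it. *)
Lemma powR_le_sqr (delta r y : R) : 0 <= delta -> delta <= 2 -> 0 < r ->
  `|y| `^ delta <= r `^ delta * (1 + y ^+ 2 / r ^+ 2).
Proof.
move=> d0 d2 r0; have rp := powR_ge0 r delta.
have [yr|ry] := leP `|y| r.
  apply: (@le_trans _ _ (r `^ delta)); first by apply: ge0_ler_powR => //; rewrite nnegrE// ltW.
  by rewrite ler_peMr// lerDl divr_ge0// sqr_ge0.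
have z0 : 0 <= `|y| / r by rewrite divr_ge0// ltW.
have {1}-> : `|y| = r * (`|y| / r) by rewrite mulrCA divff ?mulr1// gt_eqF.
rewrite (powRM _ (ltW r0) z0); apply: ler_wpM2l => //.
have z1 : 1 <= `|y| / r by rewrite ler_pdivlMr// mul1r ltW.
apply: (le_trans (ler_powR z1 d2)).
rewrite powR_mulrn ?divr_ge0// ?ltW// expr_div_n real_normK ?num_real//.
by rewrite ltrDr.
Qed.

Lemma powR_sum_root_le (p a b : R) : 1 <= p -> 0 <= a -> 0 <= b ->
  (a + b) `^ p^-1 <= 2 * (a `^ p^-1 + b `^ p^-1).
Proof.
move=> p1 a0 b0; have p0 : 0 <= p^-1 by rewrite invr_ge0 (le_trans ler01).
have := powR_normD_le a b p0; rewrite !ger0_norm ?addr_ge0// => h; apply: (le_trans h).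
rewrite ler_wpM2r ?addr_ge0 ?powR_ge0// -[leRHS]powRr1//.
apply: ler_powR; first by rewrite ler1n.
by rewrite invf_le1// (lt_le_trans ltr01).
Qed.

End power_inequalities.

(** * Moments of the Lévy process and its approximation at deterministic times *)

Section levy_increments.
Context d (T : measurableType d) (R : realType) (P : probability T R).
Variables (CF : R) (l : R -> T -> R) (leps : R -> T -> R) (p delta Cl eps : R).
Hypotheses (p_ge1 : 1 <= p) (eps_gt0 : 0 < eps) (Cl_gt0 : 0 < Cl)
  (ml : forall t, 0 <= t <= CF -> measurable_fun setT (l t))
  (mleps : forall t, 0 <= t <= CF -> measurable_fun setT (leps t))
  (l_stat : stationary_increments P CF l)
  (l_eps : forall t, 0 <= t -> t < CF ->
     ('E_P[(fun w => `|l t w - leps t w| `^ p)%R] <= (Cl * eps)%:E)%E)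
  (l_delta : forall t, 0 <= t -> t < CF ->
     ('E_P[(fun w => `|l t w| `^ p)%R] <= (Cl * t `^ delta)%:E)%E).

Let p_ge0 : 0 <= p. Proof. exact: le_trans p_ge1. Qed.

Lemma measurable_norm_powR (X : T -> R) : measurable_fun setT X ->
  measurable_fun setT (fun w => (`|X w| `^ p)%:E).
Proof.
move=> mX; apply/measurable_EFinP.
by apply: (measurableT_comp (measurable_powR p)); exact: measurableT_comp.
Qed.

Let norm_powR_ge0 (x : R) : (0 <= (`|x| `^ p)%:E)%E.
Proof. by rewrite lee_fin powR_ge0. Qed.

Lemma integral_norm_powRD_le (X Y : T -> R) (a b : R) :
  measurable_fun setT X -> measurable_fun setT Y ->
  (\int[P]_w (`|X w| `^ p)%:E <= a%:E)%E -> (\int[P]_w (`|Y w| `^ p)%:E <= b%:E)%E ->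
  (\int[P]_w (`|X w + Y w| `^ p)%:E <= (2 `^ p * (a + b))%:E)%E.
Proof.
move=> mX mY Xa Yb.
have mXp := measurable_norm_powR mX; have mYp := measurable_norm_powR mY.
apply: (@le_trans _ _ (\int[P]_w ((2 `^ p)%:E * ((`|X w| `^ p)%:E + (`|Y w| `^ p)%:E)))%E).
  apply: ge0_le_integral => //.
  - by apply: measurable_norm_powR; exact: measurable_funD.
  - by apply: measurable_funeM; exact: emeasurable_funD.
  - by move=> w _; rewrite -EFinD -EFinM lee_fin powR_normD_le.
rewrite ge0_integralZl//; last 2 first.
- exact: emeasurable_funD.
- by move=> w _; rewrite adde_ge0.
rewrite EFinM lee_wpmul2l ?lee_fin ?powR_ge0//.
by rewrite ge0_integralD// EFinD leeD.
Qed.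

Lemma levy_increment_moment s t : 0 <= s -> s <= t -> t < CF ->
  (\int[P]_w (`|l t w - l s w| `^ p)%:E <= (Cl * `|t - s| `^ delta)%:E)%E.
Proof.
move=> s0 st tCF; have h0 : 0 <= t - s by rewrite subr_ge0.
have law := l_stat s0 h0; rewrite addrC subrK in law.
have hCF : t - s < CF by rewrite (le_lt_trans _ tCF)// lerBlDr lerDl.
have mpow : measurable_fun setT (fun x : R => (`|x| `^ p)%:E).
  apply/measurable_EFinP.
  by apply: (measurableT_comp (measurable_powR p)); exact: normr_measurable.
rewrite (@equal_in_law_integral _ _ _ P _ (l (t - s)) (fun x => (`|x| `^ p)%:E))//.
- by have := l_delta h0 hCF; rewrite unlock ger0_norm.
- apply: measurable_funB; apply: ml; first by rewrite (le_trans s0)//= ltW.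
  by rewrite s0 (le_trans st)// ltW.
- by apply: ml; rewrite h0 ltW.
- by apply: law; exact: ltW.
Qed.

Lemma levy_approximation_moment s t : 0 <= s < CF -> 0 <= t < CF ->
  (\int[P]_w (`|leps t w - l s w| `^ p)%:E <=
    (2 `^ p * (Cl * eps + Cl * `|t - s| `^ delta))%:E)%E.
Proof.
move=> /andP[s0 sCF] /andP[t0 tCF].
have ms : measurable_fun setT (l s) by apply: ml; rewrite s0 ltW.
have mt : measurable_fun setT (l t) by apply: ml; rewrite t0 ltW.
have me : measurable_fun setT (leps t) by apply: mleps; rewrite t0 ltW.
have E w : leps t w - l s w = (leps t w - l t w) + (l t w - l s w) by ring.
under eq_integral do rewrite E.
apply: integral_norm_powRD_le; [exact: measurable_funB..| |].
  under eq_integral do rewrite distrC.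
  by have := l_eps t0 tCF; rewrite unlock.
have [st|/ltW ts] := leP s t; first exact: levy_increment_moment.
under eq_integral do rewrite distrC.
by rewrite distrC; exact: levy_increment_moment.
Qed.

End levy_increments.

Section independent_composition.
Context d (T : measurableType d) (R : realType) (P : probability T R).
Variables (G H : set (set T)) (CF : R) (X Y : R -> T -> R) (F : R -> R) (LF : R).
Hypotheses (GT : G `<=` measurable) (HT : H `<=` measurable)
  (indep : independent_sigma P G H) (CF_gt0 : 0 < CF)
  (mX : forall t, 0 <= t <= CF ->
    measurable_fun [set: g_sigma_algebraType G] (X t : g_sigma_algebraType G -> R))
  (mY : forall t, 0 <= t <= CF ->
    measurable_fun [set: g_sigma_algebraType G] (Y t : g_sigma_algebraType G -> R))
  (X_right : forall w t, 0 <= t < CF -> X s w @[s --> t^'+] --> X t w)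
  (Y_right : forall w t, 0 <= t < CF -> Y s w @[s --> t^'+] --> Y t w)
  (LF_ge0 : 0 <= LF) (F_lip : forall x y, `|F x - F y| <= LF * `|x - y|)
  (mF : measurable_fun setT F) (F_itv : forall x, 0 <= F x < CF).
Variables (p delta K eps : R).
Hypotheses (K_ge0 : 0 <= K) (eps_ge0 : 0 <= eps)
  (delta_gt0 : 0 < delta) (delta_le1 : delta <= 1)
  (moment : forall s t, 0 <= s < CF -> 0 <= t < CF ->
    (\int[P]_w (`|X t w - Y s w| `^ p)%:E <= (K * (eps + `|t - s| `^ delta))%:E)%E).

Let measurable_id_g_sigma (G' : set (set T)) : G' `<=` measurable ->
  measurable_fun [set: T] (id : T -> g_sigma_algebraType G').
Proof.
move=> G'T _ A mA; rewrite setTI preimage_id; have {mA} : <<s G'>> A by [].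
by apply: smallest_sub => //; exact: sigma_algebra_measurable.
Qed.

(* Conditionally on [H], the processes [X] and [Y] are evaluated at deterministic times. *)
Lemma independent_composition_moment (U V : T -> R) (r C : R) :
  measurable_fun [set: g_sigma_algebraType H] (U : g_sigma_algebraType H -> R) ->
  measurable_fun [set: g_sigma_algebraType H] (V : g_sigma_algebraType H -> R) ->
  0 < r -> (\int[P]_w ((U w - V w) ^+ 2)%:E <= (C * r ^+ 2)%:E)%E ->
  (\int[P]_w (`|X (F (U w)) w - Y (F (V w)) w| `^ p)%:E <=
    (K * (eps + LF `^ delta * r `^ delta * (1 + C)))%:E)%E.
Proof.
move=> mU mV r0 UV.
have mU' := g_sigma_measurable_fun HT mU; have mV' := g_sigma_measurable_fun HT mV.
pose f (z : g_sigma_algebraType G * g_sigma_algebraType H) :=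
  (`|X (F (U z.2)) z.1 - Y (F (V z.2)) z.1| `^ p)%:E.
(* By [powR_le_sqr] the conditional moment is at most a + b (U - V)^2, which is linear in the one
   quantity whose mean is known. *)
pose a := K * (eps + LF `^ delta * r `^ delta).
pose b := K * (LF `^ delta * r `^ delta / r ^+ 2).
have a0 : 0 <= a by rewrite mulr_ge0// addr_ge0// mulr_ge0// powR_ge0.
have b0 : 0 <= b by rewrite mulr_ge0// divr_ge0 ?sqr_ge0// mulr_ge0// powR_ge0.
pose c (y : g_sigma_algebraType H) := (a + b * (U y - V y) ^+ 2)%:E.
have mUV2 : measurable_fun [set: g_sigma_algebraType H] (fun y => (U y - V y) ^+ 2).
  by apply: measurable_funX; exact: measurable_funB.
apply: (@le_trans _ _ (\int[P]_w c w)%E).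
  (* The independent pair is the identity taken twice, into the sigma-algebras of [G] and of [H];
     freezing the second copy fixes both times F(U) and F(V). *)
  apply: (@ge0_integral_indep_le _ _ _ T (g_sigma_algebraType G) (g_sigma_algebraType H)
    R P id id _ _ _ f c).
  - exact: measurable_id_g_sigma.
  - exact: measurable_id_g_sigma.
  - by move=> A B mA mB; exact: indep.
  - apply/measurable_EFinP.
    apply: (measurableT_comp (measurable_powR p)); apply: measurableT_comp => //.
    apply: measurable_funB.
      apply: (@right_continuous_measurable R _ _ (g_sigma_algebraType G)
        (g_sigma_algebraType H) CF X (F \o U)) => //; first exact: measurableT_comp.
      by move=> y; exact: F_itv.
    apply: (@right_continuous_measurable R _ _ (g_sigma_algebraType G)
        (g_sigma_algebraType H) CF Y (F \o V)) => //; first exact: measurableT_comp.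
    by move=> y; exact: F_itv.
  - by move=> z; rewrite lee_fin powR_ge0.
  - by apply/measurable_EFinP; apply: measurable_funD => //; exact: measurable_funM.
  - move=> y; apply: (le_trans (moment (F_itv (V y)) (F_itv (U y)))).
    rewrite lee_fin /a /b -mulrA -mulrDr ler_wpM2l// -addrA lerD2l.
    apply: (@le_trans _ _ ((LF * `|U y - V y|) `^ delta)).
      by apply: ge0_ler_powR; rewrite ?nnegrE ?mulr_ge0// ltW.
    rewrite powRM//.
    apply: (@le_trans _ _ (LF `^ delta * (r `^ delta * (1 + (U y - V y) ^+ 2 / r ^+ 2)))).
      rewrite ler_wpM2l ?powR_ge0//; apply: powR_le_sqr; [exact: ltW| |exact: r0].
      by rewrite (le_trans delta_le1)// ler1n.
    by rewrite le_eqVlt; apply/orP; left; apply/eqP; ring.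
rewrite /c; under eq_integral do rewrite EFinD (EFinM b).
have mUV : measurable_fun setT (fun w => ((U w - V w) ^+ 2)%:E).
  by apply/measurable_EFinP; apply: measurable_funX; exact: measurable_funB.
rewrite ge0_integralD//; last 2 first.
- by move=> w _; rewrite -EFinM lee_fin mulr_ge0// sqr_ge0.
- exact: measurable_funeM.
rewrite integral_cst// [X in (_ * X)%E]probability_setT mule1.
rewrite ge0_integralZl//; last by move=> w _; rewrite lee_fin sqr_ge0.
apply: (@le_trans _ _ (a%:E + b%:E * (C * r ^+ 2)%:E)%E).
  by rewrite leeD2l// lee_wpmul2l// lee_fin.
rewrite -EFinM -EFinD lee_fin /a /b le_eqVlt; apply/orP; left; apply/eqP.
by field; rewrite gt_eqF.
Qed.

End independent_composition.

(** [phi] is measurable only over [E]; outside [E] the time is set to the default value 0, which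
    still lies in [0, b). Pairing [pi] with the identity reduces to the case of independent
    arguments. *)
Lemma right_continuous_measurable_comp d1 d2 (T1 : measurableType d1) (T2 : measurableType d2)
    (R : realType) (b : R) (X : R -> T1 -> R) (phi : T2 -> R) (pi : T2 -> T1) (E : set T2) :
  0 < b -> (forall t, 0 <= t <= b -> measurable_fun setT (X t)) ->
  (forall w t, 0 <= t < b -> X s w @[s --> t^'+] --> X t w) ->
  measurable E -> measurable_fun E phi -> (forall y, 0 <= phi y < b) ->
  measurable_fun setT pi ->
  measurable_fun E (fun y => X (phi y) (pi y)).
Proof.
move=> b0 mX Xr mE mphi phib mpi.
apply: (eq_measurable_fun (fun y => X ((phi \_ E) y) (pi y))).
  by move=> y Ey; rewrite patchE Ey.
apply: measurable_funTS.
apply: (measurableT_comp (f := fun z : T1 * T2 => X ((phi \_ E) z.2) z.1)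
  (g := fun y => (pi y, y))); last exact: measurable_fun_pair.
apply: (right_continuous_measurable (b := b)) => //.
  by move: mphi => /(measurable_restrictT _ mE).
by move=> y; rewrite patchE; case: ifPn => // _; rewrite lexx.
Qed.

(** Joint measurability is known only over [D], so Tonelli is applied to the extension of [f] by 0;
    exchanging the integrals exposes the bound at each fixed y. *)
Lemma ge0_iterated_integral_le d1 d2 (T1 : measurableType d1) (T2 : measurableType d2)
    (R : realType) (m1 : {sigma_finite_measure set T1 -> \bar R})
    (m2 : {sigma_finite_measure set T2 -> \bar R}) (D : set T2) (f : T1 * T2 -> \bar R)
    (B : R) :
  measurable D -> measurable_fun ([set: T1] `*` D) f -> (forall z, 0 <= f z)%E -> 0 <= B ->
  (forall y, D y -> \int[m1]_x f (x, y) <= B%:E)%E ->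
  (\int[m1]_x \int[m2]_(y in D) f (x, y) <= B%:E * m2 D)%E.
Proof.
move=> mD mf f0 B0 fB.
have mTD : measurable ([set: T1] `*` D) by exact: measurableX.
pose h := f \_ ([set: T1] `*` D).
have hE x y : h (x, y) = ((fun y => f (x, y)) \_ D) y.
  by rewrite /h !patchE; congr (if _ then _ else _); apply/idP/idP;
    rewrite !inE /=; [case|split].
have mh : measurable_fun setT h by exact/(measurable_restrictT _ mTD).
have h0 z : (0 <= h z)%E by rewrite /h patchE; case: ifPn.
rewrite (eq_integral (fun x => \int[m2]_y h (x, y))%E); last first.
  by move=> x _; rewrite [LHS]integral_mkcond; apply: eq_integral => y _; rewrite hE.
rewrite (@fubini_tonelli _ _ _ _ _ m1 m2 h mh h0) -integral_cst// [leRHS]integral_mkcond.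
apply: ge0_le_integral => //.
- by move=> y _; exact: integral_ge0.
- exact: measurable_fun_fubini_tonelli_G.
- by apply/(measurable_restrictT _ mD); exact: measurable_cst.
- move=> y _; under eq_integral do rewrite hE.
  rewrite patchE; under eq_integral do rewrite patchE.
  by case: ifPn => [/set_mem/fB//|_]; rewrite integral0.
Qed.

Section field_approximation.
Context d (T : measurableType d) (R : realType) (P : probability T R).
Variables (n : nat) (L : R) (W : 'rV[R]_n -> T -> R).
Local Notation D := (cube n L).
Variables (lambda : nat -> R) (e : nat -> 'rV[R]_n -> R) (alpha beta Ce Clambda : R).
Hypotheses (n_gt0 : (0 < n)%N) (L0 : 0 < L) (WG : gaussian_random_field P D W)
  (Wmean : forall x, D x -> 'E_P[W x]%E = 0%E)
  (eigenpairs : covariance_eigenpairs P D W lambda e)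
  (eC1 : forall i, continuously_differentiable_on D (e i))
  (alpha_gt0 : 0 < alpha) (beta_gt0 : 0 < beta) (Ce_gt0 : 0 < Ce)
  (e_bounded : forall i, ('N[lebesgue_cube n L]_+oo[EFin \o e i] <= Ce%:E)%E)
  (grad_e_bounded : forall i,
     ('N[lebesgue_cube n L]_+oo[
         (fun x => (euclidean_norm (gradient (e i) x))%:E)]
       <= (Ce * i.+1%:R `^ alpha)%:E)%E)
  (lambda_summable :
     (\sum_(0 <= i <oo) (lambda i * i.+1%:R `^ beta)%:E <= Clambda%:E)%E).
Variables (WN : nat -> 'rV[R]_n -> T -> R) (rate : nat -> R).
Hypothesis WN_approx : field_approximation P L alpha beta lambda e W WN rate.

(** All that the composition argument uses about [W^N], in a form that no longer distinguishes the
    two approximations. *)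
Lemma field_approximation_bound : exists2 C : R, 0 <= C & forall N, (0 < N)%N ->
  [/\ 0 < rate N,
      measurable_fun ([set: T] `*` D) (fun z : T * 'rV[R]_n => WN N z.2 z.1)
    & forall x, D x ->
        (\int[P]_w ((WN N x w - W x w) ^+ 2)%:E <= (C * rate N ^+ 2)%:E)%E /\
        exists2 h : T -> R,
          measurable_fun [set: g_sigma_algebraType (events_of D W)]
            (h : g_sigma_algebraType (events_of D W) -> R) &
          {ae P, forall w, WN N x w = h w}].
Proof.
have [ebasis _ lambda_ni] := eigenpairs.
case: WN_approx => [[[Z [Zn Zcvg WNE]] rateE]|[WN_grid [gamma gamma_lt rateE]]].
- have [s2 s20 Zsum] := iid_standard_normal_sum_sqr Zn; have [mZ _ _] := Zn.
  have [C C0 HC] := KL_sum_rate L0 WG lambda_ni eC1 beta_gt0 Ce_gt0 e_bounded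
    lambda_summable mZ s20 Zsum Zcvg.
  exists C => // N N0; split.
  + by rewrite rateE// powR_gt0// ltr0n.
  + apply: (eq_measurable_fun (fun z : T * 'rV[R]_n => KL_sum lambda e Z N z.2 z.1)).
      by move=> z; rewrite inE => -[_ Dz]; rewrite WNE.
    exact: (KL_sum_jointly_measurable lambda ebasis mZ).
  + move=> x Dx; split.
      under eq_integral do rewrite WNE//.
      apply: (le_trans (HC N x N0 Dx)); rewrite lee_fin ler_wpM2l// rateE//.
      rewrite -powR_mulrn ?powR_ge0// -powRrM le_eqVlt; apply/orP; left; apply/eqP.
      by congr powR; field.
    have [h mh hE] := KL_sum_version L0 WG ebasis eC1 Ce_gt0 e_bounded grad_e_bounded
      mZ s20 Zsum Zcvg N Dx.
    by exists h => //; apply: filterS hE => w <-; exact: WNE.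
- have [C C0 HC] := grid_approximation_rate n_gt0 L0 WG Wmean eigenpairs eC1 alpha_gt0
    beta_gt0 Ce_gt0 e_bounded grad_e_bounded lambda_summable WN_grid gamma_lt rateE.
  exists C => // N N0; split.
  + by rewrite rateE// powR_gt0// ltr0n.
  + exact: (grid_approximation_measurable L0 WG WN_grid N0).
  + by move=> x Dx; split; [exact: HC|exact: grid_approximation_version].
Qed.

End field_approximation.

(** * Lipschitz maps and the assembly of the estimate *)

Lemma lipschitz_real (R : realType) (f : R -> R) : [lipschitz f x | x in [set: R]] ->
  exists2 k : R, 0 <= k & forall x y, `|f x - f y| <= k * `|x - y|.
Proof.
move=> /(filterI (nbhs_pinfty_ge (num_real 0)))/filter_ex[k [k0 fk]].
by exists k => // x y; apply: (fk (x, y)).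
Qed.

Lemma lipschitz_measurable (R : realType) (f : R -> R) (k : R) : 0 <= k ->
  (forall x y, `|f x - f y| <= k * `|x - y|) -> measurable_fun setT f.
Proof.
move=> k0 fk; apply: continuous_measurable_fun => x.
have k1 : 0 < k + 1 by rewrite ltr_wpDl.
apply/cvgrPdist_le => e e0; near=> y.
apply: (le_trans (fk _ _)).
apply: (@le_trans _ _ ((k + 1) * `|x - y|)); first by rewrite ler_wpM2r// lerDl.
rewrite mulrC -ler_pdivlMr//; near: y.
by apply: cvgr_dist_le => //; rewrite divr_gt0.
Unshelve. all: by end_near. Qed.

Theorem theorem5p6 (R : realType)
    (disp : measure_display) (Omega : measurableType disp)
    (P : probability Omega R) (Pcomplete : measure_is_complete P)
    (d : nat) (d_gt0 : (0 < d)%N) (L : R) (L_gt0 : 0 < L)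
    (W : 'rV[R]_d -> Omega -> R)
    (WGauss : gaussian_random_field P (cube d L) W)
    (Wmean : forall x, cube d L x -> 'E_P[W x]%E = 0%E)
    (lambda : nat -> R) (e : nat -> 'rV[R]_d -> R)
    (eigenpairs : covariance_eigenpairs P (cube d L) W lambda e)
    (eC1 : forall i, continuously_differentiable_on (cube d L) (e i))
    (alpha beta Ce Clambda : R)
    (alpha_gt0 : 0 < alpha) (beta_gt0 : 0 < beta)
    (Ce_gt0 : 0 < Ce) (Clambda_gt0 : 0 < Clambda)
    (e_bounded : forall i,
       ('N[lebesgue_cube d L]_+oo[EFin \o e i] <= Ce%:E)%E)
    (grad_e_bounded : forall i,
       ('N[lebesgue_cube d L]_+oo[
           (fun x => (euclidean_norm (gradient (e i) x))%:E)]
         <= (Ce * i.+1%:R `^ alpha)%:E)%E)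
    (lambda_summable :
       (\sum_(0 <= i <oo) (lambda i * i.+1%:R `^ beta)%:E <= Clambda%:E)%E)
    (F : R -> R) (CF : R) (CF_gt0 : 0 < CF)
    (F_lipschitz : [lipschitz F x | x in [set: R]])
    (F_ge0 : forall x, 0 <= F x) (F_lt : forall x, F x < CF)
    (l : R -> Omega -> R) (gamma_l b : R) (nu : {measure set R -> \bar R})
    (l_levy : levy_process P CF l)
    (l_triplet : levy_triplet P CF l gamma_l b nu)
    (eta : R) (eta_gt1 : 1 < eta)
    (leps : R -> R -> Omega -> R)
    (leps_cadlag : forall eps, 0 < eps -> cadlag_process CF (leps eps))
    (* l, together with its approximation, is independent of W *)
    (l_indep_W : forall eps, 0 < eps ->
       independent_sigma P
         (events_of `[0, CF] l `|` events_of `[0, CF] (leps eps))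
         (events_of (cube d L) W))
    (delta : R) (delta_gt0 : 0 < delta) (delta_le1 : delta <= 1)
    (l_moments : forall s, 1 <= s -> s < eta ->
       exists2 Cl : R, 0 < Cl &
         forall t, 0 <= t -> t < CF ->
           (forall eps, 0 < eps ->
              ('E_P[(fun w => `|l t w - leps eps t w| `^ s)%R]
                 <= (Cl * eps)%:E)%E) /\
           ('E_P[(fun w => `|l t w| `^ s)%R] <= (Cl * t `^ delta)%:E)%E)
    (WN : nat -> 'rV[R]_d -> Omega -> R) (rate : nat -> R)
    (WN_approx :
       field_approximation P L alpha beta lambda e W WN rate)
    (p : R) (p_ge1 : 1 <= p) (p_lt : p < eta)
    (g : R -> R) (g_lipschitz : [lipschitz g x | x in [set: R]]) :
  exists2 C : R, 0 < C &
    forall (N : nat) (eps : R), (0 < N)%N -> 0 < eps ->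
      (LpLp_norm P (cube d L) p
         (fun x w => g (leps eps (F (WN N x w)) w) - g (l (F (W x w)) w))%R
       <= (C * (eps `^ p^-1 + rate N `^ (delta / p)))%:E)%E.
Proof.
have [LF LF0 FL] := lipschitz_real F_lipschitz.
have [Lg Lg0 gL] := lipschitz_real g_lipschitz.
have mF := lipschitz_measurable LF0 FL; have mg := lipschitz_measurable Lg0 gL.
have F_itv y : 0 <= F y < CF by rewrite F_ge0 F_lt.
have [Cl Cl0 Hl] := l_moments p p_ge1 p_lt.
have [C C0 HC] := field_approximation_bound d_gt0 L_gt0 WGauss Wmean eigenpairs eC1
  alpha_gt0 beta_gt0 Ce_gt0 e_bounded grad_e_bounded lambda_summable WN_approx.
have [[ml lcadlag] _ _ l_stat _] := l_levy.
have l_right w t : 0 <= t < CF -> l s w @[s --> t^'+] --> l t w := (lcadlag w).1 t.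
have p_gt0 : 0 < p by rewrite (lt_le_trans ltr01).
have p_ge0 := ltW p_gt0.
have delta_ge0 := ltW delta_gt0.
pose K := 2 `^ p * Cl; pose A := LF `^ delta * (1 + C).
have K0 : 0 <= K by rewrite mulr_ge0 ?powR_ge0// ltW.
have A0 : 0 <= A by rewrite mulr_ge0 ?powR_ge0// addr_ge0.
(* The factors are the Lipschitz constant of [g], the moment constant and the volume of the cube; 1
   + A dominates both the coefficient 1 of eps and the coefficient A of R(N)^delta. *)
pose M := Lg `^ p * (K * (1 + A)) * L ^+ d.
have M0 : 0 <= M by rewrite mulr_ge0 ?exprn_ge0 ?(ltW L_gt0)// mulr_ge0 ?powR_ge0// mulr_ge0// addr_ge0.
(* The 2 is the constant of [powR_sum_root_le]; adding 1 ensures positivity, as M is 0 when [Lg]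
   is. *)
exists (M `^ p^-1 * 2 + 1); first by rewrite ltr_wpDl// mulr_ge0// powR_ge0.
move=> N eps N0 eps0; have eps_ge0 := ltW eps0.
have [r0 mWN bWN] := HC N N0; set r := rate N in r0 bWN *.
have rd0 := powR_ge0 r delta.
have [mleps lepscadlag] := leps_cadlag eps eps0.
have leps_right w t : 0 <= t < CF -> leps eps s w @[s --> t^'+] --> leps eps t w :=
  (lepscadlag w).1 t.
have mD := @measurable_cube R d L.
pose B := Lg `^ p * (K * (eps + LF `^ delta * r `^ delta * (1 + C))).
have B0 : 0 <= B.
  rewrite mulr_ge0 ?powR_ge0// mulr_ge0// addr_ge0// mulr_ge0 ?addr_ge0//.
  by rewrite mulr_ge0// powR_ge0.
have BM : B * L ^+ d <= M * (eps + r `^ delta).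
  rewrite -subr_ge0.
  rewrite (_ : _ - _ = Lg `^ p * (K * (r `^ delta + A * eps)) * L ^+ d); last first.
    by rewrite /M /B /A; ring.
  rewrite mulr_ge0 ?exprn_ge0 ?(ltW L_gt0)// mulr_ge0 ?powR_ge0// mulr_ge0// addr_ge0//.
  exact: mulr_ge0.
pose G := events_of `[0, CF] l `|` events_of `[0, CF] (leps eps).
have GO : G `<=` measurable.
  by rewrite subUset; split; apply: events_of_measurable => t /=; rewrite in_itv/=;
    [exact: ml|exact: mleps].
have HO : events_of (cube d L) W `<=` measurable.
  by apply: events_of_measurable => x; exact: (field_measurable WGauss).
have mlG t : 0 <= t <= CF ->
    measurable_fun [set: g_sigma_algebraType G] (l t : g_sigma_algebraType G -> R).
  move=> tCF _ Y mY; apply: sub_sigma_algebra; left; exists t; first by rewrite /= in_itv.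
  by exists Y => //; rewrite setTI.
have mlepsG t : 0 <= t <= CF ->
    measurable_fun [set: g_sigma_algebraType G] (leps eps t : g_sigma_algebraType G -> R).
  move=> tCF _ Y mY; apply: sub_sigma_algebra; right; exists t; first by rewrite /= in_itv.
  by exists Y => //; rewrite setTI.
have moment s t : 0 <= s < CF -> 0 <= t < CF ->
    (\int[P]_w (`|leps eps t w - l s w| `^ p)%:E <= (K * (eps + `|t - s| `^ delta))%:E)%E.
  move=> sCF tCF; rewrite /K -mulrA mulrDr.
  apply: (levy_approximation_moment (CF := CF) p_ge1 ml mleps l_stat) => // u u0 uCF.
    exact: (Hl u u0 uCF).1.
  exact: (Hl u u0 uCF).2.
have mleps_comp (U : Omega -> R) : measurable_fun setT U ->
    measurable_fun setT (fun w => leps eps (F (U w)) w).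
  move=> mU; apply: (right_continuous_measurable_comp (b := CF) (phi := F \o U) (pi := id)) => //.
    exact: measurableT_comp.
  by move=> y; exact: F_itv.
have ml_comp (U : Omega -> R) : measurable_fun setT U ->
    measurable_fun setT (fun w => l (F (U w)) w).
  move=> mU; apply: (right_continuous_measurable_comp (b := CF) (phi := F \o U) (pi := id)) => //.
    exact: measurableT_comp.
  by move=> y; exact: F_itv.
have pointwise x : cube d L x -> (\int[P]_w (`|g (leps eps (F (WN N x w)) w) -
    g (l (F (W x w)) w)| `^ p)%:E <= B%:E)%E.
  move=> Dx; have [WNW [h mh hE]] := bWN x Dx.
  have mWNx : measurable_fun setT (WN N x).
    apply: (measurable_comp (F := [set: Omega] `*` cube d L) _ _ mWN (g := fun w => (w, x))).
    - exact: measurableX.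
    - by move=> _ [w _ <-].
    - exact: measurable_fun_pair.
  have mWx := field_measurable WGauss Dx.
  have mh' := g_sigma_measurable_fun HO mh.
  (* [W^N(x)] is replaced by its version [h], because independence is available only for the
     sigma-algebra generated by [W]; the integrals see no difference. *)
  apply: (@le_trans _ _ (\int[P]_w ((Lg `^ p)%:E *
      (`|leps eps (F (h w)) w - l (F (W x w)) w| `^ p)%:E))%E).
    apply: ae_ge0_le_integral => //.
    - apply: measurable_norm_powR; apply: measurable_funB; apply: measurableT_comp => //.
        exact: mleps_comp.
      exact: ml_comp.
    - by move=> w _; rewrite -EFinM lee_fin mulr_ge0// powR_ge0.
    - apply: measurable_funeM; apply: measurable_norm_powR.
      by apply: measurable_funB; [exact: mleps_comp|exact: ml_comp].
    - apply: filterS hE => w -> _; rewrite -EFinM lee_fin -powRM//.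
      by apply: ge0_ler_powR; rewrite ?nnegrE ?mulr_ge0.
  have mint : measurable_fun setT (fun w => (`|leps eps (F (h w)) w - l (F (W x w)) w| `^ p)%:E).
    apply: measurable_norm_powR.
    by apply: measurable_funB; [exact: mleps_comp|exact: ml_comp].
  rewrite ge0_integralZl//; last by rewrite lee_fin powR_ge0.
  rewrite /B EFinM; apply: lee_wpmul2l; first by rewrite lee_fin powR_ge0.
  apply: (@independent_composition_moment _ _ _ P G (events_of (cube d L) W) CF
    (leps eps) l F LF GO HO (l_indep_W eps eps0)) => //.
    by move=> _ Y mY; apply: sub_sigma_algebra; exists x => //; exists Y => //; rewrite setTI.
  rewrite (ge0_ae_eq_integral (g := fun w => ((WN N x w - W x w) ^+ 2)%:E)) => //.
  - by apply/measurable_EFinP; apply: measurable_funX; exact: measurable_funB.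
  - by apply/measurable_EFinP; apply: measurable_funX; exact: measurable_funB.
  - by move=> w _; rewrite lee_fin sqr_ge0.
  - by move=> w _; rewrite lee_fin sqr_ge0.
  - by apply: filterS hE => w -> _.
have mjoint (X : R -> Omega -> R) (V : 'rV[R]_d -> Omega -> R) :
    (forall t, 0 <= t <= CF -> measurable_fun setT (X t)) ->
    (forall w t, 0 <= t < CF -> X s w @[s --> t^'+] --> X t w) ->
    measurable_fun ([set: Omega] `*` cube d L) (fun z : Omega * 'rV[R]_d => V z.2 z.1) ->
    measurable_fun ([set: Omega] `*` cube d L)
      (fun z : Omega * 'rV[R]_d => X (F (V z.2 z.1)) z.1).
  move=> mX Xr mV; apply: (right_continuous_measurable_comp (b := CF)
    (phi := fun z : Omega * 'rV[R]_d => F (V z.2 z.1)) (pi := fst)) => //.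
    exact: measurableX.
  exact: (measurableT_comp (f := F)).
have [_ _ mW] := WGauss.
have integral_le : (\int[P]_w \int[lebesgue_rV]_(x in cube d L)
    (`|g (leps eps (F (WN N x w)) w) - g (l (F (W x w)) w)| `^ p)%:E <=
    (M * (eps + r `^ delta))%:E)%E.
  (* The bound at a fixed point of the cube is uniform, so exchanging the two integrals costs only
     the volume. *)
  apply: (@le_trans _ _ (B%:E * lebesgue_rV (cube d L))%E).
    apply: (@ge0_iterated_integral_le _ _ Omega 'rV[R]_d R P lebesgue_rV (cube d L)
      (fun z => (`|g (leps eps (F (WN N z.2 z.1)) z.1) - g (l (F (W z.2 z.1)) z.1)| `^ p)%:E) B)
      => //.
    apply/measurable_EFinP; apply: (measurableT_comp (measurable_powR p)).
    apply: measurableT_comp => //; apply: measurable_funB.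
      by apply: (measurableT_comp (f := g)) => //; exact: (mjoint (leps eps) (WN N)).
    by apply: (measurableT_comp (f := g)) => //; exact: (mjoint l W).
  by rewrite [X in (_ * X)%E](lebesgue_cubeE d L_gt0) -EFinM lee_fin.
have pV0 : 0 <= p^-1 by rewrite invr_ge0.
rewrite /LpLp_norm; apply: (@le_trans _ _ ((M * (eps + r `^ delta))%:E `^ p^-1)%E).
  apply: gt0_ler_poweR => //; rewrite in_itv/= leey andbT.
    apply: integral_ge0 => w _; apply: integral_ge0 => x _.
    by rewrite lee_fin powR_ge0.
  by rewrite lee_fin mulr_ge0// addr_ge0.
rewrite poweR_EFin lee_fin powRM ?addr_ge0//.
apply: (@le_trans _ _ (M `^ p^-1 * (2 * (eps `^ p^-1 + r `^ (delta / p))))).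
  rewrite ler_wpM2l ?powR_ge0// powRrM; exact: powR_sum_root_le.
by rewrite mulrA ler_wpM2r ?addr_ge0 ?powR_ge0// lerDl.
Qed.
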